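(* Let $n\ge 1$ and let $X(\mathbb{R}^n)$ be a Banach function space satisfying the weak doubling property. If $a\in\mathcal{M}_{X(\mathbb{R}^n)}\subset S'(\mathbb{R}^n)$, then $a\in L^\infty(\mathbb{R}^n)$ and \[ \|a\|_{L^\infty(\mathbb{R}^n)}\le\|a\|_{\mathcal{M}_{X(\mathbb{R}^n)}}. \] The constant $1$ on the right-hand side is best possible, i.e. it cannot be replaced by any smaller constant.
   Context: Banach function spaces: let $\mathfrak{M}^+(\mathbb{R}^n)$ be the set of Lebesgue measurable functions on $\mathbb{R}^n$ with values in $[0,\infty]$. A Banach function norm is a map $\rho:\mathfrak{M}^+(\mathbb{R}^n)\to[0,\infty]$ such that for all $f,g,f_j\in\mathfrak{M}^+(\mathbb{R}^n)$, all constants $a\ge0$ and all measurable $E\subset\mathbb{R}^n$: (A1) $\rho(f)=0\iff f=0$ a.e., $\rho(af)=a\rho(f)$, $\rho(f+g)\le\rho(f)+\rho(g)$; (A2) $0\le g\le f$ a.e. implies $\rho(g)\le\rho(f)$; (A3) $0\le f_j\uparrow f$ a.e. implies $\rho(f_j)\uparrow\rho(f)$; (A4) $|E|<\infty$ implies $\rho(\chi_E)<\infty$; (A5) $|E|<\infty$ implies $\int_E f\,dx\le C_E\rho(f)$ with $C_E\in(0,\infty)$ independent of $f$. The Banach function space $X(\mathbb{R}^n)$ is the set of measurable complex-valued $f$ with $\rho(|f|)<\infty$ (a.e.-equal functions identified), normed by $\|f\|_{X(\mathbb{R}^n)}=\rho(|f|)$. $B(y,R)$ is the open ball of radius $R$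 centered at $y$, $\chi_E$ the characteristic function of $E$. Weak doubling property: $X(\mathbb{R}^n)$ has it if there is $\tau>1$ with $\liminf_{R\to\infty}\big(\inf_{y\in\mathbb{R}^n}\|\chi_{B(y,\tau R)}\|_{X(\mathbb{R}^n)}/\|\chi_{B(y,R)}\|_{X(\mathbb{R}^n)}\big)<\infty$. Fourier multipliers: $(Fu)(\xi)=\int_{\mathbb{R}^n}u(x)e^{-ix\xi}dx$ on the Schwartz space $S(\mathbb{R}^n)$, extended to tempered distributions $S'(\mathbb{R}^n)$ as usual. For $a\in S'(\mathbb{R}^n)$ and $u\in S(\mathbb{R}^n)$, $F^{-1}aFu$ is a smooth polynomially bounded function. $\mathcal{M}_{X(\mathbb{R}^n)}$ is the set of $a\in S'(\mathbb{R}^n)$ with $\|a\|_{\mathcal{M}_{X(\mathbb{R}^n)}}:=\sup\{\|F^{-1}aFu\|_{X(\mathbb{R}^n)}/\|u\|_{X(\mathbb{R}^n)}: u\in (S(\mathbb{R}^n)\cap X(\mathbb{R}^n))\setminus\{0\}\}<\infty$. *)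

(* Defs.v *)
From HB Require Import structures.
From mathcomp Require Import all_boot all_order all_algebra.
From mathcomp Require Import all_classical all_reals all_analysis.
From mathcomp Require Import complex.

Set Implicit Arguments.
Unset Strict Implicit.
Unset Printing Implicit Defensive.

Import Order.TTheory GRing.Theory Num.Theory.
Import numFieldNormedType.Exports.

Local Open Scope classical_set_scope.
Local Open Scope ring_scope.
Local Open Scope complex_scope.

Section FourierMultipliers.
Context {R : realType} {n : nat}.

Notation vec := 'rV[R]_n.

Definition dotp (x y : vec) : R := \sum_(i < n) x ord0 i * y ord0 i.
Definition enorm (x : vec) : R := Num.sqrt (dotp x x).
Definition eball (y : vec) (r : R) : set vec := [set x | enorm (x - y) < r].

Definition obox (a b : vec) : set vec :=
  [set x | forall i : 'I_n, a ord0 i < x ord0 i < b ord0 i].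
Definition boxvol (a b : vec) : R :=
  \prod_(i < n) Num.max 0 (b ord0 i - a ord0 i).
Definition lebesgue_outer (A : set vec) : \bar R :=
  ereal_inf [set (\sum_(k <oo) (boxvol (ab k).1 (ab k).2)%:E)%E
            | ab in [set ab : (vec * vec)^nat |
                       A `<=` \bigcup_k obox (ab k).1 (ab k).2]].

Definition lebesgue_measurable_set (A : set vec) : Prop :=
  forall B : set vec,
    lebesgue_outer B = (lebesgue_outer (B `&` A) + lebesgue_outer (B `\` A))%E.

Definition ae (P : vec -> Prop) : Prop :=
  exists N : set vec, lebesgue_outer N = 0%E /\ forall x, ~ N x -> P x.

Definition lmeas_efun (f : vec -> \bar R) : Prop :=
  forall c : R, lebesgue_measurable_set [set x | (f x < c%:E)%E].
Definition lmeas_rfun (f : vec -> R) : Prop :=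
  forall c : R, lebesgue_measurable_set [set x | f x < c].
Definition lmeas_cfun (f : vec -> R[i]) : Prop :=
  lmeas_rfun (fun x => complex.Re (f x)) /\ lmeas_rfun (fun x => complex.Im (f x)).

Definition Mplus (f : vec -> \bar R) : Prop :=
  lmeas_efun f /\ forall x, (0 <= f x)%E.

(** Lebesgue integral.  The integral is taken with the library's integral
    over the Borel sigma-algebra generated by the open boxes, with respect
    to (the restriction of) the Lebesgue outer measure. *)
Definition boxes : set (set vec) := [set B | exists a b, B = obox a b].
Definition Rn : Type := g_sigma_algebraType boxes.
Definition lam : set Rn -> \bar R := lebesgue_outer.
Definition lint (E : set vec) (f : vec -> \bar R) : \bar R :=
  integral lam (E : set Rn) (f : Rn -> \bar R).

Definition cabs (z : R[i]) : R :=
  Num.sqrt (complex.Re z ^+ 2 + complex.Im z ^+ 2).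

Definition cint (f : vec -> R[i]) : R[i] :=
  (fine (lint setT (fun x => (complex.Re (f x))%:E)))%:C
  + 'i * (fine (lint setT (fun x => (complex.Im (f x))%:E)))%:C.
Definition cintegrable (f : vec -> R[i]) : Prop :=
  lmeas_cfun f /\ (lint setT (fun x => (cabs (f x))%:E) < +oo)%E.

(** partial derivatives; a multi-index is a list of directions *)
Definition pd (i : 'I_n) (g : vec -> R) : vec -> R := fun x => 'D_('e_i) g x.
Fixpoint pdn (al : seq 'I_n) (g : vec -> R) : vec -> R :=
  if al is i :: al' then pd i (pdn al' g) else g.
Definition cpdn (al : seq 'I_n) (u : vec -> R[i]) : vec -> R[i] :=
  fun x => (pdn al (fun y => complex.Re (u y)) x)%:C
           + 'i * (pdn al (fun y => complex.Im (u y)) x)%:C.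

Definition smooth_r (g : vec -> R) : Prop :=
  forall al : seq 'I_n,
    continuous (pdn al g) /\ forall (i : 'I_n) x, derivable (pdn al g) x 'e_i.
Definition smooth_c (u : vec -> R[i]) : Prop :=
  smooth_r (fun y => complex.Re (u y)) /\ smooth_r (fun y => complex.Im (u y)).

Definition schwartz (u : vec -> R[i]) : Prop :=
  smooth_c u /\
  forall (k : nat) (al : seq 'I_n), exists M : R,
    forall x, (1 + enorm x) ^+ k * cabs (cpdn al u x) <= M.

Definition test_fun (u : vec -> R[i]) : Prop :=
  smooth_c u /\ exists r : R, forall x, r < enorm x -> u x = 0.

(** tempered distributions: continuous linear functionals on S(R^n);
    only their values on Schwartz functions matter *)
Definition tempered (T : (vec -> R[i]) -> R[i]) : Prop :=
  (forall u v (c : R[i]), schwartz u -> schwartz v ->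
      T (fun x => u x + c * v x) = T u + c * T v) /\
  exists (C : R) (N : nat), forall u (M : R), schwartz u ->
    (forall x (k : nat) (al : seq 'I_n), (k <= N)%N -> (size al <= N)%N ->
        (1 + enorm x) ^+ k * cabs (cpdn al u x) <= M) ->
    cabs (T u) <= C * M.

Definition dist_is_fun (T : (vec -> R[i]) -> R[i]) (g : vec -> R[i]) : Prop :=
  lmeas_cfun g /\
  forall phi, test_fun phi ->
    cintegrable (fun x => g x * phi x) /\ cint (fun x => g x * phi x) = T phi.

Definition expi (t : R) : R[i] := (cos t)%:C + 'i * (sin t)%:C.
Definition fourier (u : vec -> R[i]) : vec -> R[i] :=
  fun xi => cint (fun x => u x * expi (- dotp x xi)).
Definition ifourier (u : vec -> R[i]) : vec -> R[i] :=
  fun x => ((2 * pi) ^- n)%:C * cint (fun xi => u xi * expi (dotp x xi)).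

(** the tempered distribution F^{-1} (a F u), for a in S' and u in S:
    <F^{-1}(a Fu), phi> = <a, Fu . F^{-1} phi> *)
Definition multiplier_op (a : (vec -> R[i]) -> R[i]) (u : vec -> R[i]) :
  (vec -> R[i]) -> R[i] :=
  fun phi => a (fun xi => fourier u xi * ifourier phi xi).

Definition ebs (f : vec -> R[i]) : vec -> \bar R := fun x => (cabs (f x))%:E.
Definition chi (E : set vec) : vec -> \bar R := fun x => (\1_E x)%:E.

Definition banach_function_norm (rho : (vec -> \bar R) -> \bar R) : Prop :=
  (forall f, Mplus f -> (rho f = 0%E <-> ae (fun x => f x = 0%E))) /\
  (forall f (a : R), Mplus f -> 0 <= a -> rho (fun x => a%:E * f x)%E = (a%:E * rho f)%E) /\
  (forall f g, Mplus f -> Mplus g -> (rho (fun x => f x + g x) <= rho f + rho g)%E) /\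
  (forall f g, Mplus f -> Mplus g -> ae (fun x => g x <= f x)%E -> (rho g <= rho f)%E) /\
  (forall (F : (vec -> \bar R)^nat) f, (forall j, Mplus (F j)) -> Mplus f ->
     ae (fun x => {homo (fun j => F j x) : i j / (i <= j)%N >-> (i <= j)%E} /\
                  (fun j => F j x) @ \oo --> f x) ->
     {homo (fun j => rho (F j)) : i j / (i <= j)%N >-> (i <= j)%E} /\
     (fun j => rho (F j)) @ \oo --> rho f) /\
  (forall E, lebesgue_measurable_set E -> (lebesgue_outer E < +oo)%E ->
     (rho (chi E) < +oo)%E) /\
  (forall E, lebesgue_measurable_set E -> (lebesgue_outer E < +oo)%E ->
     exists CE : R, 0 < CE /\
       forall f, Mplus f -> (lint E f <= CE%:E * rho f)%E).

Definition ratio_inf (rho : (vec -> \bar R) -> \bar R) (tau r : R) : \bar R :=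
  ereal_inf [set (rho (chi (eball y (tau * r))) *
                  ((fine (rho (chi (eball y r))))^-1)%:E)%E | y in [set: vec]].
Definition weak_doubling (rho : (vec -> \bar R) -> \bar R) : Prop :=
  exists tau : R, 1 < tau /\
    (ereal_sup [set ereal_inf [set ratio_inf rho tau r | r in [set r | (r0 <= r)%R]]
               | r0 in [set: R]] < +oo)%E.

Definition mult_norm (rho : (vec -> \bar R) -> \bar R)
    (a : (vec -> R[i]) -> R[i]) : \bar R :=
  ereal_sup [set q : \bar R | exists (u g : vec -> R[i]),
     [/\ schwartz u, (rho (ebs u) < +oo)%E, (exists x, u x != 0),
         dist_is_fun (multiplier_op a u) g &
         q = (rho (ebs g) * ((fine (rho (ebs u)))^-1)%:E)%E]].

Definition in_mult_space (rho : (vec -> \bar R) -> \bar R)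
    (a : (vec -> R[i]) -> R[i]) : Prop :=
  tempered a /\ (mult_norm rho a < +oo)%E.

Definition linf_norm (g : vec -> R[i]) : \bar R :=
  ereal_inf [set M : \bar R | ae (fun x => ((cabs (g x))%:E <= M)%E)].

End FourierMultipliers.

(* Main.v *)
(** Move the multiplier to the physical side: [b = a o F] is again tempered, [a] acts on [w] by
    [T_a w x = (2 pi)^-n b (w (. + x))], and [a psi = b theta] with [theta = F^-1 psi].
    Approximate [theta] by a combination [sum_k m_k e_{p_k}] of exponentials with
    [sum_k |m_k| <= ||psi||_1], and let [w] be a cutoff equal to 1 on [B(y, r)] and supported in
    [B(y, s r)], [s > 1].  For [x] in [B(y, r)] and [r] large, [theta w(. + x)] is close to [theta]
    in the Schwartz topology, uniformly in [x] and [y], so that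
    [|a psi| <= sum_k |m_k| |T_a (e_{p_k} w) x| + eps] on [B(y, r)].  Taking norms in [X],
    [|a psi| - eps <= ||a|| ||psi||_1 ||chi_{B(y, s r)}|| / ||chi_{B(y, r)}||], and weak doubling,
    iterated with [s] a high root of [tau], makes the last ratio as close to 1 as we please.
    Hence [a] is bounded by [||a||] for the L^1 norm, and Radon-Nikodym represents it by a function
    bounded by [||a||].  The constant multiplier 1 shows that the constant is optimal. *)
Require Import Defs.
From HB Require Import structures.
From mathcomp Require Import all_boot all_order all_algebra.
From mathcomp Require Import all_classical all_reals all_analysis.
From mathcomp Require Import complex ring lra measurable_realfun.
Set Implicit Arguments.
Unset Strict Implicit.
Unset Printing Implicit Defensive.
Import Order.TTheory GRing.Theory Num.Theory.
Import numFieldNormedType.Exports.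
Local Open Scope classical_set_scope.
Local Open Scope ring_scope.
Local Open Scope complex_scope.

(** * Lebesgue measure on R^n *)

Section borel_Rn.
Context {R : realType} {n : nat}.
Notation vec := 'rV[R]_n.

(** Weak doubling speaks only of some radii tending to infinity and of centres that may move with
    the radius, so the radius beyond which the pointwise estimate holds must not depend on the
    centre. The finite order of [b] ensures this: for [x] in [B(y, r)] the function [w(. + x) - 1]
    vanishes up to a distance of order [r] from the origin, hence is at most [K (1 + |z|) / r]
    together with its derivatives, with [K] free of [x], [y] and [r]. The exponential sum may depend
    on [y] and [r]; it is finite, so that the triangle inequality of the norm applies. Two points
    could spoil the constant 1: the real and imaginary parts of [a] are represented separately, and
    the bound on the modulus is recovered from countably many directions in the plane; and the
    multiplier norm ranges over all functions that represent [F^-1 a F u], so its value at the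
    constant multiplier rests on uniqueness almost everywhere. Measurability is stated with the
    outer measure but integrals live on the Borel sets, whence the passages between Lebesgue and
    Borel functions modulo null sets. *)

Lemma measurable_obox (a b : vec) : measurable (obox a b : set (Rn (R:=R) (n:=n))).
Proof. by apply: sub_sigma_algebra; exists a, b. Qed.

(** The half-space [a < x_i] is exhausted by the boxes with side []a, k[] in direction [i] and []-k,
    k[] in the others. *)
Lemma measurable_coord (i : 'I_n) :
  measurable_fun [set: Rn (R:=R) (n:=n)] (fun x : Rn (R:=R) (n:=n) => (x : vec) ord0 i).
Proof.
apply: (measurability (@measurable_realfun.RGenOInfty.G R)) => //.
  exact: measurable_realfun.RGenOInfty.measurableE.
move=> _ [_ [a ->] <-]; rewrite setTI.
rewrite [X in measurable X](_ : _ = \bigcup_k (obox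
   (\row_j (if j == i then a else - k%:R)) (const_mx k%:R))); last first.
  apply/seteqP; split => [x /=|x [k _] /= /(_ i)]; rewrite in_itv/= andbT.
    move=> ax; pose m := (\sum_j `|(x : vec) ord0 j|).
    have [k mk] : exists k, m < k%:R by exists (Num.Def.archi_bound m); apply: archi_boundP; apply: sumr_ge0.
    exists k => // j; rewrite !mxE.
    have : `|(x : vec) ord0 j| < k%:R.
      by apply: le_lt_trans mk; rewrite /m (bigD1 j)//= lerDl sumr_ge0.
    rewrite ltr_norml => /andP[H1 H2]; by case: eqP => [ji|_]; rewrite H2 andbT// ji.

  by rewrite !mxE eqxx => /andP[].
by apply: bigcupT_measurable => k; exact: measurable_obox.
Qed.

Lemma measurable_fun_Rn d (T : measurableType d) (f : T -> Rn (R:=R) (n:=n)) :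
  (forall i, measurable_fun setT (fun t => (f t : vec) ord0 i)) ->
  measurable_fun setT f.
Proof.
move=> mf; apply: (measurability (boxes : set (set (Rn (R:=R) (n:=n))))) => // _ [_ [a [b ->]] <-]; rewrite setTI.
rewrite [X in measurable X](_ : _ = \bigcap_(i in [set: 'I_n])
    ((fun t => (f t : vec) ord0 i) @^-1` `]a ord0 i, b ord0 i[)); last first.
  apply/seteqP; split => [x /= H i _|x H i] /=.
    by rewrite in_itv/=; exact: H.
  by have := H i I; rewrite /= in_itv.
apply: fin_bigcap_measurable => [|i _]; first exact: finite_finset.
by rewrite -[X in measurable X]setTI; apply: mf.
Qed.

Lemma obox_setI (a b c d : vec) : obox a b `&` obox c d =
  obox (\row_i Num.max (a ord0 i) (c ord0 i)) (\row_i Num.min (b ord0 i) (d ord0 i)).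
Proof.
apply/seteqP; split => [x [/= H1 H2] i|x /= H].
  by move: (H1 i) (H2 i); rewrite !mxE gt_max lt_min => /andP[-> ->] /andP[-> ->].
by split=> i; move: (H i); rewrite !mxE gt_max lt_min => /andP[/andP[? ?] /andP[? ?]]; apply/andP.
Qed.

Lemma boxvol_ge0 (a b : vec) : 0 <= boxvol a b.
Proof. by apply: prodr_ge0 => i _; rewrite le_max lexx. Qed.

Lemma bigcup_obox_nat :
  \bigcup_k obox (const_mx (- k%:R)) (const_mx k%:R) = [set: vec].
Proof.
apply/seteqP; split => // x _; pose m := (\sum_j `|(x : vec) ord0 j|).
have [k mk] : exists k, m < k%:R by exists (Num.Def.archi_bound m); apply: archi_boundP; apply: sumr_ge0.
exists k => // j; rewrite ![const_mx _ _ _]mxE -ltr_norml.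
by apply: le_lt_trans mk; rewrite /m (bigD1 j)//= lerDl sumr_ge0.
Qed.

End borel_Rn.

Section sigma_finite_copy.
Context d (T : measurableType d) (R : realType).
Context (mu : {measure set T -> \bar R}) (musf : sigma_finite setT mu).

(** The proof of sigma-finiteness is an argument, so that the structure of a sigma-finite measure
    can be attached to a measure that comes out of an existential, such as the induction hypothesis
    of [product_lebesgue]. *)
Definition sigma_finite_copy of sigma_finite setT mu : set T -> \bar R := mu.
Local Notation nu := (sigma_finite_copy musf).
Let nu0 : nu set0 = 0%E. Proof. exact: measure0. Qed.
Let nu_ge0 A : (0 <= nu A)%E. Proof. exact: measure_ge0. Qed.
Let nu_sigma : semi_sigma_additive nu. Proof. exact: measure_semi_sigma_additive. Qed.
HB.instance Definition _ := isMeasure.Build _ _ _ nu nu0 nu_ge0 nu_sigma.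
HB.instance Definition _ := Measure_isSigmaFinite.Build _ _ _ nu musf.
End sigma_finite_copy.

Definition pushforward_measure d d' (T1 : measurableType d) (T2 : measurableType d')
    (R : realType) (m : {measure set T1 -> \bar R}) (f : T1 -> T2)
    (mf : measurable_fun setT f) : {measure set T2 -> \bar R} :=
  measure_function_pushforward__canonical__measure_function_Measure m mf.

(** * Lebesgue measure as an iterated product *)

Section product_lebesgue.
Context {R : realType}.
Let leb := @lebesgue_measure R.

(** Induction on the dimension: a row of length [n + 1] is identified with its head and its tail,
    and the measure is the image of the product measure. In dimension 0 it is the Dirac mass at the
    only point. The second clause, Tonelli's theorem for products of one-variable functions, is
    carried along because the product structure is visible only here; the weight and the Gaussians
    need it later. *)
Lemma product_lebesgue n : exists mu : {measure set (Rn (R:=R) (n:=n)) -> \bar R},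
  (forall a b : 'rV[R]_n, mu (obox a b) = (boxvol a b)%:E) /\
  forall (f : 'I_n -> R -> R) (c : 'I_n -> R),
    (forall i t, 0 <= f i t) -> (forall i, measurable_fun setT (f i)) ->
    (forall i, \int[leb]_t (f i t)%:E = (c i)%:E)%E ->
    (\int[mu]_x (\prod_i f i ((x : 'rV[R]_n) ord0 i))%R%:E = (\prod_i c i)%R%:E)%E.
Proof.
elim: n => [|n [mu [muB muP]]].
  exists (dirac ((0 : 'rV[R]_0) : Rn (R:=R) (n:=0)) : {measure set (Rn (R:=R) (n:=0)) -> \bar R}); split.
    move=> a b; rewrite [LHS](_ : _ = (\1_(obox a b) (0 : 'rV[R]_0))%:E)//.
    by rewrite /boxvol big_ord0 indicE mem_set// => -[].
  move=> f c f0 mf cf; rewrite integral_dirac//= ?diracT ?mul1e ?big_ord0//.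
  under eq_fun do rewrite big_ord0; exact: measurable_cst.
have musf : sigma_finite setT mu.
  exists (fun k => obox (const_mx (- k%:R)) (const_mx k%:R)).
    by rewrite bigcup_obox_nat.
  by move=> k; split; [exact: measurable_obox|rewrite muB ltry].
pose mus : {sigma_finite_measure set (Rn (R:=R) (n:=n)) -> \bar R} := sigma_finite_copy musf.
(* [unlift ord0] is [None] at index 0, where the default [p.1] is taken, and [Some j] at
   [lift ord0 j]. *)
pose phi (p : measurableTypeR R * Rn (R:=R) (n:=n)) : Rn (R:=R) (n:=n.+1) :=
  (\row_i oapp ((p.2 : 'rV[R]_n) ord0) p.1 (unlift ord0 i) : 'rV[R]_n.+1).
have phi0 p : (phi p : 'rV[R]_n.+1) ord0 ord0 = p.1 by rewrite mxE unlift_none.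
have phiS p i : (phi p : 'rV[R]_n.+1) ord0 (lift ord0 i) = (p.2 : 'rV[R]_n) ord0 i.
  by rewrite mxE liftK.
have mphi : measurable_fun setT phi.
  apply: measurable_fun_Rn => i.
  case: (unliftP ord0 i) => [j ->|->].
    under eq_fun do rewrite phiS.
    exact: (measurableT_comp (measurable_coord j) measurable_snd).
  under eq_fun do rewrite phi0; exact: measurable_fst.
exists (pushforward_measure (leb \x mus)%E mphi); split.
  move=> a b; rewrite /= /pushforward.
  rewrite (_ : _ @^-1` _ = `]a ord0 ord0, b ord0 ord0[ `*`
      obox (\row_i a ord0 (lift ord0 i)) (\row_i b ord0 (lift ord0 i))); last first.
    apply/seteqP; split => [p /= H|p [/=]].
      split; first by move: (H ord0); rewrite phi0 /= in_itv.
      by move=> i; move: (H (lift ord0 i)); rewrite phiS !mxE.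
    rewrite in_itv/= => H1 H2 i; case: (unliftP ord0 i) => [j ->|->].
      by move: (H2 j); rewrite phiS !mxE.
    by rewrite phi0.
  rewrite product_measure1E//; last exact: measurable_obox.
  transitivity (lebesgue_measure `]a ord0 ord0, b ord0 ord0[%classic *
    mu (obox (\row_i a ord0 (lift ord0 i)) (\row_i b ord0 (lift ord0 i))))%E; first by [].
  rewrite muB lebesgue_measure_itv/= lte_fin /boxvol big_ord_recl EFinM; congr (_ * (_)%:E)%E.
    by case: ltP => ab; rewrite ?EFinB; [rewrite max_r// subr_ge0 ltW|rewrite max_l// subr_le0].
  by apply: eq_bigr => i _; rewrite !mxE.
move=> f c f0 mf cf.
have mg m (h : 'I_m -> R -> R) : (forall i, measurable_fun setT (h i)) ->
    measurable_fun setT (fun x : Rn (R:=R) (n:=m) => (\prod_i h i ((x : 'rV[R]_m) ord0 i))).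
  move=> mh; apply: measurable_prod => i _.
  exact: (measurableT_comp (mh i) (measurable_coord i)).
rewrite ge0_integral_pushforward//; last 2 first.
- by apply/measurable_EFinP; exact: mg.
- by move=> x _; rewrite lee_fin prodr_ge0.
rewrite preimage_setT.
rewrite fubini_tonelli1/=; last 2 first.
- apply/measurable_EFinP; exact: (measurableT_comp (mg _ _ mf) mphi).
- by move=> x; rewrite lee_fin prodr_ge0.
pose g (y : Rn (R:=R) (n:=n)) := \prod_i f (lift ord0 i) ((y : 'rV[R]_n) ord0 i).
have mg' : measurable_fun setT g by exact: (mg _ (fun i => f (lift ord0 i))).
transitivity (\int[leb]_t ((f ord0 t)%:E * \int[mu]_y (g y)%:E))%E.
  apply: eq_integral => t _; rewrite -ge0_integralZl_EFin//; last 2 first.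
  - by move=> y _; rewrite lee_fin prodr_ge0.
  - exact/measurable_EFinP.
  apply: eq_integral => y _ /=; rewrite big_ord_recl phi0 EFinM /g.
  by congr (_ * _%:E)%E; apply: eq_bigr => i _; rewrite phiS.
rewrite (muP (fun i => f (lift ord0 i)) (fun i => c (lift ord0 i)))//.
rewrite ge0_integralZr//; last 3 first.
- by apply/measurable_EFinP; exact: mf.
- by move=> t _; rewrite lee_fin.
- rewrite lee_fin prodr_ge0// => i _; rewrite -lee_fin -cf.
  by apply: integral_ge0 => t _; rewrite lee_fin.
by rewrite cf -EFinM big_ord_recl.
Qed.
End product_lebesgue.

(** * The Lebesgue outer measure and its Caratheodory sets *)

Section lebesgue_outer_measure.
Context {R : realType} {n : nat}.
Notation vec := 'rV[R]_n.+1.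
Notation lo := (@lebesgue_outer R n.+1).

(** Degenerate boxes pad finite covers to sequences. Positive dimension enters here: in dimension 0
    the empty product would be 1. *)
Lemma boxvol00 : boxvol (0 : vec) 0 = 0.
Proof. by rewrite /boxvol big_ord_recl subrr max_l// mul0r. Qed.

Lemma lebesgue_outer0 : lo set0 = 0%E.
Proof.
apply/eqP; rewrite eq_le; apply/andP; split.
  apply: ereal_inf_lbound; exists (fun=> (0, 0)) => //.
  by rewrite eseries0// => k _ _; rewrite boxvol00.
apply: le_ereal_inf_tmp => _ [ab _ <-]; apply: nneseries_ge0 => k _ _.
by rewrite lee_fin boxvol_ge0.
Qed.

Lemma lebesgue_outer_ge0 A : (0 <= lo A)%E.
Proof.
apply: le_ereal_inf_tmp => _ [ab _ <-]; apply: nneseries_ge0 => k _ _.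
by rewrite lee_fin boxvol_ge0.
Qed.

Lemma le_lebesgue_outer : {homo lo : A B / A `<=` B >-> (A <= B)%E}.
Proof.
move=> A B AB; apply: ereal_inf_le_tmp => _ [ab Bab <-]; exists ab => //.
exact: subset_trans AB Bab.
Qed.

Lemma lebesgue_outer_obox (a b : vec) : (lo (obox a b) <= (boxvol a b)%:E)%E.
Proof.
apply: ereal_inf_lbound; exists ((fun k : nat => if k is 0%N return vec * vec then (a, b) else (0, 0)) : (vec * vec)^nat).
  by move=> x abx; exists 0%N.
rewrite nneseries_recl//; last by move=> k _; rewrite lee_fin boxvol_ge0.
by rewrite eseries_cond/= eseries0 ?adde0// => -[|k] _ _//=; rewrite boxvol00.
Qed.

(** Covers of the [F i] that are optimal up to [e / 2^(i+1)] are merged into one sequence along a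
    bijection of [nat] with [nat * nat]. If some [F i] has infinite outer measure, so does the
    right-hand side. *)
Lemma lebesgue_outer_sigma : sigma_subadditive lo.
Proof.
move=> F; have [Foo|] := pselect (forall i, lo (F i) \is a fin_num); last first.
  move=> /existsNP[i Fi]; have -> : (\sum_(i <oo) lo (F i) = +oo)%E.
    apply/eqP; rewrite -leye_eq.
    have <- : lo (F i) = +oo%E.
      by move: Fi (lebesgue_outer_ge0 (F i)); case: (lo _).
    apply: le_trans (nneseries_lim_ge i.+1 _) => //; last by move=> *; exact: lebesgue_outer_ge0.
    by rewrite big_nat_recr//= leeDr// sume_ge0// => k _; exact: lebesgue_outer_ge0.
  by rewrite leey.
apply/lee_addgt0Pr => _/posnumP[e].
have [G GF] : {G : nat -> nat -> vec * vec & forall i,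
    F i `<=` \bigcup_k obox (G i k).1 (G i k).2 /\
    (\sum_(k <oo) (boxvol (G i k).1 (G i k).2)%:E <= lo (F i) + (e%:num / (2 ^ i.+1)%:R)%:E)%E}.
  apply: (@choice _ _ (fun i (g : nat -> vec * vec) => F i `<=` \bigcup_k obox (g k).1 (g k).2 /\
    (\sum_(k <oo) (boxvol (g k).1 (g k).2)%:E <= lo (F i) + (e%:num / (2 ^ i.+1)%:R)%:E)%E)) => i.
  have e2 : 0 < e%:num / (2 ^ i.+1)%:R by rewrite divr_gt0// ltr0n expn_gt0.
  have [_ [g Fg <-] /ltW ge] := lb_ereal_inf_adherent e2 (Foo i).
  by exists g.
pose P (m : nat * nat) := (boxvol (G m.1 m.2).1 (G m.1 m.2).2)%:E.
have P0 m : (0 <= P m)%E by rewrite lee_fin boxvol_ge0.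
have /card_esym/ppcard_eqP[h] := card_nat2.
apply: (@le_trans _ _ (\sum_(k <oo) P (h k))%E).
  apply: ereal_inf_lbound; exists (fun k => G (h k).1 (h k).2) => // x [i _].
  move=> /(GF i).1[k _ xk]; exists (h^-1%FUN (i, k)) => //=.
  by rewrite invK ?inE.
rewrite nneseries_esumT; last by move=> k; exact: P0.
rewrite -(@reindex_esum _ _ _ [set: nat] [set: nat * nat] h P); last exact: bij.
rewrite [X in esum X _](_ : _ = [set: nat] `*`` (fun=> [set: nat])); last by apply/seteqP; split.
rewrite -(@esum_esum _ _ _ _ _ (fun i j => P (i, j)))// -nneseries_esumT; last by move=> i; exact: esum_ge0.
apply: le_trans (epsilon_trick _ (fun i => lebesgue_outer_ge0 (F i)) (ltW (gt0 e))).
apply: lee_nneseries => [i _ _|i _]; first exact: esum_ge0.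
by rewrite -nneseries_esumT; [exact: (GF i).2|move=> k; exact: P0].
Qed.

HB.instance Definition _ := isOuterMeasure.Build R vec lo
  lebesgue_outer0 lebesgue_outer_ge0 le_lebesgue_outer lebesgue_outer_sigma.

(** The interval []a, b[] is cut at [c]. The second piece starts at [c - d] rather than at [c],
    because an open interval has to contain the points equal to [c]; the overlap costs [d]. *)
Let itv_split (a b c d : R) : 0 <= d ->
  Num.max 0 (Num.min b c - a) + Num.max 0 (b - Num.max a (c - d)) <=
  Num.max 0 (b - a) + d.
Proof.
move=> d0; rewrite /Num.max /Num.min.
by do ?[case: ifP; [move=> ?|move/negbT; rewrite -leNgt => ?]]; lra.
Qed.

(** Each box of a cover is cut along the hyperplane [x_i = c] into two overlapping open boxes. The
    overlap in the [k]-th box has volume at most [d k * W k], where [W k] is the volume of the face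
    orthogonal to direction [i]. *)
Lemma caratheodory_halfspace (i : 'I_n.+1) (c : R) :
  lo.-caratheodory [set x : vec | x ord0 i < c].
Proof.
apply: le_caratheodory_measurable => X; apply: le_ereal_inf_tmp => _ [ab Xab <-].
apply/lee_addgt0Pr => e e0.
pose W k := \prod_(j < n.+1 | j != i) Num.max 0 ((ab k).2 ord0 j - (ab k).1 ord0 j).
have W0 k : 0 <= W k by apply: prodr_ge0 => j _; rewrite le_max lexx.
(* The divisor [1 + W k] makes [d k * W k] summable to at most [e] and keeps [d k] defined and
   positive when the face has volume 0. *)
pose d k := e / (2 ^ k.+1)%:R / (1 + W k).
have d0 k : 0 < d k.
  by rewrite !divr_gt0 ?ltr0n ?expn_gt0// ltr_pwDl.
have dW k : d k * W k <= e / (2 ^ k.+1)%:R.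
  rewrite /d -mulrA ler_piMr ?divr_ge0 ?(ltW e0)//.
  by rewrite mulrC ler_pdivrMr ?mul1r ?lerDr// ltr_pwDl.
pose b1 k : vec := \row_j if j == i then Num.min ((ab k).2 ord0 i) c else (ab k).2 ord0 j.
pose a2 k : vec := \row_j if j == i then Num.max ((ab k).1 ord0 i) (c - d k) else (ab k).1 ord0 j.
apply: (@le_trans _ _ (\sum_(k <oo) (boxvol (ab k).1 (b1 k))%:E +
    \sum_(k <oo) (boxvol (a2 k) (ab k).2)%:E)%E).
  apply: leeD; apply: ereal_inf_lbound.
    exists (fun k => ((ab k).1, b1 k)) => // x [Xx xc].
    have [k _ xk] := Xab _ Xx; exists k => // j; rewrite mxE /=.
    case: eqP => [->|_]; last exact: xk.
    by have /andP[h1 h2] := xk i; rewrite lt_min h1 h2 /=.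
  exists (fun k => (a2 k, (ab k).2)) => // x [Xx /negP]; rewrite -leNgt => xc.
  have [k _ xk] := Xab _ Xx; exists k => // j; rewrite mxE /=.
  case: eqP => [->|_]; last exact: xk.
  have /andP[h1 h2] := xk i; rewrite gt_max h1 h2 andbT/=.
  by apply: lt_le_trans xc; rewrite ltrBlDr ltrDl.
rewrite -nneseriesD; [|by move=> k _ _; rewrite lee_fin boxvol_ge0..].
apply: le_trans (epsilon_trick _ _ (ltW e0)); last by move=> k; rewrite lee_fin boxvol_ge0.
apply: lee_nneseries => [k _ _|k _]; first by rewrite -EFinD lee_fin addr_ge0 ?boxvol_ge0.
rewrite -!EFinD lee_fin /boxvol (bigD1 i)//= [X in _ + X <= _](bigD1 i)//=.
rewrite [X in _ <= X + _](bigD1 i)//= -/(W k) !mxE eqxx.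
rewrite (eq_bigr (fun j => Num.max 0 ((ab k).2 ord0 j - (ab k).1 ord0 j))); last first.
  by move=> j /negbTE ji; rewrite mxE ji.
rewrite [X in _ + _ * X <= _](eq_bigr (fun j => Num.max 0 ((ab k).2 ord0 j - (ab k).1 ord0 j))); last first.
  by move=> j /negbTE ji; rewrite mxE ji.
rewrite -/(W k) -mulrDl.
apply: le_trans (ler_wpM2r (W0 k) (itv_split _ _ _ (ltW (d0 k)))) _.
by rewrite mulrDl lerD2l.
Qed.

Lemma borel_caratheodory (A : set (Rn (R:=R) (n:=n.+1))) : measurable A -> lo.-caratheodory A.
Proof.
have Cm i (c : R) : (lo.-cara).-measurable ([set x : vec | c < x ord0 i] : set (caratheodory_type lo)).
  rewrite [X in measurable X](_ : _ = \bigcup_k ~` [set x : vec | x ord0 i < c + k.+1%:R^-1]).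
    by apply: bigcupT_measurable => k; apply: measurableC; exact: caratheodory_halfspace.
  apply/seteqP; split => [x /= cx|x [k _ /= /negP]]; last first.
    by rewrite -leNgt; apply: lt_le_trans; rewrite ltrDl.
  have /ltr_add_invr[k kx] := cx.
  by exists k => //=; apply/negP; rewrite -leNgt ltW.
apply: smallest_sub => //; first exact: (@sigma_algebra_measurable _ (caratheodory_type lo)).
move=> _ [a [b ->]].
rewrite (_ : obox a b = \bigcap_(i in [set: 'I_n.+1])
    ([set x : vec | a ord0 i < x ord0 i] `&` [set x : vec | x ord0 i < b ord0 i])).
  apply: (@fin_bigcap_measurable _ (caratheodory_type lo)) => [|i _]; first exact: finite_finset.
  by apply: measurableI; [exact: Cm|exact: caratheodory_halfspace].
by apply/seteqP; split => [x H i _|x H i]; [have /andP[]:= H i|apply/andP; apply: H].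
Qed.

Lemma borel_lebesgue (A : set (Rn (R:=R) (n:=n.+1))) : measurable A -> lebesgue_measurable_set (A : set vec).
Proof. by move=> /borel_caratheodory mA B; rewrite setDE; exact: mA. Qed.

Lemma lebesgue_caratheodory (A : set vec) : lebesgue_measurable_set A -> lo.-caratheodory A.
Proof. by move=> mA B; rewrite -setDE; exact: mA. Qed.

Local Notation RnT := (Rn (R:=R) (n:=n.+1)).
Local Notation lam := (@lam R n.+1).
Let lam0 : lam set0 = 0%E. Proof. exact: lebesgue_outer0. Qed.
Let lam_ge0 A : (0 <= lam A)%E. Proof. exact: lebesgue_outer_ge0. Qed.
Let lam_sigma : semi_sigma_additive lam.
Proof.
move=> F mF tF mUF.
apply: (@caratheodory_measure_sigma_additive R vec lo F) => //.
  by move=> i; exact: borel_caratheodory.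
exact: borel_caratheodory.
Qed.
HB.instance Definition _ := isMeasure.Build _ RnT R lam lam0 lam_ge0 lam_sigma.

End lebesgue_outer_measure.

(** * Lebesgue measure on the Borel sets: uniqueness, translations, null sets *)

Section lebesgue_Rn.
Context {R : realType} {n : nat}.
Notation vec := 'rV[R]_n.+1.
Notation lo := (@lebesgue_outer R n.+1).
Local Notation RnT := (Rn (R:=R) (n:=n.+1)).
Local Notation lam := (@lam R n.+1).

Lemma setI_closed_boxes : setI_closed (@boxes R n.+1).
Proof. by move=> _ _ [a [b ->]] [c [d ->]]; rewrite obox_setI; eexists; eexists. Qed.

Lemma lebesgue_Rn_unique (mu nu : {measure set RnT -> \bar R}) :
  (forall a b : vec, mu (obox a b) = (boxvol a b)%:E) ->
  (forall a b : vec, nu (obox a b) = (boxvol a b)%:E) ->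
  forall A, measurable A -> mu A = nu A.
Proof.
move=> muB nuB; apply: (measure_unique (@boxes R n.+1 : set (set RnT))
  (fun k => obox (const_mx (- k%:R)) (const_mx k%:R))) => //.
- exact: setI_closed_boxes.
- by move=> k; eexists; eexists.
- exact: bigcup_obox_nat.
- by move=> _ [a [b ->]]; rewrite muB nuB.
- by move=> k; rewrite muB ltry.
Qed.

(** The lower bound compares with the product measure [mu], which has the same values on boxes: its
    countable subadditivity bounds the volume of the box by the total volume of any cover. *)
Lemma lam_obox (a b : vec) : lam (obox a b) = (boxvol a b)%:E.
Proof.
have [mu [muB _]] := @product_lebesgue R n.+1.
apply/eqP; rewrite eq_le lebesgue_outer_obox /= -muB.
apply: le_ereal_inf_tmp => _ [ab abab <-].
apply: (@le_trans _ _ (\sum_(k <oo) mu (obox (ab k).1 (ab k).2))%E).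
  apply: measure_sigma_subadditive => //; last exact: measurable_obox.
  by move=> k; exact: measurable_obox.
by apply: lee_nneseries => // k _; rewrite muB.
Qed.

Lemma lam_sigma_finite : sigma_finite setT lam.
Proof.
exists (fun k => obox (const_mx (- k%:R)) (const_mx k%:R)).
  by rewrite bigcup_obox_nat.
by move=> k; split; [exact: measurable_obox|rewrite lam_obox ltry].
Qed.
HB.instance Definition _ := Measure_isSigmaFinite.Build _ RnT R lam lam_sigma_finite.

Lemma integral_prod_coord (f : 'I_n.+1 -> R -> R) (c : 'I_n.+1 -> R) :
  (forall i t, 0 <= f i t) -> (forall i, measurable_fun setT (f i)) ->
  (forall i, \int[lebesgue_measure]_t (f i t)%:E = (c i)%:E)%E ->
  (\int[lam]_x (\prod_i f i ((x : vec) ord0 i))%R%:E = (\prod_i c i)%R%:E)%E.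
Proof.
have [mu [muB muP]] := @product_lebesgue R n.+1; move=> f0 mf cf.
rewrite -(muP _ _ f0 mf cf); apply: eq_measure_integral => A mA _.
exact: (lebesgue_Rn_unique lam_obox muB).
Qed.

Lemma measurable_translation (v : vec) :
  measurable_fun setT (fun x : RnT => (x : vec) + v : RnT).
Proof.
apply: measurable_fun_Rn => i; under eq_fun do rewrite mxE.
by apply: measurable_funD => //; exact: measurable_coord.
Qed.

Lemma lam_translation (v : vec) A : measurable A ->
  pushforward lam (fun x : RnT => (x : vec) + v : RnT) A = lam A.
Proof.
move=> mA; apply: (lebesgue_Rn_unique (mu := pushforward_measure lam (measurable_translation v))) mA => [a b|]; last exact: lam_obox.
rewrite /= /pushforward (_ : _ @^-1` _ = obox (a - v) (b - v)).
  by rewrite lam_obox /boxvol; congr (_%:E); apply: eq_bigr => i _; rewrite !mxE; congr Num.max; lra.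
by apply/seteqP; split => x H i; move: (H i); rewrite !mxE ltrBlDr ltrBrDr.
Qed.

Lemma ge0_integral_translation (v : vec) (f : RnT -> \bar R) : measurable_fun setT f ->
  (forall x, (0 <= f x)%E) -> (\int[lam]_x f ((x : vec) + v)%R = \int[lam]_x f x)%E.
Proof.
move=> mf f0; transitivity (\int[pushforward_measure lam (measurable_translation v)]_x f x)%E.
  by rewrite ge0_integral_pushforward//; exact: measurable_translation.
by apply: eq_measure_integral => A mA _; exact: lam_translation.
Qed.

Lemma integral_translation (v : vec) (f : RnT -> R) : measurable_fun setT f ->
  (\int[lam]_x (f ((x : vec) + v)%R)%:E = \int[lam]_x (f x)%:E)%E.
Proof.
move=> mf; rewrite integralE [RHS]integralE.
have mfE : measurable_fun setT (EFin \o f) by exact/measurable_EFinP.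
congr (_ - _)%E.
  rewrite -[RHS](ge0_integral_translation v (measurable_funepos mfE))//.
  by apply: eq_integral => x _; rewrite !funeposE.
rewrite -[RHS](ge0_integral_translation v (measurable_funeneg mfE))//.
by apply: eq_integral => x _; rewrite !funenegE.
Qed.

(** An open set is the union of the boxes with rational corners that it contains, and there are
    countably many of these. *)
Lemma open_measurable_Rn (U : set vec) : open U -> measurable (U : set RnT).
Proof.
move=> oU.
pose F (pq : 'rV[rat]_n.+1 * 'rV[rat]_n.+1) : set vec :=
  let B := obox (map_mx ratr pq.1) (map_mx ratr pq.2) in
  if `[< B `<=` U >] then B else set0.
rewrite (_ : U = \bigcup_pq F pq).
  apply: countable_bigcupT_measurable; first exact: countableP.
  by move=> pq; rewrite /F; case: ifP => _; [exact: measurable_obox|exact: measurable0].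
apply/seteqP; split => [x Ux|x [pq _]]; last by rewrite /F; case: ifPn => // /asboolP; apply.
have /nbhs_ballP[e /= e0 xeU] : nbhs x U by exact: open_nbhs_nbhs.
have /choice[p pP] i : exists q : rat, x ord0 i - e < ratr q < x ord0 i.
  have : x ord0 i - e < x ord0 i by rewrite ltrBlDr ltrDl.
  by move=> /rat_in_itvoo[q]; rewrite in_itv/=; exists q.
have /choice[q qP] i : exists q : rat, x ord0 i < ratr q < x ord0 i + e.
  have : x ord0 i < x ord0 i + e by rewrite ltrDl.
  by move=> /rat_in_itvoo[q]; rewrite in_itv/=; exists q.
have xin : obox (map_mx ratr (\row_i p i)) (map_mx ratr (\row_i q i)) x.
  by move=> i; rewrite !mxE; have /andP[_ ->] := pP i; have /andP[-> _] := qP i.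
exists (\row_i p i, \row_i q i) => //; rewrite /F/=; case: ifPn => // /asboolP[].
move=> y yB; apply: xeU; split => // i j; rewrite (ord1 i) /ball /= ltr_distl.
have := yB j; rewrite !mxE => /andP[h1 h2].
by have /andP[? _] := pP j; have /andP[_ ?] := qP j; apply/andP; split; lra.
Qed.

Lemma continuous_measurable_Rn (f : vec -> R) : continuous f ->
  measurable_fun setT (f : RnT -> R).
Proof.
move=> cf; apply: (measurability (@measurable_realfun.RGenOInfty.G R)) => //.
  exact: measurable_realfun.RGenOInfty.measurableE.
move=> _ [_ [a ->] <-]; rewrite setTI; apply: open_measurable_Rn.
by apply: open_comp => [x _|]; [exact: cf|exact: interval_open].
Qed.

Lemma borel_lmeas_rfun (f : vec -> R) : measurable_fun setT (f : RnT -> R) -> lmeas_rfun f.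
Proof.
move=> mf c; apply: borel_lebesgue; rewrite -[X in measurable X]setTI.
rewrite (_ : [set x | f x < c] = f @^-1` `]-oo, c[); first exact: mf.
by apply/seteqP; split => x /=; rewrite in_itv.
Qed.

(** A G-delta hull: the intersection of covers by boxes whose total volumes exceed the outer measure
    by at most [1 / (k + 1)]. *)
Lemma outer_hull (A : set vec) : exists B : set RnT, [/\ measurable B, A `<=` B & lo B = lo A].
Proof.
have [Aoo|Afin] := eqVneq (lo A) +oo%E.
  exists setT; split => //; rewrite Aoo; apply/eqP; rewrite -leye_eq -Aoo.
  exact: le_lebesgue_outer.
have {}Afin : lo A \is a fin_num.
  by rewrite ge0_fin_numE ?lebesgue_outer_ge0// ltey.
have [g gP] : {g : nat -> (vec * vec)^nat & forall k, A `<=` \bigcup_j obox (g k j).1 (g k j).2 /\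
    (\sum_(j <oo) (boxvol (g k j).1 (g k j).2)%:E <= lo A + k.+1%:R^-1%:E)%E}.
  apply: (@choice _ _ (fun k (h : (vec * vec)^nat) => A `<=` \bigcup_j obox (h j).1 (h j).2 /\
    (\sum_(j <oo) (boxvol (h j).1 (h j).2)%:E <= lo A + k.+1%:R^-1%:E)%E)) => k.
  have k0 : 0 < k.+1%:R^-1 :> R by rewrite invr_gt0.
  by have [_ [h Ah <-] /ltW hA] := lb_ereal_inf_adherent k0 Afin; exists h.
exists (\bigcap_k \bigcup_j obox (g k j).1 (g k j).2); split.
- by apply: bigcapT_measurable => k; apply: bigcupT_measurable => j; exact: measurable_obox.
- by move=> x Ax k _; exact: (gP k).1.
apply/eqP; rewrite eq_le; apply/andP; split; last first.
  by apply: le_lebesgue_outer => x Ax k _; exact: (gP k).1.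
apply/lee_addgt0Pr => e e0; have /ltr_add_invr[k ke] := e0.
apply: le_trans (_ : lo A + k.+1%:R^-1%:E <= _)%E; last first.
  by rewrite leeD2l// lee_fin ltW//; move: ke; rewrite add0r.
apply: le_trans (gP k).2; apply: (@le_trans _ _ (lo (\bigcup_j obox (g k j).1 (g k j).2))).
  by apply: le_lebesgue_outer => x /(_ k I).
apply: le_trans (lebesgue_outer_sigma _) _; apply: lee_nneseries => [j _ _|j _].
  exact: lebesgue_outer_ge0.
exact: lebesgue_outer_obox.
Qed.

Lemma bigcup_null (F : nat -> set vec) : (forall k, lo (F k) = 0%E) -> lo (\bigcup_k F k) = 0%E.
Proof.
move=> F0; apply/eqP; rewrite eq_le lebesgue_outer_ge0 andbT.
by apply: le_trans (lebesgue_outer_sigma _) _; rewrite eseries0.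
Qed.

Lemma null_hull (N : set vec) : lo N = 0%E ->
  exists B : set RnT, [/\ measurable B, N `<=` B & lam B = 0%E].
Proof. by move=> N0; have [B [mB NB]] := outer_hull N; rewrite N0; exists B. Qed.

(** Intersecting with the boxes [K k] makes the outer measures finite, so that they can be cancelled
    in Caratheodory's identity for the hull, which leaves a null difference. *)
Lemma lebesgue_hull (A : set vec) : lebesgue_measurable_set A ->
  exists B N : set RnT, [/\ measurable B, measurable N, lam N = 0%E, A `<=` B & B `\` A `<=` N].
Proof.
move=> mA; pose K k : set vec := obox (const_mx (- k%:R)) (const_mx k%:R).
have mAK k : lo.-caratheodory (A `&` K k).
  apply: (@measurableI _ (caratheodory_type lo)); first exact: lebesgue_caratheodory.
  by apply: borel_caratheodory; exact: measurable_obox.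
have [B BP] := choice (fun k => outer_hull (A `&` K k)).
have BA0 k : lo (B k `\` (A `&` K k)) = 0%E.
  have [_ AB lB] := BP k; have := mAK k (B k); rewrite setIC (setIidl AB) -lB => /esym/eqP.
  rewrite -setDE; have Bfin : lo (B k) \is a fin_num.
    rewrite ge0_fin_numE ?lebesgue_outer_ge0// lB.
    apply: le_lt_trans (le_lebesgue_outer (@subIsetr _ A (K k))) _.
    by apply: le_lt_trans (lebesgue_outer_obox _ _) _; exact: ltry.
  rewrite -(fineK Bfin); case: (lo (B k `\` _)) => [r||]//=.
  by rewrite -EFinD eqe => /eqP h; congr (_%:E); apply: (addrI (fine (lo (B k)))); rewrite addr0.
have [N NP] := choice (fun k => null_hull (BA0 k)).
exists (\bigcup_k B k), (\bigcup_k N k); split.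
- by apply: bigcupT_measurable => k; have [] := BP k.
- by apply: bigcupT_measurable => k; have [] := NP k.
- by apply: bigcup_null => k; have [] := NP k.
- move=> x Ax; have [k _ xk] : (\bigcup_k K k) x by rewrite bigcup_obox_nat.
  by exists k => //; have [_ AB _] := BP k; apply: AB.
- move=> x [[k _ Bx] Ax]; exists k => //; have [_ BN _] := NP k.
  by apply: BN; split => // -[].
Qed.

(** Off a null set the sublevel sets at all rational levels coincide with Borel hulls, and these
    levels determine the function; on the null set the Borel version is put equal to 0. *)
Lemma lmeas_rfun_borel (g : vec -> R) : lmeas_rfun g ->
  exists (h : RnT -> R) (N : set RnT), [/\ measurable_fun setT h, measurable N, lam N = 0%E &
    forall x, ~ N x -> g x = h x].
Proof.
move=> mg; have [B /choice[N BN]] := choice (fun q : rat => lebesgue_hull (mg (ratr q))).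
(* The exceptional set is a union over the rationals, while [bigcup_null] is indexed by [nat]. *)
have [e eP] : exists e : nat -> rat, forall q, exists k, e k = q.
  exists (fun k => odflt 0 (unpickle k)) => q; exists (pickle q).
  by rewrite pickleK.
have mN : measurable (\bigcup_q N q).
  by apply: bigcupT_measurable_rat => q; have [] := BN q.
exists (fun x => if `[< (\bigcup_q N q) x >] then 0 else g x), (\bigcup_q N q); split => //.
- apply: (measurability (@measurable_realfun.RGenInftyO.G R)) => //.
    exact: measurable_realfun.RGenInftyO.measurableE.
  move=> _ [_ [c ->] <-]; rewrite setTI.
  rewrite [X in measurable X](_ : _ = ((\bigcup_q N q) `&` [set x | 0 < c]) `|`
     ((\bigcup_(q : rat) (if ratr q < c then B q else set0)) `\` (\bigcup_q N q))).
    apply: measurableU; last first.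
      apply: measurableD => //; apply: bigcupT_measurable_rat => q; case: ifP => // _.
      by have [] := BN q.
    apply: measurableI => //; have [c0|c0] := ltP 0 c.
      by rewrite (_ : [set _ | _] = setT)//; apply/seteqP; split.
    by rewrite (_ : [set _ | _] = set0)//; apply/seteqP; split => x //=.
  apply/seteqP; split => x /=; rewrite in_itv/=; case: asboolP => Nx.
  + by left.
  + move=> gc; right; split => //; have /rat_in_itvoo[q] := gc; rewrite in_itv/= => /andP[gq qc].
    by exists q => //; rewrite qc; have [_ _ _ + _] := BN q; apply.
  + by case=> [[]|[_ /(_ Nx)]].
  + case=> [[/Nx]//|[[q _] + _]]; case: ifP => // qc Bx; apply: lt_trans qc.
    by apply: contrapT => gx; apply: Nx; exists q => //; have [_ _ _ _] := BN q; apply.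
- rewrite (_ : \bigcup_q N q = \bigcup_k N (e k)).
    by apply: bigcup_null => k; have [] := BN (e k).
  apply/seteqP; split => x [q _ Nx]; last by exists (e q).
  by have [k ek] := eP q; exists k => //; rewrite ek.
- by move=> x Nx; case: asboolP.
Qed.

Import HBNNSimple.

(** Stated for arbitrary nonnegative functions, since Lebesgue measurable ones may fail to be Borel:
    the integral is a supremum over simple functions below the integrand, and each of these may be
    cut off on [N] without changing its integral. *)
Lemma nnintegral_null (f g : vec -> \bar R) (N : set RnT) : measurable N -> lam N = 0%E ->
  (forall x, (0 <= f x)%E) -> (forall x, (0 <= g x)%E) -> (forall x, ~ N x -> f x = g x) ->
  (lint setT f <= lint setT g)%E.
Proof.
move=> mN N0 f0 g0 fg; rewrite /lint !ge0_integralTE//.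
apply: ge_ereal_sup => _ [h hf <-].
pose h' := proj_nnsfun h (measurableC mN).
have h'E x : h' x = if `[< N x >] then 0 else h x.
  rewrite /h' /= mindicE; case: asboolP => Nx; last by rewrite mem_set ?mulr1.
  by rewrite memNset ?mulr0// => /(_ Nx).
apply: ereal_sup_ubound; exists h' => [x|].
  by rewrite h'E; case: asboolP => [//|Nx]; rewrite -fg.
rewrite -!integralT_nnsfun; apply: ae_eq_integral => //.
- by apply/measurable_EFinP; exact: measurable_funP.
- by apply/measurable_EFinP; exact: measurable_funP.
exists N; split => // x H; apply: contrapT => Nx; apply: H => _.
by rewrite h'E; case: asboolP.
Qed.

Lemma lint_null (f g : vec -> \bar R) (N : set vec) : lo N = 0%E ->
  (forall x, ~ N x -> f x = g x) -> lint setT f = lint setT g.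
Proof.
move=> /null_hull[B [mB NB B0]] fg.
have {}fg x : ~ B x -> f x = g x by move=> Bx; apply: fg => /NB.
rewrite /lint integralE [RHS]integralE; congr (_ - _)%E; apply/eqP; rewrite eq_le; apply/andP;
  split; apply: (nnintegral_null mB B0) => x; rewrite ?funepos_ge0 ?funeneg_ge0// => Bx;
  by rewrite ?funeposE ?funenegE fg.
Qed.

End lebesgue_Rn.

(** * Complex-valued integrals *)

Section complex_modulus.
Context {R : realType}.
Implicit Types z w : R[i].
Notation Re := complex.Re.
Notation Im := complex.Im.

Lemma iE : 'i%R = Complex 0 1 :> R[i].
Proof. by rewrite -complexiE. Qed.

Lemma rect_complexE (a b : R) : a%:C + 'i%R * b%:C = Complex a b.
Proof. by rewrite iE; apply/eqP; rewrite eq_complex /=; apply/andP; split; apply/eqP; ring. Qed.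

Lemma normc_cabs z : `|z| = (cabs z)%:C.
Proof. by rewrite normc_def. Qed.

Lemma Re_add z w : Re (z + w) = Re z + Re w. Proof. by case: z; case: w. Qed.
Lemma Im_add z w : Im (z + w) = Im z + Im w. Proof. by case: z; case: w. Qed.
Lemma Re_opp z : Re (- z) = - Re z. Proof. by case: z. Qed.
Lemma Im_opp z : Im (- z) = - Im z. Proof. by case: z. Qed.
Lemma Re_mul z w : Re (z * w) = Re z * Re w - Im z * Im w. Proof. by case: z; case: w. Qed.
Lemma Im_mul z w : Im (z * w) = Re z * Im w + Im z * Re w. Proof. by case: z; case: w. Qed.

Lemma cabs_ge0 z : 0 <= cabs z. Proof. exact: sqrtr_ge0. Qed.
Lemma cabsM z w : cabs (z * w) = cabs z * cabs w.
Proof. by apply: complexI; rewrite rmorphM /= -!normc_cabs normrM. Qed.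
Lemma cabsD z w : cabs (z + w) <= cabs z + cabs w.
Proof. by rewrite -lecR rmorphD /= -!normc_cabs ler_normD. Qed.
Lemma cabsN z : cabs (- z) = cabs z.
Proof. by apply: complexI; rewrite -!normc_cabs normrN. Qed.
Lemma cabsB z w : cabs (z - w) <= cabs z + cabs w.
Proof. by rewrite -(cabsN w) cabsD. Qed.
Lemma cabs_distC z w : cabs (z - w) = cabs (w - z).
Proof. by rewrite -cabsN opprB. Qed.
Lemma cabs0 : cabs (0 : R[i]) = 0.
Proof. by apply: complexI; rewrite -!normc_cabs normr0. Qed.
Lemma cabs1 : cabs (1 : R[i]) = 1.
Proof. by apply: complexI; rewrite -!normc_cabs normr1. Qed.
Lemma cabs_eq0 z : cabs z = 0 -> z = 0.
Proof. by move=> z0; apply/eqP; rewrite -normr_eq0 normc_cabs z0. Qed.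
Lemma cabs_real (x : R) : cabs x%:C = `|x|.
Proof. by rewrite /cabs /= expr0n addr0 sqrtr_sqr. Qed.
Lemma cabs_sum I (r : seq I) (F : I -> R[i]) :
  cabs (\sum_(i <- r) F i) <= \sum_(i <- r) cabs (F i).
Proof.
elim/big_ind2: _ => //; first by rewrite cabs0.
by move=> x y z t xy zt; apply: le_trans (cabsD _ _) _; exact: lerD.
Qed.
Lemma Re_le_cabs z : `|Re z| <= cabs z.
Proof. by rewrite -sqrtr_sqr /cabs ler_wsqrtr// lerDl sqr_ge0. Qed.
Lemma Im_le_cabs z : `|Im z| <= cabs z.
Proof. by rewrite -sqrtr_sqr /cabs ler_wsqrtr// lerDr sqr_ge0. Qed.
Lemma cabs_le_ReIm z : cabs z <= `|Re z| + `|Im z|.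
Proof.
rewrite [z in cabs z]complexE; apply: le_trans (cabsD _ _) _.
by rewrite cabsM !cabs_real (_ : cabs 'i%C = 1) ?mul1r// /cabs /= expr0n expr1n add0r sqrtr1.
Qed.
Lemma cabs_expi (t : R) : cabs (expi t) = 1.
Proof. by rewrite /expi rect_complexE /cabs /= cos2Dsin2 sqrtr1. Qed.
Lemma expiD (s t : R) : expi (s + t) = expi s * expi t.
Proof.
rewrite /expi !rect_complexE cosD sinD; apply/eqP; rewrite eq_complex /=.
by apply/andP; split; apply/eqP; ring.
Qed.
Lemma expi0 : expi (0 : R) = 1.
Proof. by rewrite /expi rect_complexE cos0 sin0. Qed.

(** The factor is the conjugate of [z] divided by [|z|]. It reduces the modulus of an integral to
    the integral of a real part in [cabs_cint]. *)
Lemma cabs_rotation z : exists w, cabs w = 1 /\ w * z = (cabs z)%:C.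
Proof.
have [->|z0] := eqVneq z 0; first by exists 1; rewrite cabs1 cabs0 mulr0.
exists (`|z|^-1 * z^*); split; last first.
  by rewrite -mulrA [z^* * z]mulrC -sqr_normc -normc_cabs expr2 mulrA mulVf ?mul1r// normr_eq0.
by apply: complexI; rewrite -normc_cabs normrM normcJ normfV normr_id mulVf// normr_eq0.
Qed.

End complex_modulus.

(** * Integrable complex functions on R^n *)

Section complex_integral.
Context {R : realType} {n : nat}.
Notation vec := 'rV[R]_n.+1.
Local Notation RnT := (Rn (R:=R) (n:=n.+1)).
Local Notation lam := (@lam R n.+1).
Notation Re := complex.Re.
Notation Im := complex.Im.
Implicit Types (f g : vec -> R[i]) (h : vec -> R).

(** [cmeas], [rintg] and [cintg] refer to Borel sets, where the integration theory takes place;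
    [lmeas_cfun] and [cintegrable] of the statement refer to Lebesgue measurable sets. *)
Definition cmeas f := measurable_fun setT ((fun x => Re (f x)) : RnT -> R) /\
  measurable_fun setT ((fun x => Im (f x)) : RnT -> R).
Definition rintg h := lam.-integrable setT (EFin \o h : RnT -> \bar R).
Definition cintg f := rintg (fun x => Re (f x)) /\ rintg (fun x => Im (f x)).
Definition rint h : R := \int[lam]_x (h : RnT -> R) x.

Lemma cintE f : cint f = Complex (rint (fun x => Re (f x))) (rint (fun x => Im (f x))).
Proof. by rewrite /cint rect_complexE. Qed.

Lemma Re_cint f : Re (cint f) = rint (fun x => Re (f x)). Proof. by rewrite cintE. Qed.
Lemma Im_cint f : Im (cint f) = rint (fun x => Im (f x)). Proof. by rewrite cintE. Qed.

Lemma cint_eq f g : rint (fun x => Re (f x)) = rint (fun x => Re (g x)) ->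
  rint (fun x => Im (f x)) = rint (fun x => Im (g x)) -> cint f = cint g.
Proof. by move=> fgR fgI; rewrite !cintE fgR fgI. Qed.

Lemma rintg_meas h : rintg h -> measurable_fun setT (h : RnT -> R).
Proof. by move=> /measurable_int/measurable_EFinP. Qed.

Lemma cintg_cmeas f : cintg f -> cmeas f.
Proof. by move=> [/rintg_meas ? /rintg_meas ?]. Qed.

Lemma rintg_le h k : measurable_fun setT (h : RnT -> R) -> (forall x, `|h x| <= k x) ->
  rintg k -> rintg h.
Proof.
move=> mh hk ik; apply: (le_integrable measurableT _ _ ik); first exact/measurable_EFinP.
by move=> x _ /=; rewrite lee_fin (le_trans (hk x))// ler_norm.
Qed.

Lemma cmeas_cabs f : cmeas f -> measurable_fun setT ((fun x => cabs (f x)) : RnT -> R).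
Proof.
move=> [mR mI]; apply: measurableT_comp; first exact: (continuous_measurable_fun (@sqrt_continuous R)).
by apply: measurable_funD; exact: measurable_funX.
Qed.

Lemma cintg_le f k : cmeas f -> (forall x, cabs (f x) <= k x) -> rintg k -> cintg f.
Proof.
move=> [mR mI] fk ik; split; apply: rintg_le ik => // x; apply: le_trans (fk x).
  exact: Re_le_cabs.
exact: Im_le_cabs.
Qed.

Lemma rintgD h k : rintg h -> rintg k -> rintg (fun x => h x + k x).
Proof. by move=> ih ik; have := integrableD measurableT ih ik. Qed.

Lemma rintgZ (c : R) h : rintg h -> rintg (fun x => c * h x).
Proof. by move=> ih; have := integrableZl measurableT c ih. Qed.

Lemma rintg0 : rintg (fun=> 0).
Proof. exact: (@integrable0 _ _ _ lam setT). Qed.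

Lemma rintg_norm h : rintg h -> rintg (fun x => `|h x|).
Proof. by move=> ih; have := integrable_norm ih. Qed.

Lemma rintgZr (c : R) h : rintg h -> rintg (fun x => h x * c).
Proof. by move=> /(rintgZ c); under eq_fun do rewrite mulrC. Qed.

Lemma rintg_sum (I : Type) (r : seq I) (H : I -> vec -> R) : (forall i, rintg (H i)) ->
  rintg (fun x => \sum_(i <- r) H i x).
Proof.
move=> iH; elim: r => [|i r IHr]; first by under eq_fun do rewrite big_nil; exact: rintg0.
by under eq_fun do rewrite big_cons; exact: rintgD.
Qed.

Lemma cintg_cabs f : cintg f -> rintg (fun x => cabs (f x)).
Proof.
move=> cf; have [iR iI] := cf; apply: rintg_le (rintgD (rintg_norm iR) (rintg_norm iI)).
  by apply: cmeas_cabs; exact: cintg_cmeas.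
by move=> x; rewrite ger0_norm ?cabs_ge0// cabs_le_ReIm.
Qed.

Lemma cintgD f g : cintg f -> cintg g -> cintg (fun x => f x + g x).
Proof.
move=> [fR fI] [gR gI]; split.
  by under eq_fun do rewrite Re_add; exact: rintgD.
by under eq_fun do rewrite Im_add; exact: rintgD.
Qed.

Lemma cintgZ (c : R[i]) f : cintg f -> cintg (fun x => c * f x).
Proof.
move=> [fR fI]; split.
  under eq_fun do rewrite Re_mul -mulNr; exact: rintgD (rintgZ _ fR) (rintgZ _ fI).
under eq_fun do rewrite Im_mul; exact: rintgD (rintgZ _ fI) (rintgZ _ fR).
Qed.

Lemma cintgZr (c : R[i]) f : cintg f -> cintg (fun x => f x * c).
Proof. by move=> /(cintgZ c); under eq_fun do rewrite mulrC. Qed.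

Lemma cintgN f : cintg f -> cintg (fun x => - f x).
Proof. by move=> /(cintgZ (-1)); under eq_fun do rewrite mulN1r. Qed.

Lemma cintgB f g : cintg f -> cintg g -> cintg (fun x => f x - g x).
Proof. by move=> cf cg; apply: cintgD => //; exact: cintgN. Qed.

Lemma cintg_sum (I : Type) (r : seq I) (F : I -> vec -> R[i]) : (forall i, cintg (F i)) ->
  cintg (fun x => \sum_(i <- r) F i x).
Proof.
move=> iF; elim: r => [|i r IHr].
  by under eq_fun do rewrite big_nil; split; exact: rintg0.
by under eq_fun do rewrite big_cons; exact: cintgD.
Qed.

Lemma rintD h k : rintg h -> rintg k -> rint (fun x => h x + k x) = rint h + rint k.
Proof. exact: RintegralD. Qed.

Lemma rintZ (c : R) h : rintg h -> rint (fun x => c * h x) = c * rint h.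
Proof. exact: RintegralZl. Qed.

Lemma le_rint h k : rintg h -> rintg k -> (forall x, h x <= k x) -> rint h <= rint k.
Proof. by move=> ih ik hk; apply: le_Rintegral => // x _; exact: hk. Qed.

Lemma rint_ge0 h : (forall x, 0 <= h x) -> 0 <= rint h.
Proof. by move=> h0; apply: Rintegral_ge0. Qed.

Lemma cintD f g : cintg f -> cintg g -> cint (fun x => f x + g x) = cint f + cint g.
Proof.
move=> [fR fI] [gR gI]; rewrite !cintE; congr Complex.
  by rewrite -rintD//; congr rint; apply/funext => x; rewrite Re_add.
by rewrite -rintD//; congr rint; apply/funext => x; rewrite Im_add.
Qed.

Lemma cintZ (c : R[i]) f : cintg f -> cint (fun x => c * f x) = c * cint f.
Proof.
move=> [fR fI]; rewrite !cintE; case: c => a b; congr Complex.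
  rewrite -mulNr -!rintZ// -rintD; [|exact: rintgZ..].
  by congr rint; apply/funext => x; rewrite Re_mul mulNr.
rewrite -!rintZ// -rintD; [|exact: rintgZ..].
by congr rint; apply/funext => x; rewrite Im_mul.
Qed.

Lemma cintZr (c : R[i]) f : cintg f -> cint (fun x => f x * c) = cint f * c.
Proof. by move=> cf; under eq_fun do rewrite mulrC; rewrite cintZ// mulrC. Qed.

Lemma cintN f : cintg f -> cint (fun x => - f x) = - cint f.
Proof. by move=> cf; under eq_fun do rewrite -mulN1r; rewrite cintZ// mulN1r. Qed.

Lemma cintB f g : cintg f -> cintg g -> cint (fun x => f x - g x) = cint f - cint g.
Proof. by move=> cf cg; rewrite cintD ?cintN//; exact: cintgN. Qed.

Lemma cint0 : cint (fun _ : vec => 0 : R[i]) = 0 :> R[i].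
Proof. by rewrite cintE /rint /= /Rintegral integral0. Qed.

Lemma cint_sum (I : Type) (r : seq I) (F : I -> vec -> R[i]) : (forall i, cintg (F i)) ->
  cint (fun x => \sum_(i <- r) F i x) = \sum_(i <- r) cint (F i).
Proof.
move=> iF; elim: r => [|i r IHr].
  by under eq_fun do rewrite big_nil; rewrite big_nil cint0.
under eq_fun do rewrite big_cons; rewrite big_cons cintD ?IHr//; exact: cintg_sum.
Qed.

(** The integral is rotated onto the positive real axis; estimating real and imaginary parts
    separately would lose a constant factor. *)
Lemma cabs_cint f : cintg f -> cabs (cint f) <= rint (fun x => cabs (f x)).
Proof.
move=> cf; have [w [w1 wz]] := cabs_rotation (cint f).
have -> : cabs (cint f) = Re (cint (fun x => w * f x)) by rewrite cintZ// wz.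
rewrite Re_cint; apply: le_rint; [by have [] := cintgZ w cf|exact: cintg_cabs|].
by move=> x; rewrite -[leRHS]mul1r -w1 -cabsM (le_trans (ler_norm _))// Re_le_cabs.
Qed.

Lemma cabs_cint_le f k : cmeas f -> (forall x, cabs (f x) <= k x) -> rintg k ->
  cabs (cint f) <= rint k.
Proof.
move=> mf fk ik; have cf := cintg_le mf fk ik.
by apply: le_trans (cabs_cint cf) _; apply: le_rint => //; exact: cintg_cabs.
Qed.

Lemma rint_translation (v : vec) h : measurable_fun setT (h : RnT -> R) ->
  rint (fun x => h (x + v)) = rint h.
Proof. by move=> mh; congr fine; exact: integral_translation. Qed.

Lemma cint_translation (v : vec) f : cmeas f -> cint (fun x => f (x + v)) = cint f.
Proof.
by move=> [mR mI]; rewrite !cintE; congr Complex;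
  [exact: (rint_translation v mR)|exact: (rint_translation v mI)].
Qed.

Lemma rintg_translation (v : vec) h : rintg h -> rintg (fun x => h (x + v)).
Proof.
move=> ih; have mh := rintg_meas ih; apply/integrableP; split.
  by apply/measurable_EFinP; exact: (measurableT_comp mh (measurable_translation v)).
move/integrableP : ih => [_]; rewrite -(ge0_integral_translation v)//.
by apply: measurableT_comp => //; exact/measurable_EFinP.
Qed.

Lemma cmeasM f g : cmeas f -> cmeas g -> cmeas (fun x => f x * g x).
Proof.
move=> [fR fI] [gR gI]; split.
  by under eq_fun do rewrite Re_mul; apply: measurable_funB; exact: measurable_funM.
by under eq_fun do rewrite Im_mul; apply: measurable_funD; exact: measurable_funM.
Qed.

Lemma cmeasD f g : cmeas f -> cmeas g -> cmeas (fun x => f x + g x).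
Proof.
move=> [fR fI] [gR gI]; split.
  by under eq_fun do rewrite Re_add; exact: measurable_funD.
by under eq_fun do rewrite Im_add; exact: measurable_funD.
Qed.

Lemma cmeas_cst (c : R[i]) : cmeas (fun=> c).
Proof. by split; exact: measurable_cst. Qed.

Definition ccont f := continuous (fun x => Re (f x)) /\ continuous (fun x => Im (f x)).

Lemma ccont_cmeas f : ccont f -> cmeas f.
Proof. by move=> [cR cI]; split; exact: continuous_measurable_Rn. Qed.

Lemma cmeas_lmeas f : cmeas f -> lmeas_cfun f.
Proof. by move=> [mR mI]; split; exact: borel_lmeas_rfun. Qed.

Lemma cintg_cintegrable f : cintg f -> cintegrable f.
Proof.
move=> cf; split; first by apply: cmeas_lmeas; exact: cintg_cmeas.
have /integrableP[_] := cintg_cabs cf.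
by rewrite /lint; under eq_integral => x _ do rewrite /= ger0_norm ?cabs_ge0//.
Qed.

End complex_integral.

(** * The Euclidean norm of row vectors *)

Section euclidean.
Context {R : realType} {n : nat}.
Notation vec := 'rV[R]_n.
Implicit Types x y z : vec.

Lemma dotpC x y : dotp x y = dotp y x.
Proof. by apply: eq_bigr => i _; rewrite mulrC. Qed.
Lemma dotpDl x y z : dotp (x + y) z = dotp x z + dotp y z.
Proof. by rewrite -big_split; apply: eq_bigr => i _; rewrite mxE mulrDl. Qed.
Lemma dotpZl (c : R) x z : dotp (c *: x) z = c * dotp x z.
Proof. by rewrite mulr_sumr; apply: eq_bigr => i _; rewrite mxE mulrA. Qed.
Lemma dotpDr x y z : dotp z (x + y) = dotp z x + dotp z y.
Proof. by rewrite dotpC dotpDl !(dotpC z). Qed.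
Lemma dotpZr (c : R) x z : dotp z (c *: x) = c * dotp z x.
Proof. by rewrite dotpC dotpZl (dotpC z). Qed.
Lemma dotpNr x z : dotp z (- x) = - dotp z x.
Proof. by rewrite -scaleN1r dotpZr mulN1r. Qed.
Lemma dotpNl x z : dotp (- x) z = - dotp x z.
Proof. by rewrite dotpC dotpNr dotpC. Qed.
Lemma dotp0r x : dotp x 0 = 0.
Proof. by apply: big1 => i _; rewrite mxE mulr0. Qed.
Lemma dotp_ge0 x : 0 <= dotp x x.
Proof. by apply: sumr_ge0 => i _; rewrite -expr2 sqr_ge0. Qed.
Lemma dotp_delta x i : dotp x (delta_mx ord0 i) = x ord0 i.
Proof.
rewrite /dotp (bigD1 i)//= mxE !eqxx mulr1 big1 ?addr0// => j /negbTE ji.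
by rewrite mxE ji andbF mulr0.
Qed.

Lemma enorm_ge0 x : 0 <= enorm x. Proof. exact: sqrtr_ge0. Qed.
Lemma enorm1_ge1 x : 1 <= 1 + enorm x. Proof. by rewrite lerDl enorm_ge0. Qed.
Lemma enorm1_gt0 x : 0 < 1 + enorm x.
Proof. exact: lt_le_trans (enorm1_ge1 x). Qed.
Lemma enorm_sqr x : enorm x ^+ 2 = dotp x x.
Proof. by rewrite sqr_sqrtr// dotp_ge0. Qed.
Lemma enorm0 : enorm (0 : vec) = 0.
Proof. by rewrite /enorm dotp0r sqrtr0. Qed.
Lemma enormN x : enorm (- x) = enorm x.
Proof. by rewrite /enorm dotpNl dotpNr opprK. Qed.
Lemma enorm_distC x y : enorm (x - y) = enorm (y - x).
Proof. by rewrite -enormN opprB. Qed.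

Lemma coord_le_enorm x i : `|x ord0 i| <= enorm x.
Proof.
rewrite -sqrtr_sqr ler_wsqrtr// /dotp (bigD1 i)//= -expr2 lerDl.
by apply: sumr_ge0 => j _; rewrite -expr2 sqr_ge0.
Qed.

Lemma enorm_le_sum x : enorm x <= \sum_i `|x ord0 i|.
Proof.
have S0 : 0 <= \sum_i `|x ord0 i| by apply: sumr_ge0.
rewrite -[leRHS]ger0_norm// -sqrtr_sqr ler_wsqrtr// expr2 mulr_suml.
apply: ler_sum => i _; apply: le_trans (ler_norm _) _; rewrite normrM.
by rewrite ler_wpM2l// (bigD1 i)//= lerDl sumr_ge0.
Qed.

Lemma cauchy_schwarz x y : `|dotp x y| <= enorm x * enorm y.
Proof.
rewrite -sqrtr_sqr /enorm -sqrtrM ?dotp_ge0// ler_wsqrtr//.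
have [y0|y0] := eqVneq (dotp y y) 0.
  suff -> : y = 0 by rewrite !dotp0r expr0n mulr0.
  apply/rowP => i; rewrite mxE; apply/eqP; rewrite -normr_le0.
  by apply: le_trans (coord_le_enorm y i) _; rewrite /enorm y0 sqrtr0.
have yp : 0 < dotp y y by rewrite lt0r y0 dotp_ge0.
have := dotp_ge0 (x - (dotp x y / dotp y y) *: y).
rewrite !(dotpDl, dotpDr, dotpNl, dotpNr, dotpZl, dotpZr) (dotpC y x).
set a := dotp x x; set b := dotp x y; set c := dotp y y in y0 yp *.
rewrite (_ : _ + _ = a - b ^+ 2 / c); last by field.
by rewrite subr_ge0 ler_pdivrMr.
Qed.

Lemma enormD x y : enorm (x + y) <= enorm x + enorm y.
Proof.
rewrite -(ler_pXn2r (ltn0Sn 1)) ?nnegrE ?addr_ge0 ?enorm_ge0//.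
rewrite sqrrD !enorm_sqr dotpDl !dotpDr (dotpC y x).
have := le_trans (ler_norm _) (cauchy_schwarz x y); lra.
Qed.

(** This submultiplicativity is how polynomial weights pass through translations. *)
Lemma enorm1D x y : 1 + enorm (x + y) <= (1 + enorm x) * (1 + enorm y).
Proof.
have := enormD x y; have := mulr_ge0 (enorm_ge0 x) (enorm_ge0 y); lra.
Qed.

End euclidean.

(** * Continuity, balls and an integrable weight *)

Section euclidean_topology.
Context {R : realType} {n : nat}.
Notation vec := 'rV[R]_n.+1.
Local Notation RnT := (Rn (R:=R) (n:=n.+1)).
Local Notation lam := (@lam R n.+1).
Implicit Types x y z : vec.

Lemma cts_cst (c : R) : continuous (fun _ : vec => c).
Proof. by move=> x; exact: cst_continuous. Qed.

Lemma ctsD (f g : vec -> R) : continuous f -> continuous g -> continuous (fun x => f x + g x).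
Proof. by move=> cf cg x; exact: (continuousD (cf x) (cg x)). Qed.

Lemma ctsM (f g : vec -> R) : continuous f -> continuous g -> continuous (fun x => f x * g x).
Proof. by move=> cf cg x; exact: (continuousM (cf x) (cg x)). Qed.

Lemma ctsN (f : vec -> R) : continuous f -> continuous (fun x => - f x).
Proof. by move=> cf x; exact: (continuousN (cf x)). Qed.

Lemma ctsB (f g : vec -> R) : continuous f -> continuous g -> continuous (fun x => f x - g x).
Proof. by move=> cf cg; apply: ctsD => //; exact: ctsN. Qed.

Lemma cts_comp (h : R -> R) (f : vec -> R) : continuous h -> continuous f ->
  continuous (fun x => h (f x)).
Proof. by move=> ch cf x; apply: continuous_comp; [exact: cf|exact: ch]. Qed.

Lemma cts_shift (f : vec -> R) (v : vec) : continuous f -> continuous (fun x => f (x + v)).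
Proof.
move=> cf x; apply: (continuous_comp (f := fun x => x + v) (g := f)); last exact: cf.
by apply: (@continuousD R vec vec id (fun=> v)) => //; exact: cst_continuous.
Qed.

Lemma continuous_coord (i : 'I_n.+1) : continuous (fun x : vec => x ord0 i).
Proof. exact: coord_continuous. Qed.

Lemma continuous_sum_fun (I : Type) (r : seq I) (F : I -> vec -> R) :
  (forall i, continuous (F i)) -> continuous (fun x => \sum_(i <- r) F i x).
Proof.
move=> cF; elim: r => [|i r IHr].
  by rewrite (_ : (fun x => _) = fun=> 0); [exact: cst_continuous|apply/funext => x; rewrite big_nil].
rewrite (_ : (fun x => _) = fun x => F i x + \sum_(j <- r) F j x).
  exact: ctsD.
by apply/funext => x; rewrite big_cons.
Qed.

Lemma continuous_dotp y : continuous (fun x : vec => dotp x y).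
Proof.
by apply: continuous_sum_fun => i; apply: ctsM; [exact: continuous_coord|exact: cts_cst].
Qed.

Lemma continuous_enorm : continuous (fun x : vec => enorm x).
Proof.
apply: cts_comp; first exact: sqrt_continuous.
by apply: continuous_sum_fun => i; apply: ctsM; exact: continuous_coord.
Qed.

Lemma measurable_eball y (r : R) : measurable (eball y r : set RnT).
Proof.
have mf : measurable_fun setT ((fun x => enorm (x - y)) : RnT -> R).
  by apply: continuous_measurable_Rn; apply: cts_shift; exact: continuous_enorm.
rewrite -[X in measurable X]setTI.
rewrite (_ : eball y r = (fun x => enorm (x - y)) @^-1` `]-oo, r[); first exact: mf.
by apply/seteqP; split => x /=; rewrite in_itv.
Qed.

Lemma eball_sub_obox y (r : R) : eball y r `<=` obox (y - const_mx r) (y + const_mx r).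
Proof.
move=> x yx i; rewrite !mxE -ltr_distl.
by apply: le_lt_trans yx; have := coord_le_enorm (x - y) i; rewrite !mxE.
Qed.

Lemma lebesgue_outer_eball y (r : R) : (lebesgue_outer (eball y r) < +oo)%E.
Proof.
apply: le_lt_trans (le_lebesgue_outer (@eball_sub_obox y r)) _.
by apply: le_lt_trans (lebesgue_outer_obox _ _) _; exact: ltry.
Qed.

(** The half-side [r / (n + 2)] keeps the sum of the [n + 1] coordinates strictly below [r]. *)
Lemma obox_sub_eball y (r : R) : 0 < r ->
  obox (y - const_mx (r / n.+2%:R)) (y + const_mx (r / n.+2%:R)) `<=` eball y r.
Proof.
move=> r0 x xy; apply: le_lt_trans (enorm_le_sum _) _.
apply: (@le_lt_trans _ _ (\sum_(i < n.+1) r / n.+2%:R)).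
  apply: ler_sum => i _; apply: ltW; have := xy i.
  by rewrite !mxE -ltr_distl.
rewrite sumr_const card_ord -[_ *+ n.+1]mulr_natr mulrAC -mulrA gtr_pMr//.
by rewrite ltr_pdivrMr ?mul1r ?ltr_nat.
Qed.

Lemma lebesgue_outer_eball_gt0 y (r : R) : 0 < r -> (0 < lebesgue_outer (eball y r))%E.
Proof.
move=> r0; apply: (lt_le_trans _ (le_lebesgue_outer (@obox_sub_eball y r r0))).
rewrite -/(lam _) lam_obox lte_fin; apply: prodr_gt0 => i _; rewrite lt_max; apply/orP; right.
have : 0 < r / n.+2%:R by rewrite divr_gt0.
by rewrite !mxE; move: (r / n.+2%:R) => e e0; lra.
Qed.

(** The exponent is twice the dimension, two powers per coordinate: the weight then lies below the
    product of the functions [1 / (1 + x_i^2)], whose integral is a power of [pi]. *)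
Definition weight x : R := (1 + enorm x) ^- (2 * n.+1).

Lemma weight_gt0 x : 0 < weight x.
Proof. by rewrite invr_gt0 exprn_gt0// enorm1_gt0. Qed.

Lemma integral_oneDsqr_inv : (\int[lebesgue_measure]_t ((oneDsqr (t : R))^-1)%:E = pi%:E)%E.
Proof.
rewrite ge0_symfun_integralT//=.
- rewrite (_ : [set x | _] = `[0, +oo[%classic).
    by rewrite integral0y_oneDsqr -EFinM mulrCA divff ?mulr1.
  by apply/seteqP; split => x/=; rewrite in_itv/= andbT.
- exact: continuous_oneDsqrV.
- by move=> x /=; rewrite /oneDsqr sqrrN.
Qed.

Lemma rintg_weight : rintg weight.
Proof.
have ip : rintg (fun x : vec => \prod_i (oneDsqr (x ord0 i))^-1).
  have mp : measurable_fun setT ((fun x : vec => \prod_i (oneDsqr (x ord0 i))^-1) : RnT -> R).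
    apply: measurable_prod => i _; apply: (measurableT_comp (f := fun t : R => (oneDsqr t)^-1)).
      exact: (continuous_measurable_fun (@continuous_oneDsqrV R)).
    exact: measurable_coord.
  apply/integrableP; split; first exact/measurable_EFinP.
  rewrite (eq_integral (fun x : RnT => (\prod_i (oneDsqr ((x : vec) ord0 i))^-1)%:E)); last first.
    by move=> x _ /=; rewrite ger0_norm// prodr_ge0.
  rewrite (integral_prod_coord (f := fun=> fun t => (oneDsqr t)^-1) (c := fun=> pi)) ?ltry//.
  - by move=> _; exact: (continuous_measurable_fun (@continuous_oneDsqrV R)).
  - by move=> _; exact: integral_oneDsqr_inv.
apply: rintg_le ip.
  apply: continuous_measurable_Rn => x; apply: (@continuousV R vec (fun x : vec => (1 + enorm x) ^+ (2 * n.+1))).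
    by rewrite expf_neq0// gt_eqF// enorm1_gt0.
  apply: (@cts_comp (fun t => t ^+ (2 * n.+1))); first exact: exprn_continuous.
  by apply: ctsD; [exact: cts_cst|exact: continuous_enorm].
move=> x; rewrite ger0_norm ?(ltW (weight_gt0 x))// /weight exprM prodfV lef_pV2.
- have -> : (1 + enorm x) ^+ 2 ^+ n.+1 = \prod_(i < n.+1) (1 + enorm x) ^+ 2.
    by rewrite prodr_const card_ord.
  apply: ler_prod => i _.
  rewrite (le_trans _ (oneDsqr_ge1 _))//= /oneDsqr.
  have := coord_le_enorm x i; have := enorm_ge0 x; move: (enorm x) => e e0 xe.
  by move: xe; rewrite ler_norml => /andP[]; nra.
- by rewrite posrE exprn_gt0// exprn_gt0// enorm1_gt0.
- by rewrite posrE prodr_gt0// => i _; rewrite (lt_le_trans _ (oneDsqr_ge1 _)).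
Qed.

End euclidean_topology.

(** * Fubini's theorem *)

Section fubini_Rn.
Context {R : realType} {n : nat}.
Notation vec := 'rV[R]_n.+1.
Local Notation RnT := (Rn (R:=R) (n:=n.+1)).
Local Notation lam := (@lam R n.+1).
Notation Re := complex.Re.
Notation Im := complex.Im.

Lemma rintg_cst_mul (F : vec -> vec -> R) (g h : vec -> R) (x : vec) :
  measurable_fun setT ((fun p => F p.1 p.2) : RnT * RnT -> R) ->
  (forall x y, `|F x y| <= g x * h y) -> rintg h -> rintg (F x).
Proof.
move=> mF Fgh ih; apply: rintg_le (rintgZ (g x) ih) => //.
exact: (measurableT_comp mF (@pair1_measurable _ _ RnT RnT x)).
Qed.

Lemma rint_fubini (F : vec -> vec -> R) (g h : vec -> R) :
  measurable_fun setT ((fun p => F p.1 p.2) : RnT * RnT -> R) ->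
  (forall x y, `|F x y| <= g x * h y) -> rintg g -> rintg h ->
  rint (fun x => rint (F x)) = rint (fun y => rint (fun x => F x y)).
Proof.
move=> mF Fgh ig ih.
have ix x : rintg (F x) by exact: (rintg_cst_mul _ mF Fgh ih).
have iy y : rintg (fun x => F x y).
  apply: (rintg_cst_mul (F := fun y x => F x y) (g := h) y _ _ ig).
    exact: (measurableT_comp mF (@measurable_swap _ _ RnT RnT)).
  by move=> a b; rewrite mulrC.
have mFE : measurable_fun setT ((fun p => (F p.1 p.2)%:E) : RnT * RnT -> \bar R).
  exact/measurable_EFinP.
pose slam : {sigma_finite_measure set RnT -> \bar R} := lam.
have intF : (slam \x slam)%E.-integrable setT ((fun p => (F p.1 p.2)%:E) : RnT * RnT -> \bar R).
  apply/(@integrable12ltyP _ _ _ _ _ slam slam _ mFE).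
  apply: (@le_lt_trans _ _ (\int[lam]_x ((g x * rint h)%:E))%E).
    apply: ge0_le_integral => //.
    - by move=> x _; apply: integral_ge0.
    - apply: (measurable_fun_fubini_tonelli_F (m2 := slam) (fun p : RnT * RnT => `|(F p.1 p.2)%:E|%E)) => //.
      exact: (measurableT_comp (@abse_measurable R setT) mFE).
    - by apply/measurable_EFinP; apply: rintg_meas; exact: rintgZr.
    move=> x _ /=; rewrite -rintZ// -[leLHS]fineK.
      by rewrite lee_fin; apply: le_rint => //; [exact: rintg_norm|exact: rintgZ].
    exact: (integrable_fin_num measurableT (rintg_norm (ix x))).
  by have := integrable_fin_num measurableT (rintgZr (rint h) ig); rewrite fin_numElt => /andP[].
have fub := Fubini (m1 := slam) (m2 := slam) intF.
congr fine; transitivity (\int[lam]_x \int[lam]_y (F x y)%:E)%E.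
  apply: eq_integral => x _; rewrite /rint /Rintegral fineK//.
  exact: (integrable_fin_num measurableT (ix x)).
rewrite fub; apply: eq_integral => y _; rewrite /rint /Rintegral fineK//.
exact: (integrable_fin_num measurableT (iy y)).
Qed.

Lemma cint_fubini (F : vec -> vec -> R[i]) (g h : vec -> R) :
  measurable_fun setT ((fun p => Re (F p.1 p.2)) : RnT * RnT -> R) ->
  measurable_fun setT ((fun p => Im (F p.1 p.2)) : RnT * RnT -> R) ->
  (forall x y, cabs (F x y) <= g x * h y) -> rintg g -> rintg h ->
  cint (fun x => cint (F x)) = cint (fun y => cint (fun x => F x y)).
Proof.
move=> mR mI Fgh ig ih; apply: cint_eq.
  rewrite (_ : (fun x => _) = fun x => rint (fun y => Re (F x y))); last first.
    by apply/funext => x; exact: Re_cint.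
  rewrite [in RHS](_ : (fun x => _) = fun y => rint (fun x => Re (F x y))); last first.
    by apply/funext => x; exact: Re_cint.
  by apply: (rint_fubini mR _ ig ih) => x y; apply: le_trans (Fgh x y); exact: Re_le_cabs.
rewrite (_ : (fun x => _) = fun x => rint (fun y => Im (F x y))); last first.
  by apply/funext => x; exact: Im_cint.
rewrite [in RHS](_ : (fun x => _) = fun y => rint (fun x => Im (F x y))); last first.
  by apply/funext => x; exact: Im_cint.
by apply: (rint_fubini mI _ ig ih) => x y; apply: le_trans (Fgh x y); exact: Im_le_cabs.
Qed.

Lemma measurable_expi_dotp (s : R) :
  measurable_fun setT ((fun p => Re (expi (s * dotp p.1 p.2))) : RnT * RnT -> R) /\
  measurable_fun setT ((fun p => Im (expi (s * dotp p.1 p.2))) : RnT * RnT -> R).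
Proof.
have md : measurable_fun setT ((fun p => s * dotp p.1 p.2) : RnT * RnT -> R).
  apply: measurable_funM => //; apply: measurable_sum => i.
  apply: measurable_funM; apply: (measurableT_comp (measurable_coord i)).
    exact: measurable_fst.
  exact: measurable_snd.
split.
  under eq_fun do rewrite /expi rect_complexE /=.
  exact: (measurableT_comp (continuous_measurable_fun (@continuous_cos R)) md).
under eq_fun do rewrite /expi rect_complexE /=.
exact: (measurableT_comp (continuous_measurable_fun (@continuous_sin R)) md).
Qed.

(** The multiplication formula of the Fourier transform: the double integral has the product
    majorant [|u x| |v y|], since the kernel has modulus 1. *)
Lemma cint_expi_swap (s : R) (u v : vec -> R[i]) : cintg u -> cintg v ->
  cint (fun x => u x * cint (fun y => v y * expi (s * dotp x y))) =
  cint (fun y => v y * cint (fun x => u x * expi (s * dotp x y))).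
Proof.
move=> cu cv; have [uR uI] := cintg_cmeas cu; have [vR vI] := cintg_cmeas cv.
have [eR eI] := measurable_expi_dotp s.
pose F x y := u x * (v y * expi (s * dotp x y)).
have Fle x y : cabs (F x y) <= cabs (u x) * cabs (v y).
  by rewrite /F !cabsM cabs_expi mulr1.
have cexp (f : vec -> R[i]) (e : vec -> R) : cintg f -> measurable_fun setT (e : RnT -> R) ->
    cintg (fun x => f x * expi (e x)).
  move=> cf me; apply: cintg_le (cintg_cabs cf).
    apply: cmeasM; first exact: cintg_cmeas.
    split; under eq_fun do rewrite /expi rect_complexE /=.
      exact: (measurableT_comp (continuous_measurable_fun (@continuous_cos R)) me).
    exact: (measurableT_comp (continuous_measurable_fun (@continuous_sin R)) me).
  by move=> x; rewrite cabsM cabs_expi mulr1.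
have me y : measurable_fun setT ((fun x => s * dotp x y) : RnT -> R).
  by apply: continuous_measurable_Rn; apply: ctsM; [exact: cts_cst|exact: continuous_dotp].
pose cm (f : RnT * RnT -> R[i]) := measurable_fun setT (fun p => Re (f p)) /\
  measurable_fun setT (fun p => Im (f p)).
have cmM f g : cm f -> cm g -> cm (fun p => f p * g p).
  move=> [fR fI] [gR gI]; split.
    by under eq_fun do rewrite Re_mul; apply: measurable_funB; apply: measurable_funM.
  by under eq_fun do rewrite Im_mul; apply: measurable_funD; apply: measurable_funM.
have mF : cm (fun p => F p.1 p.2).
  apply: (cmM); last (apply: (cmM); last exact: (conj eR eI)).
    split; [exact: (measurableT_comp uR measurable_fst)|exact: (measurableT_comp uI measurable_fst)].
  split; [exact: (measurableT_comp vR measurable_snd)|exact: (measurableT_comp vI measurable_snd)].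
transitivity (cint (fun x => cint (F x))).
  congr cint; apply/funext => x; rewrite -cintZ//; apply: cexp => //.
  by under eq_fun do rewrite dotpC; exact: me.
rewrite (@cint_fubini F (fun x => cabs (u x)) (fun x => cabs (v x))) //; [|..]; last 2 first.
- exact: cintg_cabs.
- exact: cintg_cabs.
- congr cint; apply/funext => y; rewrite -cintZ; last exact: cexp.
  by congr cint; apply/funext => x; rewrite /F mulrCA.
- by have [] := mF.
- by have [] := mF.
Qed.

End fubini_Rn.

(** * Smooth and Schwartz functions *)

Section one_variable.
Context {R : realType}.
Implicit Types (f g h : R -> R) (m k : nat).

Lemma is_derive_continuous h h' : (forall t : R, is_derive t 1 h (h' t)) -> continuous h.
Proof.
move=> dh t; apply: differentiable_continuous; apply/derivable1_diffP.
by have [] := dh t.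
Qed.

(** The class C^m on the line. Derivatives are existentially quantified instead of computed, so that
    each closure property only has to exhibit a candidate. *)
Fixpoint C1 m h : Prop := continuous h /\
  if m is m'.+1 then exists h', (forall t : R, is_derive t 1 h (h' t)) /\ C1 m' h' else True.

Lemma C1_S m h h' : (forall t : R, is_derive t 1 h (h' t)) -> C1 m h' -> C1 m.+1 h.
Proof. by move=> dh ch'; split; [exact: is_derive_continuous dh|exists h']. Qed.

Lemma C1_pred m h : C1 m.+1 h -> C1 m h.
Proof.
elim: m h => [|m IHm] h [ch [h' [dh ch']]]; first by split.
by split => //; exists h'; split => //; exact: IHm.
Qed.

Lemma C1_cst m (c : R) : C1 m (fun=> c).
Proof.
elim: m c => [|m IHm] c; first by split => // t; exact: cst_continuous.
have d0 (t : R) : is_derive t 1 (fun=> c) 0 by exact: is_derive_cst.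
exact: (C1_S d0).
Qed.

Lemma C1D m f g : C1 m f -> C1 m g -> C1 m (fun t => f t + g t).
Proof.
elim: m f g => [|m IHm] f g [cf Hf] [cg Hg].
  by split => // t; exact: (continuousD (cf t) (cg t)).
case: Hf Hg => f' [df cf'] [g' [dg cg']].
have dfg (t : R) : is_derive t 1 (fun t => f t + g t) (f' t + g' t) by exact: is_deriveD.
by apply: (C1_S dfg); exact: IHm.
Qed.

Lemma C1M m f g : C1 m f -> C1 m g -> C1 m (fun t => f t * g t).
Proof.
elim: m f g => [|m IHm] f g Hf Hg.
  by case: Hf Hg => cf _ [cg _]; split => // t; exact: (continuousM (cf t) (cg t)).
have [pf pg] := (C1_pred Hf, C1_pred Hg).
case: Hf Hg => _ [f' [df cf']] [_ [g' [dg cg']]].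
have dfg (t : R) : is_derive t 1 (fun t => f t * g t) (f t * g' t + g t * f' t) by exact: is_deriveM.
by apply: (C1_S dfg); apply: C1D; exact: IHm.
Qed.

Lemma C1Z m (c : R) f : C1 m f -> C1 m (fun t => c * f t).
Proof. by move=> cf; apply: C1M => //; exact: C1_cst. Qed.

Lemma C1_comp m f g : C1 m f -> C1 m g -> C1 m (fun t => f (g t)).
Proof.
elim: m f g => [|m IHm] f g Hf Hg.
  case: Hf Hg => cf _ [cg _]; split => // t.
  by apply: (continuous_comp (f := g) (g := f)); [exact: cg|exact: cf].
have pg := C1_pred Hg.
case: Hf Hg => _ [f' [df cf']] [_ [g' [dg cg']]].
have dfg (t : R) : is_derive t 1 (fun t => f (g t)) (f' (g t) * g' t) by exact: is_derive1_comp.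
by apply: (C1_S dfg); apply: C1M => //; exact: IHm.
Qed.

Lemma C1V m f : (forall t, f t != 0) -> C1 m f -> C1 m (fun t => (f t)^-1).
Proof.
move=> f0; elim: m => [|m IHm] Hf.
  by case: Hf => cf _; split => // t; apply: continuousV => //; exact: cf.
have pf := IHm (C1_pred Hf).
case: Hf => _ [f' [df cf']].
have dV (t : R) : is_derive t 1 (fun t => (f t)^-1) (- 1 * ((f t)^-1 * (f t)^-1 * f' t)).
  apply: (is_derive_eq (is_deriveV (f0 t) (df t))).
  by rewrite /GRing.scale /= expr2 invfM; ring.
by apply: (C1_S dV); apply: C1Z; apply: C1M => //; exact: C1M.
Qed.

Lemma C1_id m : C1 m id.
Proof.
case: m => [|m]; first by split => // t; exact: cvg_id.
have d1 (t : R) : is_derive t 1 id 1 by exact: is_derive_id.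
by apply: (C1_S d1); exact: C1_cst.
Qed.

Lemma C1_expR m : C1 m expR.
Proof.
elim: m => [|m IHm]; first by split => //; exact: continuous_expR.
have de (t : R) : is_derive t 1 expR (expR t) by exact: is_derive_expR.
exact: (C1_S de IHm).
Qed.

Lemma C1_cos_sin m : C1 m cos /\ C1 m sin.
Proof.
elim: m => [|m [IHc IHs]]; first by split; split => //; [exact: continuous_cos|exact: continuous_sin].
have ds (t : R) : is_derive t 1 sin (cos t) by exact: is_derive_sin.
split; last exact: (C1_S ds IHc).
have dc (t : R) : is_derive t 1 cos (- 1 * sin t) by rewrite mulN1r; exact: is_derive_cos.
by apply: (C1_S dc); exact: C1Z.
Qed.

(* Indexed by [k] because the span of these functions is closed under differentiation. *)
Definition psi k (t : R) : R := if 0 < t then t^-1 ^+ k * expR (- t^-1) else 0.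

Lemma expr_le_expR k (s : R) : 0 <= s -> s ^+ k.+1 <= k.+1`!%:R * expR s.
Proof.
move=> s0; rewrite mulrC -ler_pdivrMr ?ltr0n ?fact_gt0//.
by apply: le_trans (expR_ge1Dxn k s0); rewrite lerDr.
Qed.

Lemma psi_ge0 k t : 0 <= psi k t.
Proof.
by rewrite /psi; case: ifP => // t0; rewrite mulr_ge0 ?expR_ge0// exprn_ge0// invr_ge0 ltW.
Qed.

(** This is [expr_le_expR] at [s = 1 / t], and it gives the limit 0 at the origin for every index at
    once. *)
Lemma psi_le k t : psi k t <= k.+1`!%:R * `|t|.
Proof.
rewrite /psi; case: ifP => [t0|_]; last by rewrite mulr_ge0.
rewrite gtr0_norm// expRN ler_pdivrMr ?expR_gt0//.
have := expr_le_expR k (ltW (divr_gt0 ltr01 t0)); rewrite div1r exprS.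
by rewrite -(ler_pM2l t0) mulrA divff ?gt_eqF// mul1r mulrCA mulrA.
Qed.

Lemma psi_cvg0 k : psi k t @[t --> (0 : R)^'] --> (0 : R).
Proof.
apply/cvgrPdist_lt => e e0; near=> t.
rewrite sub0r normrN ger0_norm ?psi_ge0//; apply: le_lt_trans (psi_le _ _) _.
rewrite mulrC -ltr_pdivlMr ?ltr0n ?fact_gt0//; near: t.
by apply: dnbhs0_lt; rewrite divr_gt0// ltr0n fact_gt0.
Unshelve. all: by end_near. Qed.

Lemma is_derive_psi k (t : R) : is_derive t 1 (psi k) (psi k.+2 t - k%:R * psi k.+1 t).
Proof.
have psi_np j s : s <= 0 -> psi j s = 0 by move=> s0; rewrite /psi ltNge s0.
have [t0|t0|->] := ltgtP t 0.
- rewrite !psi_np ?(ltW t0)// mulr0 subr0.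
  have E : \near t, cst 0 t = psi k t.
    by near=> s; rewrite psi_np//; apply/ltW; near: s; exact: lt_nbhsl.
  exact: (near_eq_is_derive E (is_derive_cst 0 t 1)).
- pose e (s : R) := s^-1 ^+ k * expR (- s^-1).
  have E : \near t, e t = psi k t.
    by near=> s; rewrite /psi ifT//; near: s; exact: lt_nbhsr.
  have tn0 : t != 0 by rewrite gt_eqF.
  have dinv : is_derive t 1 (fun s : R => s^-1) (- t^-1 ^+ 2).
    apply: (is_derive_eq (is_deriveV (f := id) tn0 (is_derive_id t 1))).
    by rewrite /GRing.scale /= mulr1 exprVn.
  have dX := is_deriveX k dinv.
  have dE := is_derive1_comp (is_derive_expR _) (is_deriveN dinv).
  have de := is_deriveM dX dE.
  suff de' : is_derive t 1 e (psi k.+2 t - k%:R * psi k.+1 t).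
    exact: (near_eq_is_derive E de').
  have -> : e = GRing.inv ^+ k * (expR \o - GRing.inv) by apply/funext => s; rewrite /= exprfctE.
  apply: (is_derive_eq de); rewrite /psi t0 /GRing.scale /= (_ : (- GRing.inv) t = - t^-1)// exprfctE.
  by case: k {e E dX dE de} => [|k]; rewrite ?exprS ?expr0 /=; ring.
- rewrite !psi_np// mulr0 subr0.
  have cv : (fun h : R => h^-1 *: ((psi k \o shift 0) (h *: 1) - psi k 0)) @ 0^' --> (0 : R).
    (* The difference quotient of [psi k] at 0 is [psi k.+1], again a member of the family, and it
       tends to 0. *)
    suff -> : (fun h : R => h^-1 *: ((psi k \o shift 0) (h *: 1) - psi k 0)) = psi k.+1 by exact: psi_cvg0.
    apply/funext => h; rewrite /= (psi_np k 0)// subr0 addr0 /GRing.scale /= mulr1.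
    by rewrite /psi; case: ifP => _; rewrite ?mulr0// exprS mulrA.
  by apply: DeriveDef; [exact: cvgP cv|exact: cvg_lim cv].
Unshelve. all: by end_near. Qed.

Lemma C1_psi m k : C1 m (psi k).
Proof.
elim: m k => [|m IHm] k; first by split => //; exact: (is_derive_continuous (is_derive_psi k)).
apply: (C1_S (is_derive_psi k)); rewrite (_ : (fun t => _) = fun t => psi k.+2 t + (- k%:R) * psi k.+1 t).
  by apply: C1D => //; exact: C1Z.
by apply/funext => t; rewrite mulNr.
Qed.

(** The usual smooth transition from 0 on the negative half-line to 1 beyond [t = 1]. The two terms
    of the denominator never vanish together. *)
Definition smooth_step (t : R) : R := psi 0 t / (psi 0 t + psi 0 (1 - t)).

Lemma psi0_gt0 t : 0 < t -> 0 < psi 0 t.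
Proof. by move=> t0; rewrite /psi t0 mul1r expR_gt0. Qed.

Lemma smooth_step_den t : 0 < psi 0 t + psi 0 (1 - t).
Proof.
have [t0|t0] := ltP 0 t; first by rewrite ltr_pwDl ?psi_ge0// psi0_gt0.
by rewrite ltr_wpDl ?psi_ge0// psi0_gt0//; lra.
Qed.

Lemma C1_smooth_step m : C1 m smooth_step.
Proof.
apply: C1M; first exact: C1_psi.
apply: C1V => [t|]; first by rewrite gt_eqF// smooth_step_den.
apply: C1D; first exact: C1_psi.
apply: (C1_comp (C1_psi m 0)); apply: C1D; first exact: C1_cst.
have -> : -%R = (fun t : R => - 1 * t) by apply/funext => t; rewrite mulN1r.
exact: (C1Z (-1) (C1_id m)).
Qed.

Lemma smooth_step_ge0 t : 0 <= smooth_step t.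
Proof. by rewrite divr_ge0 ?psi_ge0// ltW// smooth_step_den. Qed.

Lemma smooth_step_le1 t : smooth_step t <= 1.
Proof. by rewrite ler_pdivrMr ?smooth_step_den// mul1r lerDl psi_ge0. Qed.

Lemma smooth_step_le0 t : t <= 0 -> smooth_step t = 0.
Proof. by move=> t0; rewrite /smooth_step /psi ltNge t0 mul0r. Qed.

Lemma smooth_step_ge1 t : 1 <= t -> smooth_step t = 1.
Proof.
move=> t1; have t0 : 0 < t by apply: lt_le_trans t1.
rewrite /smooth_step {3}/psi ifF ?addr0 ?divff ?gt_eqF ?psi0_gt0//.
by apply/negbTE; rewrite -leNgt subr_le0.
Qed.

End one_variable.

(** * Smooth functions of several variables *)

Section smooth_functions.
Context {R : realType} {n : nat}.
Notation vec := 'rV[R]_n.+1.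
Implicit Types (f g : vec -> R) (k : nat) (al : seq 'I_n.+1).

(** The class C^k on R^n, in the same existential form as [C1]. Closure properties are proved here
    and transferred to [smooth_r], whose iterated derivatives are fixed expressions and awkward for
    induction. *)
Fixpoint Ck k g : Prop := continuous g /\
  if k is k'.+1 then exists g' : 'I_n.+1 -> vec -> R,
    (forall i x, is_derive x 'e_i g (g' i x)) /\ (forall i, Ck k' (g' i)) else True.

Lemma Ck_cts k g : Ck k g -> continuous g. Proof. by case: k => [|k] []. Qed.

Lemma Ck_S k g (g' : 'I_n.+1 -> vec -> R) : continuous g ->
  (forall i x, is_derive x 'e_i g (g' i x)) -> (forall i, Ck k (g' i)) -> Ck k.+1 g.
Proof. by move=> cg dg cg'; split => //; exists g'. Qed.

Lemma Ck_pred k g : Ck k.+1 g -> Ck k g.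
Proof.
elim: k g => [|k IHk] g [cg [g' [dg cg']]]; first by split.
by split => //; exists g'; split => // i; exact: IHk.
Qed.

Lemma pdn_rcons al i g : pdn (rcons al i) g = pdn al (pd i g).
Proof. by elim: al => [//|j al IHal] /=; rewrite IHal. Qed.

Lemma smooth_pd g i : smooth_r g -> smooth_r (pd i g).
Proof. by move=> sg al; rewrite -pdn_rcons; exact: sg. Qed.

Lemma is_derive_pd g (g' : 'I_n.+1 -> vec -> R) i :
  (forall x, is_derive x 'e_i g (g' i x)) -> pd i g = g' i.
Proof. by move=> dg; apply/funext => x; have [_ <-] := dg x. Qed.

Lemma smooth_is_derive g i x : smooth_r g -> is_derive x 'e_i g (pd i g x).
Proof. by move=> sg; have [_ dg] := sg [::]; apply: DeriveDef => //; exact: dg. Qed.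

Lemma smooth_cts g : smooth_r g -> continuous g.
Proof. by move=> /(_ [::])[]. Qed.

(** In [pdn] the head of the list is the outermost derivative. The converse is by induction on the
    last entry, which acts first, so that the hypothesis applies to [pd i g]. *)
Lemma smooth_Ck g : smooth_r g <-> forall k, Ck k g.
Proof.
split.
  move=> sg k; elim: k g sg => [|k IHk] g sg; first by split => //; exact: smooth_cts.
  have dg i x : is_derive x 'e_i g (pd i g x) by exact: smooth_is_derive.
  by apply: (Ck_S (smooth_cts sg) dg) => i; apply: IHk; exact: smooth_pd.
move=> cg al; elim/last_ind: al g cg => [|al i IHal] g cg.
  split; first exact: Ck_cts (cg 0%N).
  by move=> i x; have [_ [g' [dg _]]] := cg 1%N; have [] := dg i x.
rewrite pdn_rcons; apply: IHal => k.
have [_ [g' [dg cg']]] := cg k.+1.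
by rewrite (is_derive_pd (dg i)); exact: cg'.
Qed.

Lemma CkD k f g : Ck k f -> Ck k g -> Ck k (fun x => f x + g x).
Proof.
elim: k f g => [|k IHk] f g [cf Hf] [cg Hg]; first by split => //; exact: ctsD.
case: Hf Hg => f' [df cf'] [g' [dg cg']].
have dfg i x : is_derive x 'e_i (fun x => f x + g x) (f' i x + g' i x) by exact: is_deriveD.
apply: (Ck_S (g' := fun i x => f' i x + g' i x) (ctsD cf cg) dfg) => i.
exact: (IHk _ _ (cf' i) (cg' i)).
Qed.

Lemma CkM k f g : Ck k f -> Ck k g -> Ck k (fun x => f x * g x).
Proof.
elim: k f g => [|k IHk] f g Hf Hg.
  by case: Hf Hg => cf _ [cg _]; split => //; exact: ctsM.
have [pf pg] := (Ck_pred Hf, Ck_pred Hg).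
case: Hf Hg => cf [f' [df cf']] [cg [g' [dg cg']]].
have dfg i x : is_derive x 'e_i (fun x => f x * g x) (f x * g' i x + g x * f' i x).
  exact: is_deriveM.
apply: (Ck_S (g' := fun i x => f x * g' i x + g x * f' i x) (ctsM cf cg) dfg) => i.
by apply: CkD; [exact: (IHk _ _ pf (cg' i))|exact: (IHk _ _ pg (cf' i))].
Qed.

Lemma Ck_cst k (c : R) : Ck k (fun=> c).
Proof.
elim: k c => [|k IHk] c; first by split => //; exact: cts_cst.
have d0 i (x : vec) : is_derive x 'e_i (fun=> c) 0 by exact: is_derive_cst.
by apply: (Ck_S (g' := fun _ _ => 0) (@cts_cst _ _ c) d0) => i; exact: IHk.
Qed.

Lemma is_derive_coord j i (x : vec) : is_derive x 'e_i (fun y : vec => y ord0 j) (i == j)%:R.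
Proof.
have cv : (fun h : R => h^-1 *: (((fun y : vec => y ord0 j) \o shift x) (h *: 'e_i) - x ord0 j)) @ 0^'
    --> ((i == j)%:R : R).
  apply: (cvg_trans (near_eq_cvg _)); last exact: (cvg_cst ((i == j)%:R : R)).
  near=> h; rewrite /= !mxE eqxx /= addrK /GRing.scale /= mulrA mulVf ?mul1r//.
  by rewrite eq_sym.
  by near: h; exact: nbhs_dnbhs_neq.
by apply: DeriveDef; [exact: cvgP cv|exact: cvg_lim cv].
Unshelve. all: by end_near. Qed.

Lemma Ck_coord k j : Ck k (fun x : vec => x ord0 j).
Proof.
case: k => [|k]; first by split => //; exact: continuous_coord.
apply: (Ck_S (g' := fun i _ => (i == j)%:R) (@continuous_coord _ _ j)).
  exact: is_derive_coord.
by move=> i; exact: Ck_cst.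
Qed.

(** A derivative in direction [v] is the derivative at 0 along the line [t *: v + x], which reduces
    the claim to the chain rule in one variable. *)
Lemma is_derive_comp1 (h : R -> R) g (x v : vec) (a b : R) :
  is_derive (g x) 1 h a -> is_derive x v g b -> is_derive x v (fun y => h (g y)) (a * b).
Proof.
move=> dh dg.
have line (f : vec -> R) (c : R) : is_derive x v f c <-> is_derive (0 : R) 1 (fun t : R => f (t *: v + x)) c.
  have E : (fun s : R => s^-1 *: ((f \o shift x) (s *: v) - f x)) =
      (fun s : R => s^-1 *: (((fun t : R => f (t *: v + x)) \o shift 0) (s *: 1) - (fun t : R => f (t *: v + x)) 0)).
    by apply/funext => s; rewrite /= addr0 scale0r add0r /GRing.scale /= mulr1.
  by split=> -[h1 h2]; apply: DeriveDef; move: h1 h2; rewrite /derivable /derive E.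
apply/line; have := (line g b).1 dg => dg'.
apply: (is_derive1_comp (f := h) (g := fun t : R => g (t *: v + x))) => //.
by rewrite scale0r add0r.
Qed.

Lemma Ck_comp k (h : R -> R) g : C1 k h -> Ck k g -> Ck k (fun x => h (g x)).
Proof.
elim: k h g => [|k IHk] h g Hh Hg.
  by case: Hh Hg => ch _ [cg _]; split => //; exact: cts_comp.
have pg := Ck_pred Hg.
case: Hh Hg => ch [h' [dh ch']] [cg [g' [dg cg']]].
have dhg i x : is_derive x 'e_i (fun x => h (g x)) (h' (g x) * g' i x) by exact: is_derive_comp1.
apply: (Ck_S (g' := fun i x => h' (g x) * g' i x) (cts_comp ch cg) dhg) => i.
exact: (CkM (IHk _ _ ch' pg) (cg' i)).
Qed.

Lemma smoothD f g : smooth_r f -> smooth_r g -> smooth_r (fun x => f x + g x).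
Proof. by move=> /smooth_Ck sf /smooth_Ck sg; apply/smooth_Ck => k; exact: CkD. Qed.
Lemma smoothM f g : smooth_r f -> smooth_r g -> smooth_r (fun x => f x * g x).
Proof. by move=> /smooth_Ck sf /smooth_Ck sg; apply/smooth_Ck => k; exact: CkM. Qed.
Lemma smooth_cst (c : R) : smooth_r (fun _ : vec => c).
Proof. by apply/smooth_Ck => k; exact: Ck_cst. Qed.
Lemma smooth_coord j : smooth_r (fun x : vec => x ord0 j).
Proof. by apply/smooth_Ck => k; exact: Ck_coord. Qed.
Lemma smooth_comp (h : R -> R) g : (forall k, C1 k h) -> smooth_r g -> smooth_r (fun x => h (g x)).
Proof. by move=> sh /smooth_Ck sg; apply/smooth_Ck => k; exact: Ck_comp. Qed.
Lemma smoothZ (c : R) f : smooth_r f -> smooth_r (fun x => c * f x).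
Proof. exact: (smoothM (smooth_cst c)). Qed.
Lemma smoothN f : smooth_r f -> smooth_r (fun x => - f x).
Proof. by move=> /(smoothZ (-1)); under eq_fun do rewrite mulN1r. Qed.
Lemma smoothB f g : smooth_r f -> smooth_r g -> smooth_r (fun x => f x - g x).
Proof. by move=> sf sg; exact: (smoothD sf (smoothN sg)). Qed.
Lemma smooth_sum (I : Type) (r : seq I) (F : I -> vec -> R) :
  (forall i, smooth_r (F i)) -> smooth_r (fun x => \sum_(i <- r) F i x).
Proof.
move=> sF; elim: r => [|i r IHr].
  by under eq_fun do rewrite big_nil; exact: smooth_cst.
by under eq_fun do rewrite big_cons; exact: (smoothD (sF i) IHr).
Qed.
Lemma smooth_prod (I : Type) (r : seq I) (F : I -> vec -> R) :
  (forall i, smooth_r (F i)) -> smooth_r (fun x => \prod_(i <- r) F i x).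
Proof.
move=> sF; elim: r => [|i r IHr].
  by under eq_fun do rewrite big_nil; exact: smooth_cst.
by under eq_fun do rewrite big_cons; exact: (smoothM (sF i) IHr).
Qed.
Lemma smooth_dotp (y : vec) : smooth_r (fun x : vec => dotp x y).
Proof.
apply: smooth_sum => i; apply: smoothM; [exact: smooth_coord|exact: smooth_cst].
Qed.
Lemma smooth_enorm2 : smooth_r (fun x : vec => enorm x ^+ 2).
Proof.
by under eq_fun do rewrite enorm_sqr; apply: smooth_sum => i; apply: smoothM; exact: smooth_coord.
Qed.

Lemma is_derive_shift_fun g (x v w : vec) (c : R) :
  is_derive (x + w) v g c -> is_derive x v (fun y => g (y + w)) c.
Proof.
have E : (fun s : R => s^-1 *: (((fun y => g (y + w)) \o shift x) (s *: v) - g (x + w))) =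
    (fun s : R => s^-1 *: ((g \o shift (x + w)) (s *: v) - g (x + w))).
  by apply/funext => s; rewrite /= addrA.
by move=> [h1 h2]; apply: DeriveDef; move: h1 h2; rewrite /derivable /derive E.
Qed.

Lemma pd_shift g (w : vec) i : smooth_r g -> pd i (fun y => g (y + w)) = (fun x => pd i g (x + w)).
Proof.
move=> sg; apply/funext => x.
by have [_ H] := is_derive_shift_fun (smooth_is_derive i (x + w) sg); exact: H.
Qed.

Lemma pdn_shift g (w : vec) al : smooth_r g ->
  pdn al (fun y => g (y + w)) = (fun x => pdn al g (x + w)).
Proof.
elim/last_ind: al g => [|al i IHal] g sg; first by [].
by rewrite !pdn_rcons (pd_shift w i sg) (IHal _ (smooth_pd i sg)).
Qed.

Lemma smooth_shift g (w : vec) : smooth_r g -> smooth_r (fun y => g (y + w)).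
Proof.
move=> sg al; rewrite pdn_shift//; have [cg dg] := sg al; split; first exact: cts_shift.
move=> i x; have dgx : is_derive (x + w) 'e_i (pdn al g) ('D_('e_i) (pdn al g) (x + w)).
  by apply: DeriveDef => //; exact: dg.
by have [] := is_derive_shift_fun dgx.
Qed.

Lemma pdD f g i : smooth_r f -> smooth_r g -> pd i (fun x => f x + g x) = fun x => pd i f x + pd i g x.
Proof.
by move=> sf sg; apply/funext => x; have [_ H] := is_deriveD (smooth_is_derive i x sf) (smooth_is_derive i x sg); exact: H.
Qed.

Lemma pdM f g i : smooth_r f -> smooth_r g ->
  pd i (fun x => f x * g x) = fun x => pd i f x * g x + f x * pd i g x.
Proof.
move=> sf sg; apply/funext => x.
have [_ H] := is_deriveM (smooth_is_derive i x sf) (smooth_is_derive i x sg).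
by rewrite addrC (mulrC (pd i f x)); exact: H.
Qed.

Lemma pd_cst (c : R) i : pd i (fun _ : vec => c) = fun=> 0.
Proof. by apply/funext => x; have [_ H] := is_derive_cst c x 'e_i; exact: H. Qed.

Lemma pdZ (c : R) f i : smooth_r f -> pd i (fun x => c * f x) = fun x => c * pd i f x.
Proof.
move=> sf; rewrite (pdM i (smooth_cst c) sf) pd_cst.
by apply/funext => x; rewrite mul0r add0r.
Qed.

Lemma pd_coord i j : pd i (fun x : vec => x ord0 j) = fun=> (i == j)%:R.
Proof. by apply/funext => x; have [_ H] := is_derive_coord j i x; exact: H. Qed.

Lemma pdnD al f g : smooth_r f -> smooth_r g ->
  pdn al (fun x => f x + g x) = fun x => pdn al f x + pdn al g x.
Proof.
elim/last_ind: al f g => [|al i IHal] f g sf sg; first by [].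
by rewrite !pdn_rcons (pdD i sf sg) (IHal _ _ (smooth_pd i sf) (smooth_pd i sg)).
Qed.

Lemma pdnZ al (c : R) f : smooth_r f -> pdn al (fun x => c * f x) = fun x => c * pdn al f x.
Proof.
elim/last_ind: al f => [|al i IHal] f sf; first by [].
by rewrite !pdn_rcons (pdZ c i sf) (IHal _ (smooth_pd i sf)).
Qed.

Lemma pdn_cst al (c : R) : pdn al (fun _ : vec => c) = fun=> if al is [::] then c else 0.
Proof.
case/lastP: al => [//|al i]; rewrite pdn_rcons pd_cst.
have -> : pdn al (fun _ : vec => 0 : R) = fun=> 0.
  elim/last_ind: al => [//|al j IHal]; by rewrite pdn_rcons pd_cst.
by case: (rcons al i) (size_rcons al i).
Qed.

(** A crude Leibniz estimate: each differentiation turns one product into two, whence the factor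
    [2 ^+ size al]. *)
Lemma pdn_mul_le (N : nat) f g (x : vec) (A B : R) : smooth_r f -> smooth_r g ->
  (forall be, (size be <= N)%N -> `|pdn be f x| <= A) ->
  (forall be, (size be <= N)%N -> `|pdn be g x| <= B) ->
  forall al, (size al <= N)%N -> `|pdn al (fun x => f x * g x) x| <= 2 ^+ size al * (A * B).
Proof.
move=> sf sg fA gB al; elim/last_ind: al N f g sf sg fA gB => [|al i IHal] N f g sf sg fA gB sN.
  by rewrite /= expr0 mul1r normrM; apply: ler_pM => //; [exact: (fA [::])|exact: (gB [::])].
have [sf' sg'] := (smooth_pd i sf, smooth_pd i sg).
rewrite pdn_rcons (pdM i sf sg) (pdnD al (smoothM sf' sg) (smoothM sf sg')).
rewrite size_rcons in sN *.
case: N => [|N] in fA gB sN *; first by [].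
have fA' be : (size be <= N)%N -> `|pdn be (pd i f) x| <= A.
  by move=> sb; rewrite -pdn_rcons; apply: fA; rewrite size_rcons.
have gB' be : (size be <= N)%N -> `|pdn be (pd i g) x| <= B.
  by move=> sb; rewrite -pdn_rcons; apply: gB; rewrite size_rcons.
apply: le_trans (ler_normD _ _) _; rewrite exprS -mulrA mulr2n mulrDl mul1r; apply: lerD.
  by apply: (IHal N _ _ sf' sg fA' _ sN) => be sb; apply: gB; exact: leqW.
by apply: (IHal N _ _ sf sg' _ gB' sN) => be sb; apply: fA; exact: leqW.
Qed.

End smooth_functions.

(** * Mean value estimates for the exponential *)

Section mean_value.
Context {R : realType}.

Lemma mean_value (f f' : R -> R) (a b : R) : (forall t : R, is_derive t 1 f (f' t)) ->
  exists c, `|c - a| <= `|b - a| /\ f b - f a = f' c * (b - a).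
Proof.
move=> df; have cf := is_derive_continuous df.
have [ab|/ltW ba] := leP a b.
  have [c cab fcE] := MVT_segment ab (fun x _ => df x) (continuous_subspaceT cf).
  exists c; split=> //; move: cab; rewrite in_itv/= => /andP[ac cb].
  by rewrite !ger0_norm ?subr_ge0// lerD2r.
have [c cab fcE] := MVT_segment ba (fun x _ => df x) (continuous_subspaceT cf).
exists c; split; last by rewrite -opprB fcE -mulrN opprB.
move: cab; rewrite in_itv/= => /andP[bc ca].
by rewrite !ler0_norm ?subr_le0// lerN2 lerD2r.
Qed.

Lemma sin_lip (a b : R) : `|sin a - sin b| <= `|a - b|.
Proof.
have [c [_ ->]] := @mean_value sin cos b a (fun t => is_derive_sin t).
by rewrite normrM ler_piMl// ler_norml cos_geN1 cos_le1.
Qed.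

Lemma cos_lip (a b : R) : `|cos a - cos b| <= `|a - b|.
Proof.
have [c [_ ->]] := @mean_value cos (fun t => - sin t) b a (fun t => is_derive_cos t).
by rewrite normrM normrN ler_piMl// ler_norml sin_geN1 sin_le1.
Qed.

Lemma expi_lip (a b : R) : cabs (expi a - expi b) <= 2 * `|a - b|.
Proof.
apply: le_trans (cabs_le_ReIm _) _; rewrite /expi !rect_complexE /= mulrDl mul1r.
by apply: lerD; [exact: cos_lip|exact: sin_lip].
Qed.

(** The parts [cos t - 1] and [sin t - t] contribute [t^2] each, by the mean value theorem followed
    by the Lipschitz bounds for sine and cosine. *)
Lemma expi_taylor (t : R) : cabs (expi t - 1 - 'i%R * t%:C) <= 2 * t ^+ 2.
Proof.
apply: le_trans (cabs_le_ReIm _) _; rewrite /expi !rect_complexE iE /=.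
rewrite !(mul0r, mul1r, mulr0, subr0, add0r, addr0, oppr0) mulrDl mul1r; apply: lerD.
  have [c [ct E]] := @mean_value cos (fun t => - sin t) 0 t (fun t => is_derive_cos t).
  rewrite -cos0 E subr0 normrM normrN -(real_normK (num_real t)) expr2 ler_wpM2r//.
  have := sin_lip c 0; rewrite sin0 subr0 => /le_trans; apply.
  by move: ct; rewrite !subr0.
have dg (s : R) : is_derive s 1 (fun s => sin s - s) (cos s - 1).
  exact: (is_deriveB (is_derive_sin s) (is_derive_id s 1)).
have [c [ct E]] := mean_value 0 t dg.
rewrite (_ : sin t - t = sin t - t - (sin 0 - 0)); last by rewrite sin0 !subr0.
rewrite E subr0 normrM -(real_normK (num_real t)) expr2 ler_wpM2r//.
have := cos_lip c 0; rewrite cos0 subr0 => /le_trans; apply.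
by move: ct; rewrite !subr0.
Qed.

End mean_value.

(** * Schwartz seminorms *)

Section schwartz_seminorms.
Context {R : realType} {n : nat}.
Notation vec := 'rV[R]_n.+1.
Notation Re := complex.Re.
Notation Im := complex.Im.
Implicit Types (u v E : vec -> R[i]) (N k : nat) (al be : seq 'I_n.+1).

Definition reparts u : vec -> R := fun x => Re (u x).
Definition imparts u : vec -> R := fun x => Im (u x).

Lemma cpdnE al u x : cpdn al u x = Complex (pdn al (reparts u) x) (pdn al (imparts u) x).
Proof. by rewrite /cpdn rect_complexE. Qed.

Lemma reparts_cpdn al u : reparts (cpdn al u) = pdn al (reparts u).
Proof. by apply/funext => x; rewrite /reparts cpdnE. Qed.
Lemma imparts_cpdn al u : imparts (cpdn al u) = pdn al (imparts u).
Proof. by apply/funext => x; rewrite /imparts cpdnE. Qed.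

Lemma cfun_eq u v : reparts u = reparts v -> imparts u = imparts v -> u = v.
Proof.
move=> uvR uvI; apply/funext => x; apply/eqP; rewrite eq_complex.
by rewrite -/(reparts u x) -/(imparts u x) uvR uvI !eqxx.
Qed.

Lemma cpdn_nil u : cpdn [::] u = u.
Proof. by apply: cfun_eq; rewrite ?reparts_cpdn ?imparts_cpdn. Qed.

Lemma cpdn_cat al be u : cpdn (al ++ be) u = cpdn al (cpdn be u).
Proof.
have pdn_cat (g : vec -> R) : pdn (al ++ be) g = pdn al (pdn be g).
  by elim: al => [//|i al IHal] /=; rewrite IHal.
by apply: cfun_eq; rewrite ?reparts_cpdn ?imparts_cpdn pdn_cat.
Qed.

Lemma smooth_c_cpdn al u : smooth_c u -> smooth_c (cpdn al u).
Proof.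
have H (g : vec -> R) : smooth_r g -> smooth_r (pdn al g).
  by elim: al => [//|i al IHal] /= sg; apply: smooth_pd; exact: IHal.
move=> [sR sI]; rewrite /smooth_c -/(reparts _) -/(imparts _) reparts_cpdn imparts_cpdn.
by split; [exact: (H _ sR)|exact: (H _ sI)].
Qed.

Lemma smooth_ccont u : smooth_c u -> ccont u.
Proof. by move=> [sR sI]; split; [exact: (smooth_cts sR)|exact: (smooth_cts sI)]. Qed.

Lemma smooth_cD u v : smooth_c u -> smooth_c v -> smooth_c (fun x => u x + v x).
Proof.
move=> [uR uI] [vR vI]; split.
  by under eq_fun do rewrite Re_add; exact: (smoothD uR vR).
by under eq_fun do rewrite Im_add; exact: (smoothD uI vI).
Qed.

Lemma smooth_cM u v : smooth_c u -> smooth_c v -> smooth_c (fun x => u x * v x).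
Proof.
move=> [uR uI] [vR vI]; split.
  by under eq_fun do rewrite Re_mul; exact: (smoothB (smoothM uR vR) (smoothM uI vI)).
by under eq_fun do rewrite Im_mul; exact: (smoothD (smoothM uR vI) (smoothM uI vR)).
Qed.

Lemma smooth_c_cst (c : R[i]) : smooth_c (fun _ : vec => c).
Proof. by split; [exact: (smooth_cst (Re c))|exact: (smooth_cst (Im c))]. Qed.

Lemma smooth_cZ (c : R[i]) u : smooth_c u -> smooth_c (fun x => c * u x).
Proof. exact: (smooth_cM (smooth_c_cst c)). Qed.

Lemma smooth_c_shift u (w : vec) : smooth_c u -> smooth_c (fun x => u (x + w)).
Proof.
by move=> [uR uI]; split; [exact: (smooth_shift w uR)|exact: (smooth_shift w uI)].
Qed.

Lemma smooth_c_real (g : vec -> R) : smooth_r g -> smooth_c (fun x => (g x)%:C).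
Proof. move=> sg; split; [exact: sg|exact: (smooth_cst 0)]. Qed.

Lemma cpdnD al u v : smooth_c u -> smooth_c v ->
  cpdn al (fun x => u x + v x) = fun x => cpdn al u x + cpdn al v x.
Proof.
move=> [uR uI] [vR vI]; apply/funext => x; rewrite !cpdnE.
rewrite (_ : reparts _ = fun x => reparts u x + reparts v x); last first.
  by apply/funext => y; exact: Re_add.
rewrite (_ : imparts _ = fun x => imparts u x + imparts v x); last first.
  by apply/funext => y; exact: Im_add.
by rewrite (pdnD al uR vR) (pdnD al uI vI).
Qed.

Lemma cpdnZ al (c : R[i]) u : smooth_c u -> cpdn al (fun x => c * u x) = fun x => c * cpdn al u x.
Proof.
move=> [uR uI]; apply/funext => x; rewrite !cpdnE.
rewrite (_ : reparts _ = fun x => Re c * reparts u x + (- Im c) * imparts u x); last first.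
  by apply/funext => y; rewrite /reparts /imparts Re_mul mulNr.
rewrite [imparts (fun x => c * u x)](_ : _ = fun x => Re c * imparts u x + Im c * reparts u x); last first.
  by apply/funext => y; rewrite /reparts /imparts Im_mul.
rewrite (pdnD al (smoothZ _ uR) (smoothZ _ uI)) (pdnD al (smoothZ _ uI) (smoothZ _ uR)).
rewrite !(pdnZ _ _ uR) !(pdnZ _ _ uI); case: c => a b.
by apply/eqP; rewrite eq_complex /= mulNr !eqxx.
Qed.

Lemma cpdnB al u v : smooth_c u -> smooth_c v ->
  cpdn al (fun x => u x - v x) = fun x => cpdn al u x - cpdn al v x.
Proof.
move=> su sv; rewrite (_ : (fun x => u x - v x) = fun x => u x + (-1) * v x); last first.
  by apply/funext => x; rewrite mulN1r.
rewrite (cpdnD al su (smooth_cZ _ sv)) (cpdnZ al _ sv).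
by apply/funext => x; rewrite mulN1r.
Qed.

Lemma cpdn_shift al u (w : vec) : smooth_c u ->
  cpdn al (fun x => u (x + w)) = fun x => cpdn al u (x + w).
Proof.
move=> [uR uI]; apply/funext => x; rewrite !cpdnE.
rewrite (_ : reparts _ = fun x => reparts u (x + w))//.
by rewrite (_ : imparts _ = fun x => imparts u (x + w))// (pdn_shift w al uR) (pdn_shift w al uI).
Qed.

(** The factor 4 counts the products of real and imaginary parts, each estimated by [pdn_mul_le]. *)
Lemma cpdn_mul_le N u v (x : vec) (A B : R) : smooth_c u -> smooth_c v ->
  (forall be, (size be <= N)%N -> cabs (cpdn be u x) <= A) ->
  (forall be, (size be <= N)%N -> cabs (cpdn be v x) <= B) ->
  forall al, (size al <= N)%N -> cabs (cpdn al (fun x => u x * v x) x) <= 4 * 2 ^+ N * (A * B).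
Proof.
move=> [uR uI] [vR vI] uA vB al sN.
have uRA be : (size be <= N)%N -> `|pdn be (reparts u) x| <= A.
  by move=> /uA; apply: le_trans; rewrite cpdnE; exact: (Re_le_cabs (Complex _ _)).
have uIA be : (size be <= N)%N -> `|pdn be (imparts u) x| <= A.
  by move=> /uA; apply: le_trans; rewrite cpdnE; exact: (Im_le_cabs (Complex _ _)).
have vRB be : (size be <= N)%N -> `|pdn be (reparts v) x| <= B.
  by move=> /vB; apply: le_trans; rewrite cpdnE; exact: (Re_le_cabs (Complex _ _)).
have vIB be : (size be <= N)%N -> `|pdn be (imparts v) x| <= B.
  by move=> /vB; apply: le_trans; rewrite cpdnE; exact: (Im_le_cabs (Complex _ _)).
have A0 : 0 <= A by apply: le_trans (uA [::] _) => //; exact: cabs_ge0.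
have B0 : 0 <= B by apply: le_trans (vB [::] _) => //; exact: cabs_ge0.
have C2 : 2 ^+ size al * (A * B) <= 2 ^+ N * (A * B).
  by rewrite ler_wpM2r ?mulr_ge0// ler_weXn2l// ler1n.
have h1 := le_trans (pdn_mul_le uR vR uRA vRB sN) C2.
have h2 := le_trans (pdn_mul_le uI vI uIA vIB sN) C2.
have h3 := le_trans (pdn_mul_le uR vI uRA vIB sN) C2.
have h4 := le_trans (pdn_mul_le uI vR uIA vRB sN) C2.
rewrite cpdnE; apply: le_trans (cabs_le_ReIm _) _ => /=.
rewrite (_ : reparts _ = fun x => reparts u x * reparts v x + (-1) * (imparts u x * imparts v x)); last first.
  by apply/funext => y; rewrite /reparts Re_mul mulN1r.
rewrite [imparts (fun x => u x * v x)](_ : _ = fun x => reparts u x * imparts v x + imparts u x * reparts v x); last first.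
  by apply/funext => y; rewrite /imparts Im_mul.
rewrite (pdnD al (smoothM uR vR) (smoothZ _ (smoothM uI vI))) (pdnZ al _ (smoothM uI vI)).
rewrite (pdnD al (smoothM uR vI) (smoothM uI vR)).
have := ler_normD (pdn al (fun x => reparts u x * reparts v x) x) (-1 * pdn al (fun x => imparts u x * imparts v x) x).
have := ler_normD (pdn al (fun x => reparts u x * imparts v x) x) (pdn al (fun x => imparts u x * reparts v x) x).
rewrite normrM normrN1 mul1r -!mulrA; move: h1 h2 h3 h4.
rewrite /reparts /imparts; lra.
Qed.

(** [M] bounds the [N]-th Schwartz seminorm. A relation is used instead of a supremum, so that
    finiteness need not be carried along; the one index limits both the weight and the order of
    differentiation. *)
Definition snb N u (M : R) : Prop := forall x al, (size al <= N)%N ->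
  (1 + enorm x) ^+ N * cabs (cpdn al u x) <= M.

Lemma snb_ge0 N u M : snb N u M -> 0 <= M.
Proof.
move=> /(_ 0 [::] isT); apply: le_trans.
by rewrite mulr_ge0 ?cabs_ge0// exprn_ge0// ltW// enorm1_gt0.
Qed.

Lemma snb_le N N' u M M' : (N' <= N)%N -> M <= M' -> snb N u M -> snb N' u M'.
Proof.
move=> NN MM uM x al sN; apply: le_trans (le_trans (uM x al (leq_trans sN NN)) MM).
by rewrite ler_wpM2r ?cabs_ge0// ler_weXn2l// enorm1_ge1.
Qed.

Lemma snb_tempered N u M : snb N u M -> forall x k al, (k <= N)%N -> (size al <= N)%N ->
  (1 + enorm x) ^+ k * cabs (cpdn al u x) <= M.
Proof.
move=> uM x k al kN sN; apply: le_trans (uM x al sN).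
by rewrite ler_wpM2r ?cabs_ge0// ler_weXn2l// enorm1_ge1.
Qed.

(** [schwartz] bounds each derivative by its own constant. There are finitely many lists of
    directions of each length, so one constant serves all derivatives up to order [N]. *)
Lemma schwartzP u : schwartz u <-> smooth_c u /\ forall N, exists M, snb N u M.
Proof.
split=> -[su uS]; split=> //; last first.
  move=> k al; have [M uM] := uS (maxn k (size al)); exists M => x.
  by apply: (snb_tempered uM); [exact: leq_maxl|exact: leq_maxr].
move=> N; have [M MP] := choice (fun al => uS N al).
suff H m : exists M, forall x al, (size al <= m)%N ->
    (1 + enorm x) ^+ N * cabs (cpdn al u x) <= M by exact: H.
elim: m => [|m [M' M'P]].
  by exists (M [::]) => x al; rewrite leqn0 => /nilP ->; exact: MP.
exists (M' + \sum_(t : m.+1.-tuple 'I_n.+1) `|M t|) => x al.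
rewrite leq_eqVlt => /predU1P[sal|]; last first.
  by rewrite ltnS => /(M'P x) /le_trans; apply; rewrite lerDl sumr_ge0.
have M'0 : 0 <= M'.
  apply: le_trans (M'P 0 [::] isT).
  by rewrite mulr_ge0 ?cabs_ge0// exprn_ge0// ltW// enorm1_gt0.
have st : size al == m.+1 by apply/eqP.
rewrite (bigD1 (Tuple st))//=; apply: le_trans (MP al x) _.
rewrite addrCA (le_trans (ler_norm _))// lerDl addr_ge0// sumr_ge0//.
Qed.

Lemma schwartz_smooth u : schwartz u -> smooth_c u. Proof. by case. Qed.

Lemma schwartz_snb u N : schwartz u -> exists M, snb N u M.
Proof. by move=> /schwartzP[_]; exact. Qed.

Lemma snbD N u v M M' : smooth_c u -> smooth_c v -> snb N u M -> snb N v M' ->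
  snb N (fun x => u x + v x) (M + M').
Proof.
move=> su sv uM vM x al sN; rewrite cpdnD//.
apply: le_trans (lerD (uM x al sN) (vM x al sN)); rewrite -mulrDr ler_wpM2l ?cabsD//.
by rewrite exprn_ge0// ltW// enorm1_gt0.
Qed.

Lemma snbZ N (c : R[i]) u M : smooth_c u -> snb N u M -> snb N (fun x => c * u x) (cabs c * M).
Proof.
move=> su uM x al sN; rewrite cpdnZ// cabsM mulrCA ler_wpM2l ?cabs_ge0//; exact: uM.
Qed.

(** Growth of order [p] of one factor costs [p] additional weights on the other. The constant [e]
    stays explicit because the applications have it tend to 0, like the mesh of a Riemann sum or
    like [1 / r]. *)
Lemma snb_mul N p u v (e M : R) : smooth_c u -> smooth_c v ->
  (forall x be, (size be <= N)%N -> cabs (cpdn be u x) <= e * (1 + enorm x) ^+ p) ->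
  snb (N + p) v M -> snb N (fun x => u x * v x) (4 * 2 ^+ N * (e * M)).
Proof.
move=> su sv ue vM x al sN.
have e0 : 0 < 1 + enorm x by exact: enorm1_gt0.
have vB be : (size be <= N)%N -> cabs (cpdn be v x) <= M / (1 + enorm x) ^+ (N + p).
  move=> sb; rewrite ler_pdivlMr ?exprn_gt0// mulrC; apply: vM.
  exact: leq_trans sb (leq_addr _ _).
have := cpdn_mul_le su sv (ue x) vB sN; rewrite -(ler_pM2l (exprn_gt0 N e0)).
move/le_trans; apply; rewrite exprD; move: (gt_eqF (exprn_gt0 N e0)) (gt_eqF (exprn_gt0 p e0)).
move: (_ ^+ N) (_ ^+ p) => a b.
by rewrite le_eqVlt => a0 b0; apply/orP; left; apply/eqP; field; rewrite a0 b0.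
Qed.

Lemma snb_shift N u (w : vec) M : smooth_c u -> snb N u M ->
  snb N (fun x => u (x + w)) ((1 + enorm w) ^+ N * M).
Proof.
move=> su uM x al sN; rewrite cpdn_shift//.
apply: le_trans (ler_wpM2l _ (uM (x + w) al sN)); last by rewrite exprn_ge0// ltW// enorm1_gt0.
rewrite mulrA ler_wpM2r ?cabs_ge0// -exprMn lerXn2r ?nnegrE ?mulr_ge0//; try by rewrite ltW// enorm1_gt0.
by rewrite -{1}(addrK w x) (le_trans (enorm1D _ _))// enormN mulrC.
Qed.

Lemma snb_cpdn N be u M : snb (N + size be) u M -> snb N (cpdn be u) M.
Proof.
move=> uM x al sN; rewrite -cpdn_cat.
apply: (snb_tempered uM); first exact: leq_addr.
by rewrite size_cat leq_add2r.
Qed.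

End schwartz_seminorms.

(** * Schwartz functions, test functions and exponentials *)

Section schwartz_space.
Context {R : realType} {n : nat}.
Notation vec := 'rV[R]_n.+1.
Implicit Types (u v E : vec -> R[i]) (N k : nat) (al be : seq 'I_n.+1).

Lemma schwartzD u v : schwartz u -> schwartz v -> schwartz (fun x => u x + v x).
Proof.
move=> /schwartzP[su uS] /schwartzP[sv vS]; apply/schwartzP; split; first exact: smooth_cD.
by move=> N; have [M uM] := uS N; have [M' vM] := vS N; exists (M + M'); exact: snbD.
Qed.

Lemma schwartzZ (c : R[i]) u : schwartz u -> schwartz (fun x => c * u x).
Proof.
move=> /schwartzP[su uS]; apply/schwartzP; split; first exact: smooth_cZ.
by move=> N; have [M uM] := uS N; exists (cabs c * M); exact: snbZ.
Qed.

Lemma schwartz0 : schwartz (fun _ : vec => 0 : R[i]).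
Proof.
apply/schwartzP; split; first exact: (smooth_c_cst 0).
move=> N; exists 0 => x al _; rewrite cpdnE /reparts /imparts /= !pdn_cst.
by case: al; rewrite cabs0 mulr0.
Qed.

Lemma schwartz_sum (I : Type) (r : seq I) (F : I -> vec -> R[i]) :
  (forall i, schwartz (F i)) -> schwartz (fun x => \sum_(i <- r) F i x).
Proof.
move=> sF; elim: r => [|i r IHr].
  by under eq_fun do rewrite big_nil; exact: schwartz0.
by under eq_fun do rewrite big_cons; exact: (schwartzD (sF i) IHr).
Qed.

Lemma schwartz_shift u (w : vec) : schwartz u -> schwartz (fun x => u (x + w)).
Proof.
move=> /schwartzP[su uS]; apply/schwartzP; split; first exact: (smooth_c_shift w su).
by move=> N; have [M uM] := uS N; eexists; exact: (snb_shift w su uM).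
Qed.

Lemma schwartz_cpdn be u : schwartz u -> schwartz (cpdn be u).
Proof.
move=> /schwartzP[su uS]; apply/schwartzP; split; first exact: (smooth_c_cpdn be su).
by move=> N; have [M uM] := uS (N + size be)%N; exists M; exact: snb_cpdn.
Qed.

(** The multipliers of the Schwartz space; the degree of growth [p] may depend on the order [N]. *)
Definition moderate E := smooth_c E /\ forall N, exists e p,
  forall x be, (size be <= N)%N -> cabs (cpdn be E x) <= e * (1 + enorm x) ^+ p.

Lemma schwartz_mul E u : moderate E -> schwartz u -> schwartz (fun x => E x * u x).
Proof.
move=> [sE mE] /schwartzP[su uS]; apply/schwartzP; split; first exact: (smooth_cM sE su).
move=> N; have [e [p Ee]] := mE N; have [M uM] := uS (N + p)%N.
by eexists; exact: (snb_mul sE su Ee uM).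
Qed.

Lemma schwartz_moderate u : schwartz u -> moderate u.
Proof.
move=> /schwartzP[su uS]; split=> // N; have [M uM] := uS N; exists M, 0%N => x be sb.
rewrite expr0 mulr1; have := snb_tempered uM x (leq0n N) sb.
by rewrite expr0 mul1r.
Qed.

Definition ccoord (j : 'I_n.+1) : vec -> R[i] := fun x => (x ord0 j)%:C.

Lemma smooth_ccoord j : smooth_c (ccoord j).
Proof. exact: (smooth_c_real (smooth_coord j)). Qed.

Lemma ccoord_le j x be : cabs (cpdn be (ccoord j) x) <= 1 * (1 + enorm x) ^+ 1.
Proof.
rewrite mul1r expr1 cpdnE.
rewrite (_ : reparts _ = fun x => x ord0 j)// (_ : imparts _ = fun=> 0)// pdn_cst.
rewrite [X in Complex _ X](_ : _ = 0); last by case: be.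
rewrite (_ : Complex _ _ = (pdn be (fun x => x ord0 j) x)%:C)// cabs_real.
case/lastP: be => [|be i]; first by have := coord_le_enorm x j; rewrite /=; lra.
rewrite pdn_rcons pd_coord pdn_cst; have := enorm1_ge1 x.
apply: le_trans; case: be => [|? ?]; rewrite ?normr0 ?ler01//.
by case: (i == j); rewrite ?normr1 ?normr0 ?ler01 ?lexx.
Qed.

Lemma snb_ccoord N j u M : smooth_c u -> snb N.+1 u M ->
  snb N (fun x => ccoord j x * u x) (4 * 2 ^+ N * M).
Proof.
move=> su uM; have := snb_mul (smooth_ccoord j) su (fun x be _ => @ccoord_le j x be) (p := 1%N) (N := N).
by rewrite addn1 => /(_ _ uM); rewrite mul1r.
Qed.

Lemma moderate_ccoord j : moderate (ccoord j).
Proof.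
by split=> [|N]; [exact: smooth_ccoord|exists 1, 1%N => x be _; exact: ccoord_le].
Qed.

Lemma schwartz_ccoord j u : schwartz u -> schwartz (fun x => ccoord j x * u x).
Proof. by move=> Su; exact: (schwartz_mul (moderate_ccoord j) Su). Qed.

Lemma snb_weight u M : snb (2 * n.+1) u M -> forall x, cabs (u x) <= M * weight x.
Proof.
move=> uM x; have := uM x [::] isT; rewrite cpdn_nil mulrC.
by rewrite /weight -ler_pdivlMr// exprn_gt0// enorm1_gt0.
Qed.

Lemma snb_cintg u M : smooth_c u -> snb (2 * n.+1) u M -> cintg u.
Proof.
move=> su /snb_weight uM; apply: cintg_le uM _; last exact: (rintgZ _ rintg_weight).
exact: (ccont_cmeas (smooth_ccont su)).
Qed.

Lemma schwartz_cintg u : schwartz u -> cintg u.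
Proof.
by move=> Su; have [M uM] := schwartz_snb (2 * n.+1) Su; exact: (snb_cintg (schwartz_smooth Su) uM).
Qed.

(** The exterior of a closed ball is open, so every derivative vanishes where the function does. *)
Lemma test_support u : test_fun u -> exists2 r : R, 0 < r &
  forall x al, r < enorm x -> cpdn al u x = 0.
Proof.
move=> [[uR uI] [r ur]]; exists (Num.max r 1); first by rewrite lt_max ltr01 orbT.
move=> x al rx; have {rx} rx : r < enorm x by apply: le_lt_trans rx; rewrite le_max lexx.
have H (g : vec -> R) : (forall x, r < enorm x -> g x = 0) ->
    forall x, r < enorm x -> pdn al g x = 0.
  move=> g0; elim: al => [//|i al IHal] y ry /=.
  have nz : \near y, cst 0 y = pdn al g y.
    have oU : open [set z : vec | r < enorm z].
      rewrite (_ : [set z | _] = (fun z => enorm z) @^-1` `]r, +oo[).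
        by apply: open_comp => [z _|]; [exact: continuous_enorm|exact: interval_open].
      by apply/seteqP; split => z /=; rewrite in_itv/= andbT.
    have : nbhs y [set z : vec | r < enorm z] by exact: open_nbhs_nbhs.
    by apply: filterS => z rz; rewrite IHal.
  have [_ H] := near_eq_is_derive nz (is_derive_cst (0 : R) y 'e_i); exact: H.
by rewrite cpdnE !H// => y /ur; rewrite /reparts /imparts => ->.
Qed.

Lemma continuous_bounded_eball (g : vec -> R) (r : R) : continuous g ->
  exists M, forall x, enorm x <= r -> `|g x| <= M.
Proof.
move=> cg; pose K : set vec := [set v | forall i, `[- r, r]%classic (v ord0 i)].
have cK : compact K.
  by apply: (rV_compact (A := fun=> `[- r, r]%classic)) => i; exact: segment_compact.
have : compact (g @` K).
  by apply: continuous_compact => //; exact: continuous_subspaceT.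
move=> /compact_bounded[M [_ MP]]; exists (M + 1) => x xr; apply: MP; first by rewrite ltrDl.
exists x => // i /=; rewrite in_itv/= -ler_norml.
exact: le_trans (coord_le_enorm x i) xr.
Qed.

Lemma test_schwartz u : test_fun u -> schwartz u.
Proof.
move=> tu; have su := tu.1; split=> // k al; have [r r0 ur] := test_support tu.
have sal := smooth_c_cpdn al su; have [cR cI] := smooth_ccont sal.
have [M1 HM1] := continuous_bounded_eball r cR.
have [M2 HM2] := continuous_bounded_eball r cI.
have M120 : 0 <= M1 + M2.
  have := le_trans (normr_ge0 _) (HM1 0 _); have := le_trans (normr_ge0 _) (HM2 0 _).
  by rewrite enorm0 => /(_ (ltW r0)) ? /(_ (ltW r0)) ?; exact: addr_ge0.
exists ((1 + r) ^+ k * (M1 + M2)) => x; have [xr|xr] := leP (enorm x) r; last first.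
  by rewrite ur// cabs0 mulr0 mulr_ge0// exprn_ge0// addr_ge0// ltW.
apply: ler_pM; rewrite ?cabs_ge0 ?exprn_ge0 ?(ltW (enorm1_gt0 x))//.
  by rewrite lerXn2r ?nnegrE ?addr_ge0 ?enorm_ge0 ?(ltW r0)// lerD2l.
by apply: le_trans (cabs_le_ReIm _) _; apply: lerD; [exact: HM1|exact: HM2].
Qed.

Lemma test_funM u v : smooth_c u -> test_fun v -> test_fun (fun x => u x * v x).
Proof.
by move=> su [sv [r vr]]; split; [exact: (smooth_cM su sv)|exists r => x /vr ->; rewrite mulr0].
Qed.

Definition ep (y : vec) : vec -> R[i] := fun xi => expi (dotp xi y).

Lemma reparts_ep y : reparts (ep y) = fun xi => cos (dotp xi y).
Proof. by apply/funext => x; rewrite /reparts /ep /expi rect_complexE. Qed.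
Lemma imparts_ep y : imparts (ep y) = fun xi => sin (dotp xi y).
Proof. by apply/funext => x; rewrite /imparts /ep /expi rect_complexE. Qed.

Lemma smooth_ep y : smooth_c (ep y).
Proof.
rewrite /smooth_c -/(reparts _) -/(imparts _) reparts_ep imparts_ep.
by split; apply: smooth_comp (smooth_dotp y) => k; have [] := @C1_cos_sin R k.
Qed.

Lemma is_derive_dotp (y x : vec) i : is_derive x 'e_i (fun z : vec => dotp z y) (y ord0 i).
Proof.
have := smooth_is_derive i x (smooth_dotp y); rewrite (_ : pd i _ x = y ord0 i)//.
have cv : (fun h : R => h^-1 *: (((fun z : vec => dotp z y) \o shift x) (h *: 'e_i) - dotp x y)) @ 0^'
    --> (y ord0 i : R).
  apply: (cvg_trans (near_eq_cvg _)); last exact: (cvg_cst (y ord0 i : R)).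
  near=> h; rewrite /= dotpDl addrK dotpZl dotpC dotp_delta /GRing.scale /= mulrA mulVf ?mul1r//.
  by near: h; exact: nbhs_dnbhs_neq.
exact: (cvg_lim _ cv).
Unshelve. all: by end_near. Qed.

Lemma cpdn_ep al y xi : cpdn al (ep y) xi = (\prod_(i <- al) ('i%R * (y ord0 i)%:C)) * ep y xi.
Proof.
elim/last_ind: al xi => [|al i IHal] xi; first by rewrite cpdn_nil big_nil mul1r.
have E : cpdn [:: i] (ep y) = fun xi => ('i%R * (y ord0 i)%:C) * ep y xi.
  apply/funext => z; rewrite cpdnE reparts_ep imparts_ep /=.
  have dd := is_derive_dotp y z i.
  have [_ H1] := is_derive_comp1 (g := fun z => dotp z y) (is_derive_cos (dotp z y)) dd.
  have [_ H2] := is_derive_comp1 (g := fun z => dotp z y) (is_derive_sin (dotp z y)) dd.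
  rewrite /pd H1 H2 /ep /expi rect_complexE iE; apply/eqP; rewrite eq_complex /=.
  by apply/andP; split; apply/eqP; ring.
rewrite -cats1 cpdn_cat E (cpdnZ al _ (smooth_ep y)) IHal.
by rewrite big_cat big_seq1 /=; ring.
Qed.

Lemma cabs_prod_i al y (L : R) : enorm y <= L ->
  cabs (\prod_(i <- al) ('i%R * (y ord0 i)%:C)) <= (1 + L) ^+ size al.
Proof.
move=> yL; have L0 := le_trans (enorm_ge0 y) yL.
elim: al => [|i al IHal]; first by rewrite big_nil cabs1 expr0.
rewrite big_cons /= exprS cabsM; apply: ler_pM; rewrite ?cabs_ge0//.
rewrite cabsM cabs_real iE /cabs /= expr0n expr1n add0r sqrtr1 mul1r.
by have := coord_le_enorm y i; lra.
Qed.

Lemma cabs_ep y xi : cabs (ep y xi) = 1. Proof. exact: cabs_expi. Qed.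

Lemma cpdn_ep_le N al y xi (L : R) : enorm y <= L -> (size al <= N)%N ->
  cabs (cpdn al (ep y) xi) <= (1 + L) ^+ N.
Proof.
move=> yL sN; rewrite cpdn_ep cabsM cabs_ep mulr1 (le_trans (cabs_prod_i al yL))//.
by rewrite ler_weXn2l// lerDl (le_trans (enorm_ge0 y) yL).
Qed.

(** Exponentials depend on their frequency in a Lipschitz way, seminorm by seminorm, at the price of
    one power of [1 + enorm xi]. In [N + 2], the [N] comes from telescoping the at most [N] factors
    produced by differentiation and the 2 from [expi_lip]. *)
Lemma cpdn_ep_dist N al y z xi (L : R) : enorm y <= L -> enorm z <= L -> (size al <= N)%N ->
  cabs (cpdn al (ep y) xi - cpdn al (ep z) xi) <=
  (1 + L) ^+ N * N.+2%:R * enorm (y - z) * (1 + enorm xi).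
Proof.
move=> yL zL sN; rewrite !cpdn_ep; have L0 := le_trans (enorm_ge0 y) yL.
have L1 : 1 <= 1 + L by rewrite lerDl.
have h0 : cabs (ep y xi - ep z xi) <= 2 * (enorm (y - z) * enorm xi).
  apply: le_trans (expi_lip _ _) _; rewrite ler_wpM2l// -dotpNr -dotpDr mulrC.
  exact: cauchy_schwarz.
have H : cabs (\prod_(i <- al) ('i%R * (y ord0 i)%:C) - \prod_(i <- al) ('i%R * (z ord0 i)%:C)) <=
    (1 + L) ^+ size al * (size al)%:R * enorm (y - z).
  elim: al {sN} => [|i al IHal]; first by rewrite !big_nil subrr cabs0 mulr0 mul0r.
  rewrite !big_cons /=.
  set P := \prod_(j <- al) _; set Q := \prod_(j <- al) _.
  rewrite (_ : _ - _ = 'i%R * (y ord0 i - z ord0 i)%:C * P + 'i%R * (z ord0 i)%:C * (P - Q)); last first.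
    by rewrite rmorphB /=; ring.
  have ci : cabs 'i%R = 1 :> R by rewrite iE /cabs /= expr0n expr1n add0r sqrtr1.
  apply: le_trans (cabsD _ _) _; rewrite !cabsM ci !mul1r !cabs_real.
  have hP : cabs P <= (1 + L) ^+ size al by exact: cabs_prod_i.
  have hP' : (1 + L) ^+ size al <= (1 + L) ^+ (size al).+1 by rewrite ler_weXn2l.
  have hy : `|y ord0 i - z ord0 i| <= enorm (y - z).
    by have := coord_le_enorm (y - z) i; rewrite !mxE.
  have hz : `|z ord0 i| <= 1 + L by have := coord_le_enorm z i; lra.
  rewrite (_ : (1 + L) ^+ _ * _ * _ = enorm (y - z) * (1 + L) ^+ (size al).+1 +
      (1 + L) * ((1 + L) ^+ size al * (size al)%:R * enorm (y - z))); last first.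
    by rewrite exprS mulrS; ring.
  by apply: lerD; apply: ler_pM; rewrite ?cabs_ge0//; exact: le_trans hP hP'.
set P := \prod_(j <- al) _ in H *; set Q := \prod_(j <- al) _ in H *.
rewrite (_ : _ - _ = (P - Q) * ep y xi + Q * (ep y xi - ep z xi)); last by ring.
apply: le_trans (cabsD _ _) _; rewrite !cabsM cabs_ep mulr1.
have LN : (1 + L) ^+ size al <= (1 + L) ^+ N by rewrite ler_weXn2l.
have LN0 : 0 <= (1 + L) ^+ N by rewrite exprn_ge0//; lra.
have d0 := enorm_ge0 (y - z); have x0 := enorm_ge0 xi.
have h1 : cabs (P - Q) <= (1 + L) ^+ N * N%:R * enorm (y - z).
  apply: le_trans H _; rewrite ler_wpM2r//; apply: ler_pM; rewrite ?exprn_ge0 ?ler_nat//; lra.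
have h2 : cabs Q * cabs (ep y xi - ep z xi) <= (1 + L) ^+ N * (2 * (enorm (y - z) * enorm xi)).
  by apply: ler_pM; rewrite ?cabs_ge0// (le_trans (cabs_prod_i al zL)).
apply: le_trans (lerD h1 h2) _.
rewrite (_ : N.+2%:R = N%:R + 2); last by rewrite -addn2 natrD.
move: (_ ^+ N) (enorm _) (enorm xi) LN0 d0 x0 => A D X A0 D0 X0.
have : 0 <= A * D * X * N%:R by rewrite !mulr_ge0.
have : 0 <= A * D by rewrite mulr_ge0.
lra.
Qed.

Lemma moderate_ep y : moderate (ep y).
Proof.
split; first exact: smooth_ep.
by move=> N; exists ((1 + enorm y) ^+ N), 0%N => x be sb; rewrite expr0 mulr1; exact: cpdn_ep_le.
Qed.

End schwartz_space.

(** * The Fourier transform *)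

Section smooth_estimates.
Context {R : realType} {n : nat}.
Notation vec := 'rV[R]_n.+1.
Implicit Types (g : vec -> R) (i j : 'I_n.+1).

Lemma lipschitz_continuous g (K : R) :
  (forall x y, `|g x - g y| <= K * enorm (x - y)) -> continuous g.
Proof.
move=> gK x.
have c1 : continuous (fun y : vec => K * enorm (y + (- x))).
  by apply: ctsM; [exact: cts_cst|exact: cts_shift (@continuous_enorm R n)].
have c0 := c1 x; rewrite /continuous_at subrr enorm0 mulr0 in c0.
have [c2 _] := @cvgrPdist_lt R R vec (nbhs x) (nbhs_filter x) (fun y : vec => K * enorm (y + (- x))) 0.
have [_ c3] := @cvgrPdist_lt R R vec (nbhs x) (nbhs_filter x) g (g x).
apply: c3 => e e0; apply: (@filterS _ _ (nbhs_filter x) _ _ _ (c2 c0 e e0)) => y.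
by rewrite sub0r normrN -enorm_distC; apply: le_lt_trans; apply: le_trans (gK x y) _; exact: ler_norm.
Qed.

(** With this, derivatives of integrals are found from a Taylor estimate of the integrand, without
    differentiating under the integral sign. *)
Lemma quadratic_is_derive g (x v : vec) (c K : R) :
  (forall t : R, `|g (t *: v + x) - g x - t * c| <= K * t ^+ 2) -> is_derive x v g c.
Proof.
move=> gK.
have cv : (fun h : R => h^-1 *: ((g \o shift x) (h *: v) - g x)) @ 0^' --> (c : R).
  apply/cvgrPdist_lt => e e0; near=> h.
  have h0 : h != 0 by near: h; exact: nbhs_dnbhs_neq.
  have K0 : 0 <= `|K| + 1 by rewrite addr_ge0.
  rewrite distrC /= /GRing.scale /=.
  rewrite (_ : _ - c = h^-1 * (g (h *: v + x) - g x - h * c)); last by field.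
  rewrite normrM normfV ltr_pdivrMl ?normr_gt0//; apply: le_lt_trans (gK h) _.
  rewrite -(real_normK (num_real h)) expr2 mulrA mulrC ltr_pM2l ?normr_gt0//.
  apply: (@le_lt_trans _ _ ((`|K| + 1) * `|h|)).
    by rewrite ler_wpM2r// (le_trans (ler_norm K))// lerDl.
  rewrite mulrC -ltr_pdivlMr ?ltr_wpDl//; near: h.
  by apply: dnbhs0_lt; rewrite divr_gt0// ltr_wpDl.
by apply: DeriveDef; [exact: cvgP cv|exact: cvg_lim cv].
Unshelve. all: by end_near. Qed.

Lemma is_derive_line g j (x : vec) (t : R) : smooth_r g ->
  is_derive t 1 (fun s : R => g (s *: 'e_j + x)) (pd j g (t *: 'e_j + x)).
Proof.
move=> sg; have [h1 h2] := smooth_is_derive j (t *: 'e_j + x) sg.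
have E : (fun s : R => s^-1 *: (((fun s : R => g (s *: 'e_j + x)) \o shift t) (s *: 1) - g (t *: 'e_j + x))) =
    (fun s : R => s^-1 *: ((g \o shift (t *: 'e_j + x)) (s *: 'e_j) - g (t *: 'e_j + x))).
  by apply/funext => s; rewrite /= [s *: 1]mulr1 scalerDl addrA.
by apply: DeriveDef; move: h1 h2; rewrite /derivable /derive E.
Qed.

Lemma enorm_scale_delta (t : R) j : enorm (t *: 'e_j : vec) = `|t|.
Proof. by rewrite /enorm dotpZl dotpZr dotp_delta mxE !eqxx /= mulr1 -expr2 sqrtr_sqr. Qed.

Lemma taylor2 g j (x : vec) (t M : R) : smooth_r g ->
  (forall s : R, `|s| <= `|t| -> `|pd j (pd j g) (s *: 'e_j + x)| <= M) ->
  `|g (t *: 'e_j + x) - g x - t * pd j g x| <= M * t ^+ 2.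
Proof.
move=> sg gM; have sg' := smooth_pd j sg.
have [c [ct E1]] := mean_value 0 t (fun s => is_derive_line j x s sg).
have [d [dc E2]] := mean_value 0 c (fun s => is_derive_line j x s sg').
move: E1 E2 ct dc; rewrite scale0r add0r !subr0 => E1 E2 ct dc.
rewrite E1 (_ : _ - _ = (pd j g (c *: 'e_j + x) - pd j g x) * t); last by ring.
rewrite E2 !normrM -mulrA -(real_normK (num_real t)) expr2.
by apply: ler_pM => //; [exact: gM (le_trans dc ct)|rewrite ler_wpM2r].
Qed.

Lemma bounded_pd_lipschitz g (K : R) : smooth_r g ->
  (forall i x, `|pd i g x| <= K) ->
  forall x y, `|g x - g y| <= K * \sum_i `|x ord0 i - y ord0 i|.
Proof.
move=> sg gK x y.
(* [z k] has the first [k] coordinates of [x] and the others of [y]; consecutive points differ along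
   one axis, where the mean value theorem applies. *)
pose z k : vec := \row_j if (j < k)%N then x ord0 j else y ord0 j.
have z0 : z 0%N = y by apply/rowP => j; rewrite mxE.
have zn : z n.+1 = x by apply/rowP => j; rewrite mxE ltn_ord.
have step (k : 'I_n.+1) : `|g (z k.+1) - g (z k)| <= K * `|x ord0 k - y ord0 k|.
  have -> : z k.+1 = (x ord0 k - y ord0 k) *: 'e_k + z k.
    apply/rowP => j; rewrite !mxE eqxx /= ltnS leq_eqVlt (inj_eq val_inj).
    by case: eqVneq => [->|jk]; rewrite ?ltnn /= ?mulr1 ?subrK// mulr0 add0r.
  have [c [_ E]] := mean_value 0 (x ord0 k - y ord0 k) (fun s => is_derive_line k (z k) s sg).
  move: E; rewrite scale0r add0r subr0 => ->.
  by rewrite normrM ler_wpM2r.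
rewrite -z0 -zn -(telescope_sumr (fun k => g (z k)) (leq0n n.+1)) big_mkord.
apply: le_trans (ler_norm_sum _ _ _) _; rewrite mulr_sumr.
by apply: ler_sum => k _; rewrite z0 zn; exact: step.
Qed.

Lemma pd0_const g : smooth_r g -> (forall i x, pd i g x = 0) -> forall x y, g x = g y.
Proof.
move=> sg g0 x y; apply/eqP; rewrite -subr_eq0 -normr_le0.
apply: le_trans (bounded_pd_lipschitz (K := 0) sg _ x y) _; last by rewrite mul0r.
by move=> i z; rewrite g0 normr0.
Qed.

(* Since [g] and its translates have the same integral, Taylor's formula gives [t * rint (pd j g) = O(t^2)]. *)
Lemma integral_pd0 g (M : R) j : smooth_r g -> rintg g -> rintg (pd j g) ->
  (forall x, `|pd j (pd j g) x| <= M * weight x) -> rint (pd j g) = 0.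
Proof.
move=> sg ig ig' gM.
have M0 : 0 <= M.
  by have := le_trans (normr_ge0 _) (gM 0); rewrite pmulr_lge0// weight_gt0.
set N := (2 * n.+1)%N in gM *; pose K := M * 2 ^+ (2 * n.+1) * rint (@weight R n).
have K0 : 0 <= K.
  by rewrite !mulr_ge0// ?exprn_ge0// rint_ge0// => x; exact: ltW (weight_gt0 x).
have H (t : R) : 0 < t -> t <= 1 -> `|rint (pd j g)| <= K * t.
  move=> t0 t1; pose r x := g (x + t *: 'e_j) - g x - t * pd j g x.
  have igt : rintg (fun x => g (x + t *: 'e_j)) by exact: rintg_translation.
  have ir : rintg (fun x => g (x + t *: 'e_j) + (-1) * g x + (- t) * pd j g x).
    by apply: rintgD; [apply: rintgD => //; exact: rintgZ|exact: rintgZ].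
  have rr : rint (fun x => g (x + t *: 'e_j) + (-1) * g x + (- t) * pd j g x) = - t * rint (pd j g).
    rewrite rintD ?rintD ?rintZ//; [|exact: rintgZ|by apply: rintgD => //; exact: rintgZ|exact: rintgZ].
    by rewrite (rint_translation _ (rintg_meas ig)) mulN1r subrr add0r.
  (* A displacement by at most 1 changes the weight by a factor of at most [2 ^+ N]; hence the
     restriction [t <= 1]. *)
  have rle x : `|g (x + t *: 'e_j) + (-1) * g x + (- t) * pd j g x| <= M * 2 ^+ N * t ^+ 2 * weight x.
    rewrite mulN1r mulNr [x + _]addrC mulrAC.
    apply: taylor2 => // s st; apply: le_trans (gM _) _; rewrite -mulrA ler_wpM2l//.
    rewrite /weight -/N ler_pdivlMr ?exprn_gt0 ?enorm1_gt0// mulrC ler_pdivrMr ?exprn_gt0 ?enorm1_gt0//.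
    rewrite -exprMn lerXn2r ?nnegrE ?mulr_ge0 ?(ltW (enorm1_gt0 _))//.
    have -> : x = (s *: 'e_j + x) + (- s) *: 'e_j by rewrite scaleNr addrC addKr.
    apply: le_trans (enorm1D _ _) _; rewrite enorm_scale_delta normrN.
    rewrite scaleNr addrAC subrr add0r mulrC ler_wpM2r ?(ltW (enorm1_gt0 _))//.
    by move: st; rewrite (gtr0_norm t0); lra.
  have : `|- t * rint (pd j g)| <= K * t ^+ 2.
    rewrite -rr; apply: le_trans (le_normr_Rintegral measurableT ir) _.
    apply: le_trans (le_rint (rintg_norm ir) (rintgZ _ rintg_weight) rle) _.
    by rewrite rintZ ?/K; [rewrite le_eqVlt; apply/orP; left; apply/eqP; ring|exact: rintg_weight].
  by rewrite normrM normrN (gtr0_norm t0) expr2 mulrA [leRHS]mulrC ler_pM2l.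
apply/eqP; rewrite -normr_le0; apply/ler_addgt0Pr => e e0; rewrite add0r.
pose t := Num.min 1 (e / (K + 1)).
have K1 : 0 < K + 1 by rewrite ltr_wpDl.
have t0 : 0 < t by rewrite lt_min ltr01 divr_gt0.
have t1 : t <= 1 by rewrite ge_min lexx.
apply: le_trans (H t t0 t1) _; apply: (@le_trans _ _ ((K + 1) * t)).
  by rewrite ler_wpM2r ?lerDl// ltW.
by rewrite mulrC -ler_pdivlMr// ge_min lexx orbT.
Qed.

Lemma schwartz_cint_cpd0 (w : vec -> R[i]) j : schwartz w -> cint (cpdn [:: j] w) = 0.
Proof.
move=> Sw; have [sR sI] := schwartz_smooth Sw.
have [iR iI] := schwartz_cintg Sw.
have [] := schwartz_cintg (schwartz_cpdn [:: j] Sw).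
rewrite -/(reparts _) -/(imparts _) reparts_cpdn imparts_cpdn => dR dI.
have [M wM] := schwartz_snb (2 * n.+1) (schwartz_cpdn [:: j; j] Sw).
have wM' := snb_weight wM.
rewrite cintE -/(reparts _) -/(imparts _) reparts_cpdn imparts_cpdn.
rewrite (integral_pd0 (M := M) sR iR dR); last first.
  by move=> x; apply: le_trans (wM' x); rewrite cpdnE; exact: (Re_le_cabs (Complex _ _)).
rewrite (integral_pd0 (M := M) sI iI dI)//.
by move=> x; apply: le_trans (wM' x); rewrite cpdnE; exact: (Im_le_cabs (Complex _ _)).
Qed.

End smooth_estimates.

(** * The Fourier transform on the Schwartz space *)

Section fourier_transform.
Context {R : realType} {n : nat}.
Notation vec := 'rV[R]_n.+1.
Notation Re := complex.Re.
Notation Im := complex.Im.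
Implicit Types (u v : vec -> R[i]) (s : R) (j : 'I_n.+1).

(** [ft (-1)] is the Fourier transform and [ft 1] the inverse one without the factor [(2 pi)^-n];
    the parameter with [|s| = 1] treats both at once. *)
Definition ft s u : vec -> R[i] := fun xi => cint (fun x => u x * expi (s * dotp x xi)).

Lemma fourier_ft u : fourier u = ft (-1) u.
Proof. by apply/funext => xi; congr (cint _); apply/funext => x; rewrite mulN1r. Qed.

Lemma ifourier_ft u : ifourier u = fun xi => ((2 * pi) ^- n.+1)%:C * ft 1 u xi.
Proof.
by apply/funext => xi; congr (_ * cint _); apply/funext => x; rewrite mul1r dotpC.
Qed.

Lemma epE s (xi x : vec) : expi (s * dotp x xi) = ep (s *: xi) x.
Proof. by rewrite /ep dotpZr. Qed.

Lemma cintg_ep s u xi : cintg u -> cintg (fun x => u x * expi (s * dotp x xi)).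
Proof.
move=> iu; apply: (@cintg_le _ _ _ (fun x => cabs (u x))).
- apply: cmeasM; first exact: cintg_cmeas.
  by under eq_fun do rewrite epE; exact: ccont_cmeas (smooth_ccont (smooth_ep _)).
- by move=> x; rewrite cabsM cabs_expi mulr1.
- exact: cintg_cabs.
Qed.

Lemma ftZ s (c : R[i]) u : cintg u -> ft s (fun x => c * u x) = fun xi => c * ft s u xi.
Proof.
move=> iu; apply/funext => xi; rewrite /ft -cintZ; last exact: cintg_ep.
by congr cint; apply/funext => x; rewrite mulrA.
Qed.

Lemma ftD s u v : cintg u -> cintg v -> ft s (fun x => u x + v x) = fun xi => ft s u xi + ft s v xi.
Proof.
move=> iu iv; apply/funext => xi; rewrite /ft -cintD; [|exact: cintg_ep..].
by congr cint; apply/funext => x; rewrite mulrDl.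
Qed.

Lemma snb_weightX (p : nat) u (M : R) : snb (2 * n.+1 + p) u M ->
  forall x, cabs (u x) * (1 + enorm x) ^+ p <= M * weight x.
Proof.
move=> uM x; have := uM x [::] isT; rewrite cpdn_nil exprD => H.
by rewrite /weight ler_pdivlMr ?exprn_gt0 ?enorm1_gt0// mulrC [cabs _ * _]mulrC mulrA.
Qed.

Lemma ft_le s u (M : R) xi : smooth_c u -> snb (2 * n.+1) u M ->
  cabs (ft s u xi) <= M * rint (@weight R n).
Proof.
move=> su uM; rewrite -rintZ; last exact: rintg_weight.
apply: cabs_cint_le; first exact: cintg_cmeas (cintg_ep _ _ (snb_cintg su uM)).
  by move=> x; rewrite cabsM cabs_expi mulr1; exact: snb_weight.
exact/rintgZ/rintg_weight.
Qed.

Lemma ft_lip s u (M : R) xi eta : `|s| = 1 -> smooth_c u -> snb (2 * n.+1 + 1) u M ->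
  cabs (ft s u xi - ft s u eta) <= 2 * M * rint (@weight R n) * enorm (xi - eta).
Proof.
move=> s1 su uM.
have iu : cintg u by apply: (snb_cintg (M := M) su); apply: snb_le uM => //; rewrite leq_addr.
have ix z := cintg_ep s z iu.
rewrite /ft -cintB// mulrAC -rintZ; last exact: rintg_weight.
apply: cabs_cint_le; first exact/cintg_cmeas/cintgB.
  move=> x; rewrite -mulrBr cabsM.
  have H1 := expi_lip (s * dotp x xi) (s * dotp x eta).
  have H2 : `|s * dotp x xi - s * dotp x eta| <= (1 + enorm x) * enorm (xi - eta).
    rewrite -mulrBr normrM s1 mul1r -dotpNr -dotpDr; apply: le_trans (cauchy_schwarz _ _) _.
    by rewrite ler_wpM2r ?enorm_ge0// lerDr.
  have H3 := snb_weightX uM x; rewrite expr1 in H3.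
  apply: le_trans (ler_wpM2l (cabs_ge0 _) H1) _.
  apply: (@le_trans _ _ (2 * enorm (xi - eta) * (cabs (u x) * (1 + enorm x)))).
    rewrite (_ : 2 * enorm (xi - eta) * _ = cabs (u x) * (2 * ((1 + enorm x) * enorm (xi - eta)))); last by ring.
    by rewrite ler_wpM2l ?cabs_ge0// ler_wpM2l.
  rewrite (_ : 2 * M * _ * _ = 2 * enorm (xi - eta) * (M * weight x)); last by ring.
  by rewrite ler_wpM2l// mulr_ge0 ?enorm_ge0.
exact/rintgZ/rintg_weight.
Qed.

(** The factor [i s x_j] is what differentiating the kernel in direction [j] brings down; see
    [cpd_ft]. *)
Definition icoord s j u : vec -> R[i] := fun x => ('i%R * s%:C) * (ccoord j x * u x).

Lemma schwartz_icoord s j u : schwartz u -> schwartz (icoord s j u).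
Proof. by move=> Su; apply: schwartzZ; exact: schwartz_ccoord. Qed.

Lemma snb_icoord N s j u M : `|s| = 1 -> smooth_c u -> snb N.+1 u M ->
  snb N (icoord s j u) (4 * 2 ^+ N * M).
Proof.
move=> s1 su uM; have H := snb_ccoord j su uM.
have i1 : cabs ('i%R * s%:C : R[i]) = 1.
  by rewrite cabsM cabs_real s1 mulr1 iE /cabs /= expr0n expr1n add0r sqrtr1.
by have := snbZ ('i%R * s%:C) (smooth_cM (smooth_ccoord j) su) H; rewrite i1 mul1r.
Qed.

Lemma ft_taylor s u (M : R) xi j (t : R) : `|s| = 1 -> schwartz u -> snb (2 * n.+1 + 2) u M ->
  cabs (ft s u (t *: 'e_j + xi) - ft s u xi - t%:C * ft s (icoord s j u) xi) <=
  2 * M * rint (@weight R n) * t ^+ 2.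
Proof.
move=> s1 Su uM; have iu := schwartz_cintg Su.
have ix z := cintg_ep s z iu; have ij := cintg_ep s xi (schwartz_cintg (schwartz_icoord s j Su)).
rewrite /ft -cintB// -cintZ// -cintB//; [|exact: cintgB|exact: cintgZ].
rewrite mulrAC -rintZ; last exact: rintg_weight.
apply: cabs_cint_le; [by apply/cintg_cmeas/cintgB; [exact: cintgB|exact: cintgZ]| |exact/rintgZ/rintg_weight].
move=> x; rewrite dotpDr dotpZr dotp_delta [s * (_ + _)]mulrDr expiD /icoord /ccoord.
set a := s * (t * x ord0 j); set e := expi (s * dotp x xi).
rewrite (_ : _ - _ = u x * e * (expi a - 1 - 'i%R * a%:C)); last first.
  by rewrite /a !rmorphM /=; ring.
rewrite 2!cabsM cabs_expi mulr1; apply: le_trans (ler_wpM2l (cabs_ge0 _) (expi_taylor a)) _.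
have H3 := snb_weightX uM x.
have H2 : a ^+ 2 <= t ^+ 2 * (1 + enorm x) ^+ 2.
  rewrite /a !exprMn -(real_normK (num_real s)) s1 expr1n mul1r ler_wpM2l ?sqr_ge0//.
  rewrite -(real_normK (num_real (x ord0 j))) lerXn2r ?nnegrE ?(ltW (enorm1_gt0 _))//.
  by apply: le_trans (coord_le_enorm x j) _; rewrite lerDr.
apply: (@le_trans _ _ (2 * t ^+ 2 * (cabs (u x) * (1 + enorm x) ^+ 2))).
  rewrite (_ : 2 * t ^+ 2 * _ = cabs (u x) * (2 * (t ^+ 2 * (1 + enorm x) ^+ 2))); last by ring.
  by rewrite ler_wpM2l ?cabs_ge0// ler_wpM2l.
rewrite (_ : 2 * M * _ * _ = 2 * t ^+ 2 * (M * weight x)); last by ring.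
by rewrite ler_wpM2l// mulr_ge0 ?sqr_ge0.
Qed.

Lemma Re_sub_real (t : R) (A B C : R[i]) : Re (A - B - t%:C * C) = Re A - Re B - t * Re C.
Proof. by rewrite Re_add Re_add !Re_opp Re_mul mul0r subr0. Qed.

Lemma Im_sub_real (t : R) (A B C : R[i]) : Im (A - B - t%:C * C) = Im A - Im B - t * Im C.
Proof. by rewrite Im_add Im_add !Im_opp Im_mul mul0r addr0. Qed.

Lemma is_derive_ft s u xi j : `|s| = 1 -> schwartz u ->
  is_derive xi 'e_j (reparts (ft s u)) (reparts (ft s (icoord s j u)) xi) /\
  is_derive xi 'e_j (imparts (ft s u)) (imparts (ft s (icoord s j u)) xi).
Proof.
move=> s1 Su; have [M uM] := schwartz_snb (2 * n.+1 + 2) Su.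
split; apply: (quadratic_is_derive (K := 2 * M * rint (@weight R n))) => t;
  apply: le_trans (ft_taylor xi j t s1 Su uM).
- rewrite /reparts; apply: le_trans (Re_le_cabs _).
  by rewrite (Re_sub_real t).
- rewrite /imparts; apply: le_trans (Im_le_cabs _).
  by rewrite (Im_sub_real t).
Qed.

Lemma ft_cts s u : `|s| = 1 -> schwartz u ->
  continuous (reparts (ft s u)) /\ continuous (imparts (ft s u)).
Proof.
move=> s1 Su; have [M uM] := schwartz_snb (2 * n.+1 + 1) Su.
split; apply: (lipschitz_continuous (K := 2 * M * rint (@weight R n))) => x y;
  apply: le_trans (ft_lip x y s1 (schwartz_smooth Su) uM).
- by rewrite /reparts -Re_opp -Re_add; exact: Re_le_cabs.
- by rewrite /imparts -Im_opp -Im_add; exact: Im_le_cabs.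
Qed.

Lemma smooth_ft s u : `|s| = 1 -> schwartz u -> smooth_c (ft s u).
Proof.
move=> s1 Su.
have H k : forall v, schwartz v -> Ck k (reparts (ft s v)) /\ Ck k (imparts (ft s v)).
  elim: k => [|k IH] v Sv; first by have [c1 c2] := ft_cts s1 Sv; split; split.
  have [c1 c2] := ft_cts s1 Sv.
  split; [apply: (Ck_S c1 (fun i x => (is_derive_ft x i s1 Sv).1))|
    apply: (Ck_S c2 (fun i x => (is_derive_ft x i s1 Sv).2))] => i.
  - exact: (IH _ (schwartz_icoord s i Sv)).1.
  - exact: (IH _ (schwartz_icoord s i Sv)).2.
by split; apply/smooth_Ck => k; [exact: (H k u Su).1|exact: (H k u Su).2].
Qed.

Lemma cpd_ft s u j : `|s| = 1 -> schwartz u -> cpdn [:: j] (ft s u) = ft s (icoord s j u).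
Proof.
move=> s1 Su; apply: cfun_eq.
- by rewrite reparts_cpdn; exact: (is_derive_pd (g' := fun i => reparts (ft s (icoord s i u))) (fun x => (is_derive_ft x j s1 Su).1)).
- by rewrite imparts_cpdn; exact: (is_derive_pd (g' := fun i => imparts (ft s (icoord s i u))) (fun x => (is_derive_ft x j s1 Su).2)).
Qed.

Lemma cpdM j u v : smooth_c u -> smooth_c v ->
  cpdn [:: j] (fun x => u x * v x) = fun x => cpdn [:: j] u x * v x + u x * cpdn [:: j] v x.
Proof.
move=> [uR uI] [vR vI]; apply: cfun_eq.
- rewrite reparts_cpdn /=.
  rewrite (_ : reparts _ = fun x => reparts u x * reparts v x - imparts u x * imparts v x); last first.
    by apply/funext => x; rewrite /reparts Re_mul.
  under eq_fun do rewrite -mulN1r.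
  rewrite (pdD _ (smoothM uR vR) (smoothZ (-1) (smoothM uI vI))) (pdM _ uR vR) (pdZ _ _ (smoothM uI vI)) (pdM _ uI vI).
  by apply/funext => x; rewrite /reparts Re_add !Re_mul !cpdnE /= /reparts /imparts; ring.
- rewrite imparts_cpdn /=.
  rewrite (_ : imparts _ = fun x => reparts u x * imparts v x + imparts u x * reparts v x); last first.
    by apply/funext => x; rewrite /imparts Im_mul.
  rewrite (pdD _ (smoothM uR vI) (smoothM uI vR)) (pdM _ uR vI) (pdM _ uI vR).
  by apply/funext => x; rewrite /imparts Im_add !Im_mul !cpdnE /= /reparts /imparts; ring.
Qed.

(** Integration by parts: the derivative of the Schwartz function [ep (s *: xi) x * u x] has
    integral 0. *)
Lemma ft_cpd s u j xi : schwartz u ->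
  ft s (cpdn [:: j] u) xi = - ('i%R * s%:C * (xi ord0 j)%:C) * ft s u xi.
Proof.
move=> Su; have iu := schwartz_cintg Su; have id := schwartz_cintg (schwartz_cpdn [:: j] Su).
have := schwartz_cint_cpd0 j (schwartz_mul (moderate_ep (s *: xi)) Su).
rewrite (cpdM _ (smooth_ep _) (schwartz_smooth Su)).
under eq_fun do rewrite cpdn_ep big_seq1 mxE rmorphM -!mulrA [ep _ _ * u _]mulrC [ep _ _ * cpdn _ _ _]mulrC -!epE 2!mulrA.
rewrite cintD; [|exact/cintgZ/cintg_ep|exact: cintg_ep].
rewrite cintZ; last exact: cintg_ep.
by rewrite -!/(ft _ _ _) mulNr => /eqP; rewrite addrC addr_eq0 => /eqP.
Qed.

(** One more power of [1 + |xi|] is at most [1 + sum_i |xi_i|], and each [|xi_i|] is traded for a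
    derivative of [u]. The [n + 2] terms, each bounded by the previous step, give the new
    constant. *)
Lemma ft_decay s (k : nat) : `|s| = 1 -> exists N' (C : R), 0 <= C /\ forall u M, schwartz u -> snb N' u M ->
  forall xi, (1 + enorm xi) ^+ k * cabs (ft s u xi) <= C * M.
Proof.
move=> s1; elim: k => [|k [N' [C [C0 IH]]]].
  exists (2 * n.+1)%N, (rint (@weight R n)); split; first by apply: rint_ge0 => x; exact/ltW/weight_gt0.
  by move=> u M Su uM xi; rewrite expr0 mul1r mulrC; exact: ft_le (schwartz_smooth Su) uM.
exists N'.+1, (n.+2%:R * C); split; first by rewrite mulr_ge0.
move=> u M Su uM xi; rewrite exprS.
apply: (@le_trans _ _ ((1 + \sum_i `|xi ord0 i|) * ((1 + enorm xi) ^+ k * cabs (ft s u xi)))).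
  rewrite -mulrA ler_wpM2r ?lerD2l ?enorm_le_sum//.
  by rewrite mulr_ge0 ?cabs_ge0// exprn_ge0// ltW// enorm1_gt0.
have H0 : (1 + enorm xi) ^+ k * cabs (ft s u xi) <= C * M.
  by apply: IH => //; exact: snb_le uM.
have H1 i : `|xi ord0 i| * ((1 + enorm xi) ^+ k * cabs (ft s u xi)) <= C * M.
  apply: le_trans (IH (cpdn [:: i] u) M (schwartz_cpdn _ Su) _ xi).
    rewrite ft_cpd// cabsM cabsN 2!cabsM !cabs_real s1 mulr1.
    rewrite (_ : cabs ('i%R : R[i]) = 1) ?mul1r; last by rewrite iE /cabs /= expr0n expr1n add0r sqrtr1.
    by rewrite mulrCA.
  by apply: snb_cpdn; rewrite addn1.
rewrite mulrDl mul1r mulr_suml -natr1 -mulrA mulrDl mul1r [leRHS]addrC lerD//.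
apply: (@le_trans _ _ (\sum_(i < n.+1) C * M)); first by apply: ler_sum => i _.
by rewrite sumr_const card_ord -[leLHS]mulr_natl.
Qed.

Lemma ft_bound s (m k : nat) : `|s| = 1 -> exists N' (C : R), 0 <= C /\ forall u M, schwartz u -> snb N' u M ->
  forall xi al, (size al <= m)%N -> (1 + enorm xi) ^+ k * cabs (cpdn al (ft s u) xi) <= C * M.
Proof.
move=> s1; elim: m => [|m [N' [C [C0 IH]]]].
  have [N' [C [C0 H]]] := ft_decay k s1; exists N', C; split=> // u M Su uM xi al.
  by rewrite leqn0 size_eq0 => /eqP ->; rewrite cpdn_nil; exact: H Su uM xi.
exists N'.+1, (C * (4 * 2 ^+ N')); split; first by rewrite !mulr_ge0// exprn_ge0.
move=> u M Su uM xi al; case/lastP: al => [_|al j].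
  apply: le_trans (IH u M Su (snb_le (leqnSn N') (lexx M) uM) xi [::] isT) _.
  rewrite -mulrA ler_wpM2l// ler_peMl ?(snb_ge0 uM)//.
  by rewrite -[leLHS]mul1r ler_pM// ?exprn_ege1//; lra.
rewrite size_rcons ltnS -cats1 cpdn_cat (cpd_ft _ s1 Su) -mulrA => al_m.
exact: (IH _ _ (schwartz_icoord s j Su) (snb_icoord j s1 (schwartz_smooth Su) uM) xi al al_m).
Qed.

(** Continuity of the transform on the Schwartz space: [N'] and [C] do not depend on [u], which is
    what makes [a] composed with [ft s] tempered in [tempered_ft]. *)
Lemma snb_ft s N : `|s| = 1 -> exists N' (C : R), 0 <= C /\ forall u M, schwartz u -> snb N' u M ->
  snb N (ft s u) (C * M).
Proof. by move=> s1; have [N' [C [C0 H]]] := ft_bound N N s1; exists N', C; split=> // u M Su uM x al; exact: H. Qed.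

Lemma schwartz_ft s u : `|s| = 1 -> schwartz u -> schwartz (ft s u).
Proof.
move=> s1 Su; apply/schwartzP; split; first exact: smooth_ft.
move=> N; have [N' [C [_ H]]] := snb_ft N s1.
by have [M uM] := schwartz_snb N' Su; exists (C * M); exact: H Su uM.
Qed.

End fourier_transform.

(** * Gaussians *)

Section gaussian.
Context {R : realType} {n : nat}.
Notation vec := 'rV[R]_n.+1.
Local Notation RnT := (Rn (R:=R) (n:=n.+1)).
Local Notation lam := (@lam R n.+1).
Implicit Types (c s : R) (j : 'I_n.+1).

(** Negative [c] is allowed: [gauss (- c)] is the reciprocal of [gauss c] and is used to divide a
    Gaussian out. *)
Definition gauss c : vec -> R := fun x => expR (- (c * dotp x x)).

Definition gauss_mass c : R := Num.sqrt (pi / c) ^+ n.+1.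

Lemma integral_gauss1 c : 0 < c ->
  (\int[lebesgue_measure]_t (expR (- (c * (t * t))))%:E = (Num.sqrt (pi / c))%:E)%E.
Proof.
(* With variance [1 / (2 c)] the normal density is proportional to the integrand. *)
move=> c0; pose sg := Num.sqrt (c^-1 / 2) : R.
have sg2 : sg ^+ 2 *+ 2 = c^-1.
  by rewrite sqr_sqrtr ?divr_ge0 ?invr_ge0 ?ltW// -mulr_natr divfK.
have sg0 : sg != 0 by rewrite gt_eqF// sqrtr_gt0 divr_gt0// invr_gt0.
have pk : normal_peak sg = (Num.sqrt (pi / c))^-1.
  by rewrite /normal_peak -mulrnAl sg2 mulrC.
have k0 : 0 < Num.sqrt (pi / c) by rewrite sqrtr_gt0 divr_gt0// pi_gt0.
have E t : expR (- (c * (t * t))) = Num.sqrt (pi / c) * normal_pdf 0 sg t.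
  rewrite /normal_pdf (negPf sg0) pk [RHS]mulrA mulfV ?gt_eqF// mul1r /normal_fun subr0 sg2 invrK.
  by congr expR; ring.
under eq_integral do rewrite E EFinM.
rewrite ge0_integralZl ?integral_normal_pdf ?mule1//.
- by apply/measurable_EFinP; exact: measurable_normal_pdf.
- by move=> t _; rewrite lee_fin normal_pdf_ge0.
Qed.

Lemma gauss_prod c x : gauss c x = \prod_i expR (- (c * (x ord0 i * x ord0 i))).
Proof. by rewrite /gauss /dotp mulr_sumr -sumrN expR_sum. Qed.

Lemma gauss_gt0 c x : 0 < gauss c x. Proof. exact: expR_gt0. Qed.

Lemma smooth_gauss c : smooth_r (gauss c).
Proof.
apply: (@smooth_comp _ _ expR); first by move=> k; exact: C1_expR.
apply: smoothN; apply: smoothZ.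
by apply: (@smooth_sum _ _ _ _ (fun i (x : vec) => x ord0 i * x ord0 i)) => i; apply: smoothM; exact: smooth_coord.
Qed.

Lemma integral_gauss c : 0 < c -> (\int[lam]_x (gauss c x)%:E = (gauss_mass c)%:E)%E.
Proof.
move=> c0; rewrite (eq_integral (fun x : RnT => (\prod_i expR (- (c * ((x : vec) ord0 i * (x : vec) ord0 i))))%:E)).
  rewrite (integral_prod_coord (f := fun=> fun t => expR (- (c * (t * t)))) (c := fun=> Num.sqrt (pi / c))).
  - by rewrite prodr_const card_ord.
  - by move=> _ t; exact: expR_ge0.
  - move=> _; apply: measurableT_comp => //; apply: measurableT_comp => //.
    by apply: measurable_funM => //; exact: measurable_funM.
  - by move=> _; exact: integral_gauss1.
by move=> x _; rewrite gauss_prod.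
Qed.

Lemma rintg_gauss c : 0 < c -> rintg (gauss c).
Proof.
move=> c0; apply/integrableP; split.
  by apply/measurable_EFinP; apply: continuous_measurable_Rn; exact: smooth_cts (smooth_gauss c).
rewrite (eq_integral (fun x : RnT => (gauss c x)%:E)) ?integral_gauss ?ltry//.
by move=> x _ /=; rewrite gtr0_norm ?gauss_gt0.
Qed.

Lemma rint_gauss c : 0 < c -> rint (gauss c) = gauss_mass c.
Proof. by move=> c0; rewrite /rint /Rintegral integral_gauss. Qed.

Lemma is_derive_gauss c j (x : vec) : is_derive x 'e_j (gauss c) ((- (2 * c)) * x ord0 j * gauss c x).
Proof.
have d1 : is_derive (- (c * dotp x x)) 1 expR (gauss c x) by exact: is_derive_expR.
have E : (fun y : vec => - (c * dotp y y)) = fun y => (- c) * \sum_i y ord0 i * y ord0 i.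
  by apply/funext => y; rewrite mulNr.
have sq : smooth_r (fun y : vec => \sum_i y ord0 i * y ord0 i).
  by apply: (@smooth_sum _ _ _ _ (fun i (x : vec) => x ord0 i * x ord0 i)) => i; apply: smoothM; exact: smooth_coord.
have d2 := smooth_is_derive j x (smoothZ (- c) sq).
rewrite -E in d2.
have := is_derive_comp1 d1 d2; congr (is_derive _ _ _ _).
rewrite [RHS]mulrC; congr (_ * _); rewrite E (pdZ _ _ sq).
suff -> : pd j (fun y : vec => \sum_i y ord0 i * y ord0 i) = fun y => 2 * y ord0 j by ring.
apply: (is_derive_pd (g' := fun j y => 2 * y ord0 j)) => y.
apply: (quadratic_is_derive (K := 1)) => t; rewrite -!/(dotp _ _).
rewrite !dotpDl !dotpDr !dotpZl !dotpZr (dotpC 'e_j y) !dotp_delta mxE !eqxx /=.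
rewrite (_ : _ - t * _ = t ^+ 2); last by ring.
by rewrite mul1r ger0_norm ?sqr_ge0.
Qed.

Lemma pd_gauss c j : pd j (gauss c) = fun x => (- (2 * c)) * x ord0 j * gauss c x.
Proof. by apply: (is_derive_pd (g' := fun j x => (- (2 * c)) * x ord0 j * gauss c x)) => x; exact: is_derive_gauss. Qed.

(** Derivatives of a Gaussian are polynomials times the Gaussian; only the growth of the polynomial
    is recorded. *)
Lemma pdn_gauss_le c (N : nat) : exists2 e : R, 0 <= e & exists p, forall x be, (size be <= N)%N ->
  `|pdn be (gauss c) x| <= e * (1 + enorm x) ^+ p * gauss c x.
Proof.
elim: N => [|N [e e0 [p IH]]].
  exists 1 => //; exists 0%N => x be; rewrite leqn0 size_eq0 => /eqP -> /=.
  by rewrite mulr1 mul1r gtr0_norm ?gauss_gt0.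
pose d := `|2 * c|.
exists (e + 2 ^+ N * (d + 1) * e); first by rewrite addr_ge0// !mulr_ge0// ?exprn_ge0// addr_ge0// normr_ge0.
exists p.+1 => x be be_N.
have E1 := enorm1_ge1 x; have E0 := ltW (enorm1_gt0 x); have G0 := ltW (gauss_gt0 c x).
have pow : (1 + enorm x) ^+ p <= (1 + enorm x) ^+ p.+1 by rewrite ler_weXn2l.
rewrite 2!mulrDl; case/lastP: be be_N => [|be j].
  move=> _; apply: le_trans (IH x [::] isT) _; rewrite ler_wpDr//.
    by rewrite !mulr_ge0// ?exprn_ge0// addr_ge0// normr_ge0.
  by rewrite ler_wpM2r// ler_wpM2l.
rewrite size_rcons ltnS pdn_rcons pd_gauss => be_N.
apply: (@le_trans _ _ (2 ^+ N * ((d + 1) * e) * (1 + enorm x) ^+ p.+1 * gauss c x)); last first.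
  by rewrite (mulrA (2 ^+ N)) lerDr !mulr_ge0// exprn_ge0.
have sl : smooth_r (fun x : vec => - (2 * c) * x ord0 j) by apply: smoothZ; exact: smooth_coord.
have H := pdn_mul_le (N := N) (x := x) (A := (d + 1) * (1 + enorm x)) sl (smooth_gauss c) _ (IH x) be_N.
apply: le_trans (H _) _ => {H}.
  move=> ga _; rewrite (pdnZ _ _ (smooth_coord j)) normrM normrN -/d.
  apply: ler_pM; [exact: normr_ge0|exact: normr_ge0|by rewrite lerDl|].
  case/lastP: ga => [|ga i] /=; first by apply: le_trans (coord_le_enorm x j) _; rewrite lerDr.
  rewrite pdn_rcons pd_coord pdn_cst; case: ga => [|? ?]; last by rewrite normr0.
  by case: eqP => _; rewrite ?normr1 ?normr0.
rewrite (_ : _ * _ * (1 + enorm x) ^+ p.+1 * _ = 2 ^+ N * ((d + 1) * (1 + enorm x) * (e * (1 + enorm x) ^+ p * gauss c x))); last first.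
  by rewrite exprS; ring.
rewrite ler_wpM2r ?ler_eXn2l ?ltr1n//.
by rewrite !mulr_ge0// ?exprn_ge0// addr_ge0// normr_ge0.
Qed.

(** With [t = c |x|^2] the power is at most [(2 + 2 / c)^k (1 + t)^(k + 1)], and [expr_le_expR] at
    [1 + t] leaves the factor [expR 1]. *)
Lemma gauss_decay c (k : nat) : 0 < c -> exists C, forall x : vec, (1 + enorm x) ^+ k * gauss c x <= C.
Proof.
move=> c0; exists ((2 + 2 / c) ^+ k * (k.+1`!%:R * expR 1)) => x.
set t := c * dotp x x; have t0 : 0 <= t by rewrite mulr_ge0 ?dotp_ge0// ltW.
have E1 := enorm1_ge1 x; have d0 : 0 <= 2 + 2 / c by rewrite addr_ge0// divr_ge0// ltW.
have h1 : (1 + enorm x) ^+ k <= (2 + 2 / c) ^+ k * (1 + t) ^+ k.+1.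
  apply: (@le_trans _ _ ((2 + 2 / c) ^+ k * (1 + t) ^+ k)); last first.
    by rewrite ler_wpM2l ?exprn_ge0// ler_weXn2l ?lerDl.
  rewrite -exprMn lerXn2r ?nnegrE ?(mulr_ge0 d0 (addr_ge0 ler01 t0)) ?(le_trans ler01 E1)//.
  apply: (@le_trans _ _ ((1 + enorm x) ^+ 2)); first by rewrite ler_eXnr.
  have -> : (2 + 2 / c) * (1 + t) = 2 + 2 * dotp x x + (2 / c + 2 * t).
    by rewrite /t; field; rewrite gt_eqF.
  apply: (@le_trans _ _ (2 + 2 * dotp x x)).
    rewrite -enorm_sqr -subr_ge0 (_ : _ - _ = (1 - enorm x) ^+ 2) ?sqr_ge0//.
    by move: (enorm x) => e; ring.
  by rewrite lerDl addr_ge0 ?(mulr_ge0 _ t0)// divr_ge0// ltW.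
have h2 := expr_le_expR k (addr_ge0 ler01 t0).
apply: (@le_trans _ _ ((2 + 2 / c) ^+ k * (k.+1`!%:R * expR (1 + t)) * gauss c x)).
  rewrite ler_wpM2r ?(ltW (gauss_gt0 _ _))//; apply: le_trans h1 _.
  by rewrite ler_wpM2l// exprn_ge0.
by rewrite /gauss -/t expRD -!mulrA -expRD subrr expR0 mulr1.
Qed.

Lemma schwartz_gauss c : 0 < c -> schwartz (fun x => (gauss c x)%:C).
Proof.
move=> c0; apply/schwartzP; split; first exact: smooth_c_real (smooth_gauss c).
move=> N; have [e e0 [p H]] := pdn_gauss_le c N.
have [C HC] := gauss_decay (N + p) c0; exists (e * C) => x al al_N.
rewrite cpdnE (_ : imparts _ = fun=> 0)// (_ : reparts _ = gauss c)// pdn_cst.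
rewrite (_ : (if al is [::] then _ else _) = 0); last by case: (al).
rewrite -/((pdn al (gauss c) x)%:C) cabs_real.
apply: le_trans (ler_wpM2l _ (H x al al_N)) _; first by rewrite exprn_ge0 ?ltW ?enorm1_gt0.
rewrite [leLHS](_ : _ = e * ((1 + enorm x) ^+ (N + p) * gauss c x)); last by rewrite exprD; ring.
by rewrite ler_wpM2l.
Qed.

End gaussian.

(** * Fourier inversion *)

Section fourier_inversion.
Context {R : realType} {n : nat}.
Notation vec := 'rV[R]_n.+1.
Notation Re := complex.Re.
Notation Im := complex.Im.
Implicit Types (c s : R) (j : 'I_n.+1) (w : vec -> R[i]).

Let gaussC c : vec -> R[i] := fun x => (gauss c x)%:C.

Lemma cpd_gaussC c j : cpdn [:: j] (gaussC c) = fun x => (- (2 * c))%:C * (ccoord j x * gaussC c x).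
Proof.
apply: cfun_eq.
  rewrite reparts_cpdn /= (_ : reparts _ = gauss c)// pd_gauss.
  by apply/funext => x; rewrite /reparts !Re_mul /= !mul0r !subr0 mulrA.
rewrite imparts_cpdn /= (_ : imparts _ = fun=> 0)// pd_cst.
by apply/funext => x; rewrite /imparts /ccoord /gaussC -!rmorphM.
Qed.

Lemma sqr_normr1 s : `|s| = 1 -> s ^+ 2 = 1.
Proof. by move=> s1; rewrite -(real_normK (num_real s)) s1 expr1n. Qed.

(* By [ft_cpd] and [cpd_ft] the product of [ft s (gauss c)] with [gauss (- (4 c)^-1)] has zero derivatives. *)
Lemma ft_gauss s c xi : `|s| = 1 -> 0 < c ->
  ft s (gaussC c) xi = (gauss_mass (n := n) c * gauss (4 * c)^-1 xi)%:C.
Proof.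
move=> s1 c0; have Sg := schwartz_gauss (n := n) c0; have ig := schwartz_cintg Sg.
pose E := gaussC (- (4 * c)^-1).
have sE : smooth_c E by exact: smooth_c_real (smooth_gauss _).
have sf := smooth_ft s1 Sg.
have ss : (s%:C * s%:C = 1 :> R[i]) by rewrite -rmorphM -expr2 sqr_normr1.
have ii : ('i%R * 'i%R = -1 :> R[i]) by rewrite -expr2 sqr_i.
have c2 : (2 * c)%:C != 0 :> R[i] by rewrite fmorph_eq0 mulf_neq0// gt_eqF.
have dft j : cpdn [:: j] (ft s (gaussC c)) = fun y => - ((2 * c)%:C)^-1 * (ccoord j y * ft s (gaussC c) y).
  apply/funext => y; rewrite (cpd_ft _ s1 Sg).
  have := ft_cpd s j y Sg; rewrite -/(gaussC c) cpd_gaussC ftZ; last exact: (schwartz_cintg (schwartz_ccoord j Sg)).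
  rewrite /icoord ftZ; last exact: (schwartz_cintg (schwartz_ccoord j Sg)).
  set A := ft s (fun x => ccoord j x * gaussC c x) y; set B := ft s (gaussC c) y; rewrite /ccoord rmorphN /= => H.
  apply: (mulfI c2); rewrite mulNr mulrN mulVKf//.
  have -> : (2 * c)%:C * ('i%R * s%:C * A) = - ('i%R * s%:C) * (- (2 * c)%:C * A) by ring.
  rewrite H; have -> : - ('i * s%:C) * (- ('i * s%:C * (y ord0 j)%:C) * B) =
    ('i%R * 'i%R) * (s%:C * s%:C) * ((y ord0 j)%:C * B) by ring.
  by rewrite ss ii mulr1 mulN1r.
have dE j : cpdn [:: j] E = fun y => ((2 * c)%:C)^-1 * (ccoord j y * E y).
  rewrite cpd_gaussC; apply/funext => y; congr (_ * _); rewrite -fmorphV; congr (_%:C).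
  by field; rewrite gt_eqF.
have cst j : cpdn [:: j] (fun y => ft s (gaussC c) y * E y) = fun=> 0.
  by rewrite (cpdM j sf sE) dft dE; apply/funext => y; ring.
have [sR sI] := smooth_cM sf sE.
have eR j (x : vec) : pd j (reparts (fun y => ft s (gaussC c) y * E y)) x = 0.
  by have := congr1 (fun f => Re (f x)) (cst j); rewrite cpdnE.
have eI j (x : vec) : pd j (imparts (fun y => ft s (gaussC c) y * E y)) x = 0.
  by have := congr1 (fun f => Im (f x)) (cst j); rewrite cpdnE.
have R0 := pd0_const sR eR xi 0; have I0 := pd0_const sI eI xi 0.
have EE : ft s (gaussC c) xi * E xi = ft s (gaussC c) 0 * E 0.
  by apply: (eqP (_ : _ == _)); rewrite eq_complex; apply/andP; split; apply/eqP; [exact: R0|exact: I0].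
have E0 : E 0 = 1 by rewrite /E /gaussC /gauss dotp0r mulr0 oppr0 expR0.
have f0 : ft s (gaussC c) 0 = (gauss_mass (n := n) c)%:C.
  rewrite /ft; under eq_fun do rewrite dotp0r mulr0 expi0 mulr1.
  rewrite cintE -(rint_gauss c0) (_ : (fun x : vec => Im (gaussC c x)) = fun=> 0)//.
  by rewrite /rint /Rintegral; under eq_integral do [] ; rewrite integral0.
have Ex : E xi != 0 by rewrite /E /gaussC fmorph_eq0 gt_eqF// gauss_gt0.
apply: (mulIf Ex); rewrite EE E0 f0 mulr1 /E /gaussC -rmorphM /= -mulrA.
by rewrite /gauss -expRD mulNr opprK addrC subrr expR0 mulr1.
Qed.

(** The left-hand side is the integral of the transform of [gauss c]. Its value, which does not
    depend on [c], is the constant of the inversion formula. *)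
Lemma gauss_mass_dual c : 0 < c -> gauss_mass (n := n) c * gauss_mass (n := n) (4 * c)^-1 = (2 * pi) ^+ n.+1.
Proof.
move=> c0; have p0 : 0 < pi :> R by exact: pi_gt0.
rewrite /gauss_mass -exprMn -sqrtrM ?divr_ge0 ?ltW//; congr (_ ^+ _).
rewrite invrK (_ : pi / c * _ = (2 * pi) ^+ 2); last by field; rewrite gt_eqF.
by rewrite sqrtr_sqr ger0_norm// mulr_ge0// ltW.
Qed.

Lemma gauss_sub1 c (x : vec) : 0 < c -> `|gauss c x - 1| <= c * enorm x ^+ 2.
Proof.
move=> c0; have := expR_ge1Dx (- (c * dotp x x)); rewrite -/(gauss c x) enorm_sqr => H.
have H0 : 0 <= c * dotp x x by rewrite mulr_ge0 ?dotp_ge0// ltW.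
have H1 : gauss c x <= 1 by rewrite /gauss -expR0 ler_expR oppr_le0.
by rewrite ler0_norm ?subr_le0//; lra.
Qed.

(* Insert [gauss c] under the integral, move the Fourier transform onto it with [cint_expi_swap], and let [c] tend to 0. *)
Lemma cint_ft s w : `|s| = 1 -> schwartz w -> cint (ft s w) = ((2 * pi) ^+ n.+1)%:C * w 0.
Proof.
move=> s1 Sw; have Sf := schwartz_ft s1 Sw; have If := schwartz_cintg Sf; have Iw := schwartz_cintg Sw.
have [sR sI] := schwartz_smooth Sw.
have [M fM] := schwartz_snb (2 * n.+1 + 2) Sf.
have [K wK] := schwartz_snb 1 Sw.
have K0 := snb_ge0 wK.
have lipw x : cabs (w x - w 0) <= 2 * K * (n.+1%:R * enorm x).
  have H (g : vec -> R) : smooth_r g -> (forall i x, `|pd i g x| <= K) -> `|g x - g 0| <= K * (n.+1%:R * enorm x).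
    move=> sg gK; apply: le_trans (bounded_pd_lipschitz sg gK x 0) _; rewrite ler_wpM2l//.
    apply: (@le_trans _ _ (\sum_(i < n.+1) enorm x)); last by rewrite sumr_const card_ord mulr_natl.
    by apply: ler_sum => i _; rewrite mxE subr0 coord_le_enorm.
  have dK i y : cabs (cpdn [:: i] w y) <= K.
    apply: le_trans (wK y [:: i] isT); rewrite ler_peMl ?cabs_ge0// expr1; exact: enorm1_ge1.
  apply: le_trans (cabs_le_ReIm _) _; rewrite -mulrA mulr_natl mulr2n; apply: lerD.
    rewrite Re_add Re_opp; apply: (H _ sR) => i y.
    by apply: le_trans (dK i y); rewrite cpdnE; exact: (Re_le_cabs (Complex _ _)).
  rewrite Im_add Im_opp; apply: (H _ sI) => i y.
  by apply: le_trans (dK i y); rewrite cpdnE; exact: (Im_le_cabs (Complex _ _)).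
(* [A c] bounds the error of inserting [gauss c] under the integral, and [B sqrt (8 c)] that of
   replacing [w] by [w 0] against a Gaussian of mass [(2 pi)^(n+1)] and width of order [sqrt c]. *)
pose A := M * rint (@weight R n).
pose B := 2 * K * n.+1%:R * (Num.sqrt 8 * pi) ^+ n.+1.
have key c : 0 < c -> cabs (cint (ft s w) - ((2 * pi) ^+ n.+1)%:C * w 0) <= A * c + B * Num.sqrt (8 * c).
  move=> c0; have Ig := schwartz_cintg (schwartz_gauss (n := n) c0).
  have c4 : 0 < (4 * c)^-1 by rewrite invr_gt0 mulr_gt0.
  have c8 : 0 < (8 * c)^-1 by rewrite invr_gt0 mulr_gt0.
  pose Z := gauss_mass (n := n) c; have Z0 : 0 <= Z by rewrite exprn_ge0.
  have sw : cint (fun x => gaussC c x * ft s w x) = cint (fun x => w x * (Z * gauss (4 * c)^-1 x)%:C).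
    rewrite [LHS](_ : _ = cint (fun y => gaussC c y * cint (fun x => w x * expi (s * dotp y x)))); last first.
      by congr cint; apply/funext => y; rewrite /ft; congr (_ * cint _); apply/funext => x; rewrite dotpC.
    rewrite (cint_expi_swap s Ig Iw); congr cint; apply/funext => x; congr (_ * _).
    exact: (ft_gauss x s1 c0).
  have IZ : cintg (fun x : vec => (Z * gauss (4 * c)^-1 x)%:C).
    by have := cintgZ Z%:C (schwartz_cintg (schwartz_gauss (n := n) c4)); under eq_fun do rewrite -rmorphM.
  have CZ : cint (fun x : vec => (Z * gauss (4 * c)^-1 x)%:C) = ((2 * pi) ^+ n.+1)%:C.
    rewrite cintE /= rintZ ?rint_gauss//; last exact: rintg_gauss.
    by rewrite gauss_mass_dual// /rint /Rintegral; under eq_integral do []; rewrite integral0.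
  have Igf : cintg (fun x => gaussC c x * ft s w x) by exact: (schwartz_cintg (schwartz_mul (schwartz_moderate (schwartz_gauss c0)) Sf)).
  have IwZ : cintg (fun x => w x * (Z * gauss (4 * c)^-1 x)%:C).
    have := schwartz_cintg (schwartz_mul (schwartz_moderate Sw) (schwartzZ Z%:C (schwartz_gauss c4))).
    by under eq_fun do rewrite -rmorphM.
  have -> : cint (ft s w) - ((2 * pi) ^+ n.+1)%:C * w 0 =
      cint (fun x => ft s w x - gaussC c x * ft s w x) +
      cint (fun x => w x * (Z * gauss (4 * c)^-1 x)%:C - w 0 * (Z * gauss (4 * c)^-1 x)%:C).
    rewrite cintB// cintB//; last exact: cintgZ.
    by rewrite sw cintZ// CZ; ring.
  apply: le_trans (cabsD _ _) _; apply: lerD.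
    rewrite /A mulrAC -rintZ; last exact: rintg_weight.
    apply: cabs_cint_le; [exact: (cintg_cmeas (cintgB If Igf))| |exact: (rintgZ _ rintg_weight)] => x.
    have -> : ft s w x - gaussC c x * ft s w x = (1 - gauss c x)%:C * ft s w x by rewrite /gaussC rmorphB /=; ring.
    rewrite cabsM cabs_real distrC.
    apply: le_trans (ler_wpM2r (cabs_ge0 _) (gauss_sub1 x c0)) _.
    have e2 : enorm x ^+ 2 <= (1 + enorm x) ^+ 2.
      by rewrite lerXn2r ?nnegrE ?enorm_ge0 ?(ltW (enorm1_gt0 x))// lerDr.
    have := le_trans (ler_wpM2l (cabs_ge0 (ft s w x)) e2) (snb_weightX fM x).
    move/(ler_wpM2l (ltW c0)); congr (_ <= _); ring.
  have -> : B * Num.sqrt (8 * c) = rint (fun x : vec => 2 * K * n.+1%:R * Num.sqrt (8 * c) * Z * gauss (8 * c)^-1 x).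
    rewrite rintZ ?rint_gauss//; last exact: rintg_gauss.
    have p0 : 0 < pi :> R by exact: pi_gt0.
    have -> : B = 2 * K * n.+1%:R * (Z * gauss_mass (n := n) (8 * c)^-1); last by ring.
    congr (_ * _).
    rewrite /Z /gauss_mass -exprMn -sqrtrM ?divr_ge0 ?ltW//; congr (_ ^+ _).
    rewrite invrK (_ : pi / c * _ = 8 * pi ^+ 2); last by field; rewrite gt_eqF.
    by rewrite sqrtrM// sqrtr_sqr ger0_norm// ltW.
  apply: cabs_cint_le; [exact: (cintg_cmeas (cintgB IwZ (cintgZ _ IZ)))| |exact: (rintgZ _ (rintg_gauss c8))] => x.
  rewrite -mulrBl cabsM cabs_real (ger0_norm (mulr_ge0 Z0 (ltW (gauss_gt0 _ _)))).
  have G0 := ltW (gauss_gt0 (4 * c)^-1 x).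
  apply: le_trans (ler_wpM2r (mulr_ge0 Z0 G0) (lipw x)) _.
  (* Half of the Gaussian exponent absorbs the factor [enorm x]; the other half remains
     integrable. *)
  have ex : enorm x <= Num.sqrt (8 * c) * expR ((8 * c)^-1 * dotp x x).
    have q0 : 0 < Num.sqrt (8 * c) by rewrite sqrtr_gt0 mulr_gt0.
    rewrite -ler_pdivrMl//; apply: le_trans (expR_ge1Dx _); rewrite -enorm_sqr.
    set q := Num.sqrt _ in q0 *; have -> : (8 * c)^-1 = q^-1 ^+ 2.
      by rewrite exprVn sqr_sqrtr// mulr_ge0// ltW.
    by rewrite -exprMn; move: (q^-1 * enorm x) => t; nra.
  have -> : gauss (4 * c)^-1 x = gauss (8 * c)^-1 x * gauss (8 * c)^-1 x.
    by rewrite /gauss -expRD; congr expR; field; rewrite gt_eqF.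
  have -> : 2 * K * (n.+1%:R * enorm x) * (Z * (gauss (8 * c)^-1 x * gauss (8 * c)^-1 x)) =
    2 * K * n.+1%:R * Z * gauss (8 * c)^-1 x * (enorm x * gauss (8 * c)^-1 x) by ring.
  have -> : 2 * K * n.+1%:R * Num.sqrt (8 * c) * Z * gauss (8 * c)^-1 x =
    2 * K * n.+1%:R * Z * gauss (8 * c)^-1 x * Num.sqrt (8 * c) by ring.
  rewrite ler_wpM2l ?mulr_ge0 ?(ltW (gauss_gt0 _ _))//.
  by rewrite /gauss expRN ler_pdivrMr ?expR_gt0.
apply/eqP; rewrite -subr_eq0; apply/eqP/cabs_eq0/eqP; rewrite eq_le cabs_ge0 andbT.
have A0 : 0 <= A by rewrite mulr_ge0 ?(snb_ge0 fM)// rint_ge0// => x; exact: ltW (weight_gt0 x).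
have B0 : 0 <= B by rewrite !mulr_ge0// exprn_ge0// mulr_ge0// ltW// pi_gt0.
apply/ler_addgt0Pr => e e0; rewrite add0r.
(* With [c = t^2] both error terms become linear in [t]; the 3 is a bound for [sqrt 8]. *)
pose t := Num.min 1 (e / (A + 3 * B + 1)).
have D0 : 0 < A + 3 * B + 1 by lra.
have t0 : 0 < t by rewrite lt_min ltr01 divr_gt0.
have t1 : t <= 1 by rewrite ge_min lexx.
apply: le_trans (key (t ^+ 2) (exprn_gt0 _ t0)) _.
have -> : Num.sqrt (8 * t ^+ 2) = Num.sqrt 8 * t by rewrite sqrtrM// sqrtr_sqr gtr0_norm.
have s8 : Num.sqrt 8 <= 3 :> R by rewrite -[leRHS](@gtr0_norm _ 3)// -sqrtr_sqr ler_wsqrtr//; lra.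
apply: (@le_trans _ _ ((A + 3 * B + 1) * t)).
  have h1 : A * t ^+ 2 <= A * t by rewrite ler_wpM2l// expr2 ler_piMl// ltW.
  have h2 : B * (Num.sqrt 8 * t) <= 3 * B * t.
    by rewrite mulrA ler_wpM2r ?(ltW t0)// mulrC ler_wpM2r.
  rewrite 2!mulrDl mul1r; apply: (le_trans (lerD h1 h2)); rewrite lerDl; exact: ltW.
by rewrite mulrC -ler_pdivlMr// ge_min lexx orbT.
Qed.

(** Translating [w] by [x] multiplies its transform by an exponential, so [cint_ft], which is the
    case [x = 0], applies to the translate. *)
Lemma ft_inversion s w x : `|s| = 1 -> schwartz w ->
  ft (- s) (ft s w) x = ((2 * pi) ^+ n.+1)%:C * w x.
Proof.
move=> s1 Sw; rewrite -[w x](_ : (fun y => w (y + x)) 0 = _); last by rewrite add0r.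
rewrite -(cint_ft s1 (schwartz_shift x Sw)); congr cint; apply/funext => xi; rewrite /ft.
have Iw := cintg_ep s xi (schwartz_cintg (schwartz_shift x Sw)).
have := cint_translation (- x) (cintg_cmeas Iw); under eq_fun do rewrite subrK dotpDl [s * (_ + _)]mulrDr expiD.
move=> <-; rewrite -cintZr; last exact: (cintg_ep s xi (schwartz_cintg Sw)).
by congr cint; apply/funext => y; rewrite mulNr dotpNl mulrN dotpC mulrA [dotp xi x]dotpC.
Qed.

End fourier_inversion.

(** * The multiplier estimate *)

Section riemann_sums.
Context {R : realType} {n : nat}.
Notation vec := 'rV[R]_n.+1.
Local Notation RnT := (Rn (R:=R) (n:=n.+1)).
Implicit Types (phi u v F : vec -> R[i]) (r d : R).

(** The indicators of the grid cells form a partition of unity. Distributivity turns the sum over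
    multi-indices into a product of one-dimensional sums, each of which telescopes to 1. *)
Lemma sum_cell (a : nat -> R) (K : nat) (x : vec) :
  (forall i, a 0%N <= x ord0 i < a K) ->
  \sum_(k : {ffun 'I_n.+1 -> 'I_K})
    \prod_i ((a (k i) <= x ord0 i)%R%:R - (a (k i).+1 <= x ord0 i)%R%:R) = 1 :> R.
Proof.
move=> aK; rewrite -(bigA_distr_bigA (fun i (j : 'I_K) => (a j <= x ord0 i)%R%:R - (a j.+1 <= x ord0 i)%R%:R)).
apply: big1 => i _; have /andP[a0 ak] := aK i.
have := telescope_sumr (fun j => (a j <= x ord0 i)%R%:R : R) (leq0n K).
rewrite big_mkord a0 leNgt ak sub0r => T.
change (\sum_(j < K) ((a j <= x ord0 i)%R%:R - (a j.+1 <= x ord0 i)%R%:R) = 1 :> R).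
by apply: oppr_inj; rewrite -T -sumrN; apply: eq_bigr => j _; rewrite opprB.
Qed.

Lemma rint_sum (I : Type) (s : seq I) (H : I -> vec -> R) : (forall i, rintg (H i)) ->
  rint (fun x => \sum_(i <- s) H i x) = \sum_(i <- s) rint (H i).
Proof.
move=> iH; elim: s => [|k s IH].
  by rewrite big_nil; under eq_fun do rewrite big_nil; rewrite /rint /Rintegral integral0.
rewrite big_cons -IH -rintD//; last exact: rintg_sum.
by congr rint; apply/funext => x; rewrite big_cons.
Qed.

(* The nodes and weights are independent of [F], so that one Riemann sum serves a whole family of integrands. *)
Lemma riemann_sum phi r d : cintg phi -> 0 <= r -> 0 < d -> (forall x, r < enorm x -> phi x = 0) ->
  exists (I : finType) (m : I -> R[i]) (p : I -> vec),
    \sum_k cabs (m k) <= rint (fun x => cabs (phi x)) /\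
    forall F w, cintg (fun x => phi x * F x) -> 0 <= w ->
      (forall x y, enorm x <= r -> enorm y <= r + d -> enorm (x - y) <= d -> cabs (F x - F y) <= w) ->
      cabs (cint (fun x => phi x * F x) - \sum_k m k * F (p k)) <= w * rint (fun x => cabs (phi x)).
Proof.
(* The cells are half-open cubes of side [h]; the [n + 1] coordinates of a point differ from those
   of the lower corner by at most [h] each, hence a distance of at most [d]. *)
move=> iphi r0 d0 phi0; pose h := d / n.+1%:R.
have h0 : 0 < h by rewrite divr_gt0.
pose K := Num.bound (2 * r / h); pose a (j : nat) : R := - r + j%:R * h.
have aK : r < a K.
  have : 2 * r / h < K%:R by apply: archi_boundP; rewrite divr_ge0 ?mulr_ge0// ltW.
  by rewrite ltr_pdivrMr// /a; lra.
pose I : finType := {ffun 'I_n.+1 -> 'I_K}.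
pose th (k : I) (x : vec) : R := \prod_i ((a (k i) <= x ord0 i)%R%:R - (a (k i).+1 <= x ord0 i)%R%:R).
pose p (k : I) : vec := \row_i a (k i).
have amono j : a j <= a j.+1 by rewrite /a -natr1 mulrDl mul1r addrA lerDl ltW.
have e01 j t : 0 <= (a j <= t)%R%:R - (a j.+1 <= t)%R%:R :> R.
  have := amono j; case: (leP (a j.+1) t) => [h1 h2|_ _]; first by rewrite (le_trans h2 h1) subrr.
  by rewrite subr0 ler0n.
have th0 k x : 0 <= th k x by apply: prodr_ge0 => i _; exact: e01.
have thp k x : th k x != 0 -> enorm (x - p k) <= d.
  move=> tk; apply: le_trans (enorm_le_sum _) _.
  apply: (@le_trans _ _ (\sum_(i < n.+1) h)); last by rewrite sumr_const card_ord -mulr_natl /h mulrC divfK.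
  apply: ler_sum => i _; rewrite !mxE.
  have := prodf_neq0 _ _ tk i isT; have := amono (k i).
  case: (leP (a (k i).+1) (x ord0 i)) => [h1 h2|h1 _]; first by rewrite (le_trans h2 h1) subrr eqxx.
  case: (leP (a (k i)) (x ord0 i)) => [h2 _|]; last by rewrite subr0 eqxx.
  by rewrite ger0_norm ?subr_ge0// lerBlDl (le_trans (ltW h1))// /a -natr1 mulrDl mul1r addrA.
have ths x : enorm x <= r -> \sum_k th k x = 1.
  move=> xr; apply: sum_cell => i; have := le_trans (coord_le_enorm x i) xr.
  by rewrite ler_norml /a mul0r addr0 => /andP[-> h1]; exact: le_lt_trans h1 aK.
have thph x : phi x * (\sum_k th k x)%:C = phi x.
  by have [xr|xr] := leP (enorm x) r; [rewrite ths ?mulr1|rewrite phi0 ?mul0r].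
have the k x : phi x != 0 -> th k x <= 1.
  move=> px; rewrite -(ths x); first by rewrite (bigD1 k)//= lerDl sumr_ge0.
  by rewrite leNgt; apply/negP => /phi0 H; rewrite H eqxx in px.
have mth k : measurable_fun setT ((th k) : RnT -> R).
  apply: measurable_prod => i _.
  have mi (b : R) : measurable_fun setT ((fun x : vec => (b <= x ord0 i)%R%:R) : RnT -> R).
    have -> : (fun x : vec => (b <= x ord0 i)%R%:R : R) = (\1_(`[b, +oo[%classic) : R -> R) \o (fun x : vec => x ord0 i).
      by apply/funext => x; rewrite /= indicE mem_setE in_itv /= andbT.
    by apply: measurableT_comp; [exact: measurable_indic|exact: measurable_coord].
  exact: measurable_funB.
have cth k : cmeas (fun x => (th k x)%:C).
  by split => //; exact: mth.
have mphi := cintg_cmeas iphi.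
have le_phi k x : cabs (phi x * (th k x)%:C) <= cabs (phi x).
  rewrite cabsM cabs_real (ger0_norm (th0 _ _)).
  have [->|px] := eqVneq (phi x) 0; first by rewrite cabs0 mul0r.
  by rewrite ler_piMr ?cabs_ge0 ?the.
have iph k : cintg (fun x => phi x * (th k x)%:C).
  by apply: (cintg_le (cmeasM mphi (cth k)) (le_phi k)); exact: cintg_cabs.
(* The weight of a cell is the integral of [phi] over it and the node is its lower corner. A
   relevant node lies within [d] of the ball of radius [r], not necessarily in it, which explains
   [r + d]. *)
exists I, (fun k => cint (fun x => phi x * (th k x)%:C)), p; split.
  apply: (@le_trans _ _ (\sum_k rint (fun x => cabs (phi x) * th k x))).
    apply: ler_sum => k _; apply: le_trans (cabs_cint (iph k)) _.
    rewrite le_eqVlt; apply/orP; left; apply/eqP; congr rint; apply/funext => x.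
    by rewrite cabsM cabs_real ger0_norm.
  have irk k : rintg (fun x => cabs (phi x) * th k x).
    by apply: eq_ind (cintg_cabs (iph k)) _ _; congr rintg; apply/funext => x; rewrite cabsM cabs_real ger0_norm.
  rewrite -rint_sum// le_eqVlt; apply/orP; left; apply/eqP; congr rint; apply/funext => x.
  rewrite -mulr_sumr; have [xr|xr] := leP (enorm x) r; first by rewrite ths ?mulr1.
  by rewrite phi0// cabs0 mul0r.
move=> F w iF w0 Fw.
have iphF k : cintg (fun x => phi x * (th k x)%:C * F (p k)) by exact: cintgZr.
have -> : cint (fun x => phi x * F x) - \sum_k cint (fun x => phi x * (th k x)%:C) * F (p k) =
    cint (fun x => phi x * F x - \sum_k phi x * (th k x)%:C * F (p k)).
  rewrite cintB//; last exact: cintg_sum.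
  by rewrite cint_sum//; congr (_ - _); apply: eq_bigr => k _; rewrite cintZr.
rewrite -rintZ; last exact: cintg_cabs.
apply: cabs_cint_le; [by apply/cintg_cmeas/cintgB => //; exact: cintg_sum| |by apply/rintgZ/cintg_cabs] => x.
have -> : phi x * F x - \sum_k phi x * (th k x)%:C * F (p k) =
    \sum_k phi x * (th k x)%:C * (F x - F (p k)).
  rewrite -{1}(thph x) rmorph_sum /= mulr_sumr mulr_suml -sumrB.
  by apply: eq_bigr => k _; rewrite mulrBr.
apply: le_trans (cabs_sum _ _) _.
have -> : w * cabs (phi x) = \sum_k w * (cabs (phi x) * th k x).
  rewrite -mulr_sumr -mulr_sumr; have [xr|xr] := leP (enorm x) r; first by rewrite ths ?mulr1.
  by rewrite phi0// cabs0 mul0r.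
apply: ler_sum => k _; rewrite 2!cabsM cabs_real (ger0_norm (th0 _ _)) [w * _]mulrC.
have [t0|t0] := eqVneq (th k x) 0; first by rewrite t0 !(mulr0, mul0r).
have [px|px] := eqVneq (phi x) 0; first by rewrite px cabs0 !mul0r.
have xr : enorm x <= r by rewrite leNgt; apply/negP => /phi0 H; rewrite H eqxx in px.
rewrite ler_wpM2l ?mulr_ge0 ?cabs_ge0// Fw ?thp//.
rewrite -[p k](subrKC x) (le_trans (enormD _ _))// lerD// enorm_distC; exact: thp.
Qed.

Lemma cpdn_ft s u xi al : `|s| = 1 -> schwartz u ->
  cpdn al (ft s u) xi = cint (fun x => u x * cpdn al (ep (s *: x)) xi).
Proof.
move=> s1; elim/last_ind: al u => [|al j IH] u Su.
  by rewrite cpdn_nil; congr cint; apply/funext => x; rewrite cpdn_nil /ep dotpZr dotpC.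
rewrite -cats1 cpdn_cat (cpd_ft _ s1 Su) (IH _ (schwartz_icoord s j Su)).
congr cint; apply/funext => x; rewrite !cpdn_ep big_cat /= big_seq1 /icoord /ccoord mxE rmorphM /=.
by ring.
Qed.

End riemann_sums.

(** * Tempered functionals applied to Fourier transforms *)

Section tempered_functionals.
Context {R : realType} {n : nat}.
Notation vec := 'rV[R]_n.+1.
Implicit Types (phi u v F : vec -> R[i]) (r d : R) (a : (vec -> R[i]) -> R[i]).

Lemma locally_lipschitz_continuous (g : vec -> R) :
  (forall L, exists K, forall x y, enorm x <= L -> enorm y <= L -> `|g x - g y| <= K * enorm (x - y)) ->
  continuous g.
Proof.
move=> gK x; have [K HK] := gK (enorm x + 1).
have c1 : continuous (fun y : vec => (`|K| + 1) * enorm (y + (- x))).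
  by apply: ctsM; [exact: cts_cst|exact: cts_shift (@continuous_enorm R n)].
have c0 := c1 x; rewrite /continuous_at subrr enorm0 mulr0 in c0.
have [c2 _] := @cvgrPdist_lt R R vec (nbhs x) (nbhs_filter x) (fun y : vec => (`|K| + 1) * enorm (y + (- x))) 0.
have [_ c3] := @cvgrPdist_lt R R vec (nbhs x) (nbhs_filter x) g (g x).
have K1 : 0 < `|K| + 1 by rewrite ltr_wpDl.
apply: c3 => e e0.
have e10 : 0 < Num.min 1 e by rewrite lt_min ltr01.
apply: (@filterS _ _ (nbhs_filter x) _ _ _ (c2 c0 _ e10)) => y.
rewrite sub0r normrN ger0_norm ?mulr_ge0 ?enorm_ge0 ?(ltW K1)// lt_min => /andP[y1 ye].
have yx : enorm (y - x) <= 1.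
  by apply: le_trans (ltW y1); rewrite ler_peMl ?enorm_ge0// lerDr.
apply: le_lt_trans ye; apply: le_trans (HK x y _ _) _; first by rewrite lerDl.
  by rewrite -[y](subrKC x) (le_trans (enormD _ _))// lerD2l.
rewrite enorm_distC ler_wpM2r ?enorm_ge0// (le_trans (ler_norm K))// lerDl; exact: ler01.
Qed.

Lemma smooth_c_sum (I : Type) (s : seq I) (F : I -> vec -> R[i]) : (forall i, smooth_c (F i)) ->
  smooth_c (fun x => \sum_(i <- s) F i x).
Proof.
move=> sF; elim: s => [|i s IH].
  by under eq_fun do rewrite big_nil; exact: smooth_c_cst.
by under eq_fun do rewrite big_cons; exact: (smooth_cD (sF i) IH).
Qed.

Lemma cpdn_sum (I : Type) (s : seq I) (F : I -> vec -> R[i]) al : (forall i, smooth_c (F i)) ->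
  cpdn al (fun x => \sum_(i <- s) F i x) = fun x => \sum_(i <- s) cpdn al (F i) x.
Proof.
move=> sF; elim: s => [|i s IH].
  have E : (fun x : vec => \sum_(i <- [::]) F i x) = fun x => 0 * (0 : R[i]).
    by apply/funext => x; rewrite big_nil mul0r.
  rewrite E (cpdnZ _ _ (smooth_c_cst _)).
  by apply/funext => x; rewrite big_nil mul0r.
have E : (fun x : vec => \sum_(j <- i :: s) F j x) = fun x => F i x + \sum_(j <- s) F j x.
  by apply/funext => x; rewrite big_cons.
rewrite E (cpdnD _ (sF i) (smooth_c_sum _ sF)) IH.
by apply/funext => x; rewrite big_cons.
Qed.

Lemma schwartz_mul_cpdn_ep s u xi al : schwartz u ->
  schwartz (fun x => u x * cpdn al (ep (s *: x)) xi).
Proof.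
elim/last_ind: al u => [|al j IH] u Su.
  rewrite (_ : (fun x => _) = fun x => ep (s *: xi) x * u x); first exact: (schwartz_mul (moderate_ep _) Su).
  by apply/funext => x; rewrite cpdn_nil mulrC /ep !dotpZr dotpC.
rewrite (_ : (fun x => _) = fun x => icoord s j u x * cpdn al (ep (s *: x)) xi).
  exact: (IH _ (schwartz_icoord s j Su)).
apply/funext => x; rewrite -cats1 !cpdn_ep big_cat /= big_seq1 /icoord /ccoord mxE rmorphM /=.
by ring.
Qed.

(** The same nodes serve two purposes: applied to derivatives of exponentials they approximate
    [ft 1 phi] in the seminorms, and applied to a general [F] they approximate its integral. [r] and
    [K] are fixed before the mesh; [r] exceeds the radius of the support by 1 because the relevant
    nodes lie within [d <= 1] of the support. *)
Lemma ft_riemann phi (N : nat) : test_fun phi -> exists r K : R, [/\ 0 <= r, 0 <= K &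
  forall d, 0 < d -> d <= 1 -> exists (I : finType) (m : I -> R[i]) (p : I -> vec),
  [/\ \sum_k cabs (m k) <= rint (fun x => cabs (phi x)),
      forall xi al, (size al <= N)%N ->
        cabs (cpdn al (fun xi => ft 1 phi xi - \sum_k m k * ep (p k) xi) xi) <=
          K * d * (1 + enorm xi) ^+ 1 &
      forall F w, cintg (fun x => phi x * F x) -> 0 <= w ->
        (forall x y, enorm x <= r -> enorm y <= r -> enorm (x - y) <= d -> cabs (F x - F y) <= w) ->
        cabs (cint (fun x => phi x * F x) - \sum_k m k * F (p k)) <= w * rint (fun x => cabs (phi x))]].
Proof.
move=> Tphi; have Sphi := test_schwartz Tphi; have iphi := schwartz_cintg Sphi.
have [r0 r00 phi0] := test_support Tphi.
have J0 : 0 <= rint (fun x => cabs (phi x)) by apply: rint_ge0 => x; exact: cabs_ge0.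
exists (r0 + 1), ((1 + (r0 + 1)) ^+ N * N.+2%:R * rint (fun x => cabs (phi x))).
split; [by rewrite addr_ge0 ?ltW|by rewrite !mulr_ge0// exprn_ge0// !addr_ge0// ltW|] => d d0 d1.
have phi0' x : r0 < enorm x -> phi x = 0 by move=> /(phi0 x [::]); rewrite cpdn_nil.
have [I [m [p [m1 H]]]] := riemann_sum iphi (ltW r00) d0 phi0'.
have lei (x : vec) : enorm x <= r0 -> enorm x <= r0 + 1 by move=> /le_trans; apply; rewrite lerDl.
have led (y : vec) : enorm y <= r0 + d -> enorm y <= r0 + 1 by move=> /le_trans; apply; rewrite lerD2l.
exists I, m, p; split=> //; last first.
  by move=> F w iF w0 Fw; apply: H => // x y xr yr xy; apply: Fw => //; [exact: lei|exact: led].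
move=> xi al al_N.
have sm k : smooth_c (fun xi => m k * ep (p k) xi) by apply: smooth_cZ; exact: smooth_ep.
rewrite (cpdnB _ (smooth_ft (normr1 _) Sphi) (smooth_c_sum _ sm)) (cpdn_sum _ _ sm).
under eq_bigr do rewrite (cpdnZ _ _ (smooth_ep _)).
rewrite (cpdn_ft xi al (normr1 _) Sphi).
have E : (fun x => phi x * cpdn al (ep (1 *: x)) xi) = fun x => phi x * cpdn al (ep x) xi.
  by apply/funext => x; rewrite scale1r.
have := schwartz_cintg (schwartz_mul_cpdn_ep 1 xi al Sphi); rewrite E => iF.
rewrite [leRHS](_ : _ = (1 + (r0 + 1)) ^+ N * N.+2%:R * d * (1 + enorm xi) * rint (fun x => cabs (phi x))); last by ring.
apply: (H (fun x => cpdn al (ep x) xi)) => //.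
  by rewrite !mulr_ge0 ?exprn_ge0 ?(ltW d0) ?(ltW (enorm1_gt0 _))// !addr_ge0// ltW.
move=> x y xr yr xy; have D := cpdn_ep_dist xi (lei x xr) (led y yr) al_N; apply: (le_trans D).
rewrite ler_wpM2r ?(ltW (enorm1_gt0 _))// ler_wpM2l// mulr_ge0// exprn_ge0// !addr_ge0// ltW//.
Qed.

Lemma temperedZ a u (c : R[i]) : tempered a -> schwartz u -> a (fun x => c * u x) = c * a u.
Proof.
move=> [La _] Su; have S0 := @schwartz0 R n.
have a0 : a (fun=> 0) = 0.
  have := La _ _ 1 S0 S0; rewrite (_ : (fun x : vec => 0 + 1 * 0 : R[i]) = fun=> 0); last first.
    by apply/funext => x; rewrite mulr0 addr0.
  by rewrite mul1r => /eqP; rewrite -subr_eq0 opprD addNKr oppr_eq0 => /eqP.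
have := La _ _ c S0 Su; rewrite a0 add0r => <-.
by congr a; apply/funext => x; rewrite add0r.
Qed.

Lemma temperedD a u v : tempered a -> schwartz u -> schwartz v -> a (fun x => u x + v x) = a u + a v.
Proof.
move=> [La _] Su Sv; have := La _ _ 1 Su Sv; rewrite mul1r => <-.
by congr a; apply/funext => x; rewrite mul1r.
Qed.

Lemma temperedB a u v : tempered a -> schwartz u -> schwartz v -> a (fun x => u x - v x) = a u - a v.
Proof.
move=> [La _] Su Sv; have := La _ _ (-1) Su Sv; rewrite mulN1r => <-.
by congr a; apply/funext => x; rewrite mulN1r.
Qed.

Lemma tempered_sum a (I : Type) (s : seq I) (F : I -> vec -> R[i]) : tempered a ->
  (forall i, schwartz (F i)) -> a (fun x => \sum_(i <- s) F i x) = \sum_(i <- s) a (F i).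
Proof.
move=> Ta SF; elim: s => [|i s IH].
  rewrite big_nil -[RHS](mul0r (a (fun=> 0))) -(temperedZ 0 Ta (@schwartz0 R n)).
  by congr a; apply/funext => x; rewrite big_nil mul0r.
rewrite big_cons -IH -(temperedD Ta (SF i) (schwartz_sum _ SF)).
by congr a; apply/funext => x; rewrite big_cons.
Qed.

Lemma tempered_bound a : tempered a -> exists C N, 0 <= C /\ forall u M, schwartz u -> snb N u M ->
  cabs (a u) <= C * M.
Proof.
move=> [_ [C [N H]]]; exists `|C|, N; split=> // u M Su uM.
apply: le_trans (H u M Su (snb_tempered uM)) _.
by rewrite ler_wpM2r ?(snb_ge0 uM)// ler_norm.
Qed.

Lemma tempered_ft s a : `|s| = 1 -> tempered a -> tempered (fun v => a (ft s v)).
Proof.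
move=> s1 Ta; split.
  move=> u v c Su Sv; have Scv := schwartzZ c Sv.
  rewrite (ftD s (schwartz_cintg Su) (schwartz_cintg Scv)) (ftZ _ _ (schwartz_cintg Sv)).
  have Sfv := schwartz_ft s1 Sv.
  by rewrite (temperedD Ta (schwartz_ft s1 Su) (schwartzZ c Sfv)) (temperedZ c Ta Sfv).
have [C [N [C0 H]]] := tempered_bound Ta; have [N' [C' [C'0 H']]] := @snb_ft R n s N s1.
exists (C * C'), N' => u M Su uM; rewrite -mulrA; apply: H; first exact: schwartz_ft.
by apply: H' => // x al al_N; exact: uM.
Qed.

(** For Schwartz [v] this is the inverse Fourier transform, without its factor [(2 pi)^-n], of the
    distribution [v a]; see [tempered_mul_ft]. *)
Definition char_fun a v : vec -> R[i] := fun x => a (fun xi => ep x xi * v xi).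

Lemma char_fun_lip a v (L : R) : tempered a -> schwartz v -> exists2 K, 0 <= K &
  forall x y, enorm x <= L -> enorm y <= L -> cabs (char_fun a v x - char_fun a v y) <= K * enorm (x - y).
Proof.
move=> Ta Sv; have [C [N [C0 H]]] := tempered_bound Ta.
have [M vM] := schwartz_snb (N + 1) Sv; have M0 := snb_ge0 vM.
have [L0|L0] := ltP L 0.
  by exists 0 => // x y xL; move: (le_lt_trans xL L0); rewrite ltNge enorm_ge0.
exists (C * (4 * 2 ^+ N * ((1 + L) ^+ N * N.+2%:R * M))).
  by rewrite !mulr_ge0 ?exprn_ge0// addr_ge0.
move=> x y xL yL.
have Se z := schwartz_mul (moderate_ep z) Sv.
rewrite /char_fun -(temperedB Ta (Se x) (Se y)).
rewrite (_ : (fun xi => _) = fun xi => (ep x xi - ep y xi) * v xi); last by apply/funext => xi; rewrite mulrBl.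
have sB : smooth_c (fun xi => ep x xi - ep y xi).
  have := smooth_cD (smooth_ep x) (smooth_cZ (-1) (smooth_ep y)).
  by under eq_fun do rewrite mulN1r.
rewrite [leRHS](_ : _ = C * (4 * 2 ^+ N * ((1 + L) ^+ N * N.+2%:R * enorm (x - y) * M))); last by ring.
apply: H.
  rewrite (_ : (fun xi => _) = fun xi => ep x xi * v xi + (-1) * (ep y xi * v xi)).
    by apply: schwartzD; [exact: Se|exact: (schwartzZ (-1) (Se y))].
  by apply/funext => xi; rewrite mulrBl mulN1r.
apply: (snb_mul sB (schwartz_smooth Sv) _ vM) => xi be be_N.
by rewrite (cpdnB _ (smooth_ep x) (smooth_ep y)) expr1; exact: cpdn_ep_dist.
Qed.

Lemma char_fun_cts a v : tempered a -> schwartz v -> ccont (char_fun a v).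
Proof.
move=> Ta Sv; split; apply: locally_lipschitz_continuous => L;
  have [K K0 HK] := char_fun_lip L Ta Sv; exists K => x y xL yL; apply: le_trans (HK x y xL yL).
- by rewrite -Re_opp -Re_add; exact: Re_le_cabs.
- by rewrite -Im_opp -Im_add; exact: Im_le_cabs.
Qed.

Lemma test_cintg_mul phi F : test_fun phi -> ccont F -> cintg (fun x => phi x * F x).
Proof.
move=> Tphi [cR cI]; have Sphi := test_schwartz Tphi; have iphi := schwartz_cintg Sphi.
have [r r0 phi0] := test_support Tphi.
have [A HA] := continuous_bounded_eball r cR; have [B HB] := continuous_bounded_eball r cI.
have iF : rintg (fun x => (`|A| + `|B|) * cabs (phi x)) by exact/rintgZ/cintg_cabs.
apply: (cintg_le (k := fun x => (`|A| + `|B|) * cabs (phi x))) iF.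
  by apply: cmeasM; [exact: cintg_cmeas|exact: ccont_cmeas].
move=> x; rewrite cabsM mulrC; have [xr|xr] := leP (enorm x) r.
  rewrite ler_wpM2r ?cabs_ge0// (le_trans (cabs_le_ReIm _))// lerD//.
    by rewrite (le_trans (HA x xr))// ler_norm.
  by rewrite (le_trans (HB x xr))// ler_norm.
have := phi0 x [::] xr; rewrite cpdn_nil => ->.
by rewrite cabs0 !mulr0.
Qed.

(* A tempered functional commutes with the integral over [x] because the Riemann sums of
   [ft 1 phi] converge in the seminorms once multiplied by [v]. *)
Lemma tempered_mul_ft a v phi : tempered a -> schwartz v -> test_fun phi ->
  a (fun xi => v xi * ft 1 phi xi) = cint (fun x => phi x * char_fun a v x).
Proof.
move=> Ta Sv Tphi; have Sphi := test_schwartz Tphi.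
have [C [N [C0 H]]] := tempered_bound Ta.
have [M vM] := schwartz_snb (N + 1) Sv; have M0 := snb_ge0 vM.
have [r [K [r0 K0 HR]]] := ft_riemann N Tphi.
have [Q Q0 HQ] := char_fun_lip r Ta Sv.
set J := rint (fun x => cabs (phi x)) in HR; have J0 : 0 <= J by apply: rint_ge0 => x; exact: cabs_ge0.
pose B := C * (4 * 2 ^+ N * (K * M)) + Q * J.
have B0 : 0 <= B by rewrite addr_ge0 ?mulr_ge0// exprn_ge0.
have Sf := schwartz_ft (normr1 R) Sphi.
have key d : 0 < d -> d <= 1 ->
    cabs (a (fun xi => v xi * ft 1 phi xi) - cint (fun x => phi x * char_fun a v x)) <= B * d.
  move=> d0 d1; have [I [m [p [m1 E1 E2]]]] := HR d d0 d1.
  have Se k : schwartz (fun xi => m k * (ep (p k) xi * v xi)).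
    exact: (schwartzZ (m k) (schwartz_mul (moderate_ep (p k)) Sv)).
  have Svf : schwartz (fun xi => v xi * ft 1 phi xi) by exact: (schwartz_mul (schwartz_moderate Sv) Sf).
  have e1 : a (fun xi => v xi * ft 1 phi xi) - \sum_k m k * char_fun a v (p k) =
      a (fun xi => (ft 1 phi xi - \sum_k m k * ep (p k) xi) * v xi).
    rewrite (_ : \sum_k m k * char_fun a v (p k) = a (fun xi => \sum_k m k * (ep (p k) xi * v xi))); last first.
      rewrite (tempered_sum _ Ta Se); apply: eq_bigr => k _.
      by rewrite (temperedZ _ Ta (schwartz_mul (moderate_ep (p k)) Sv)).
    rewrite -(temperedB Ta Svf (schwartz_sum _ Se)); congr a; apply/funext => xi.
    by rewrite mulrBl mulrC; congr (_ - _); rewrite mulr_suml; apply: eq_bigr => k _; rewrite mulrA.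
  have sE : smooth_c (fun xi => ft 1 phi xi - \sum_k m k * ep (p k) xi).
    have sS := smooth_c_sum (index_enum I) (fun k => smooth_cZ (m k) (smooth_ep (p k))).
    have := smooth_cD (schwartz_smooth Sf) (smooth_cZ (-1) sS).
    by under eq_fun do rewrite mulN1r.
  have SE : schwartz (fun xi => (ft 1 phi xi - \sum_k m k * ep (p k) xi) * v xi).
    rewrite (_ : (fun xi => _) = fun xi => v xi * ft 1 phi xi + (-1) * \sum_k m k * (ep (p k) xi * v xi)).
      by apply: schwartzD; [exact: Svf|exact: (schwartzZ (-1) (schwartz_sum _ Se))].
    apply/funext => xi; rewrite mulrBl mulN1r mulrC; congr (_ - _).
    by rewrite mulr_suml; apply: eq_bigr => k _; rewrite mulrA.
  rewrite -[X in cabs X](subrKA (\sum_k m k * char_fun a v (p k))).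
  apply: le_trans (cabsD _ _) _; rewrite mulrDl; apply: lerD.
    rewrite e1 (_ : _ * d = C * (4 * 2 ^+ N * (K * d * M))); last by ring.
    exact: H _ _ SE (snb_mul sE (schwartz_smooth Sv) E1 vM).
  rewrite cabs_distC mulrAC; apply: E2; [|by rewrite mulr_ge0// ltW|].
    exact: (test_cintg_mul Tphi (char_fun_cts Ta Sv)).
  by move=> x y xr yr xy; apply: le_trans (HQ x y xr yr) _; rewrite ler_wpM2l.
apply/eqP; rewrite -subr_eq0; apply/eqP/cabs_eq0/eqP; rewrite eq_le cabs_ge0 andbT.
apply/ler_addgt0Pr => e e0; rewrite add0r.
have B1 : 0 < B + 1 by rewrite ltr_wpDl.
pose t := Num.min 1 (e / (B + 1)).
have t0 : 0 < t by rewrite lt_min ltr01 divr_gt0.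
apply: le_trans (key t t0 _) _; first by rewrite ge_min lexx.
apply: (@le_trans _ _ ((B + 1) * t)); first by rewrite ler_wpM2r ?lerDl// ltW.
by rewrite mulrC -ler_pdivlMr// ge_min lexx orbT.
Qed.

End tempered_functionals.

(** * Dilated cutoff functions *)

Section dilated_cutoffs.
Context {R : realType} {n : nat}.
Notation vec := 'rV[R]_n.+1.
Implicit Types (u v w F : vec -> R[i]) (g : vec -> R) (c r d : R) (x y z : vec).

Lemma pdn_zero_in g (A : R) al : (forall x, enorm x < A -> g x = 0) ->
  forall x, enorm x < A -> pdn al g x = 0.
Proof.
move=> g0; elim: al => [//|i al IHal] y yA /=.
have nz : \near y, cst 0 y = pdn al g y.
  have oU : open [set z : vec | enorm z < A].
    rewrite (_ : [set z | _] = (fun z => enorm z) @^-1` `]-oo, A[).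
      by apply: open_comp => [z _|]; [exact: continuous_enorm|exact: interval_open].
    by apply/seteqP; split => z /=; rewrite in_itv.
  have : nbhs y [set z : vec | enorm z < A] by exact: open_nbhs_nbhs.
  by apply: filterS => z zA; rewrite IHal.
have [_ H] := near_eq_is_derive nz (is_derive_cst (0 : R) y 'e_i); exact: H.
Qed.

Lemma cts_scale c g : continuous g -> continuous (fun x => g (c *: x)).
Proof.
move=> cg x; apply: (@continuous_comp vec vec R (fun x => c *: x) g x); last exact: cg.
exact: scaler_continuous.
Qed.

Lemma is_derive_scale c g i x : smooth_r g ->
  is_derive x 'e_i (fun x => g (c *: x)) (c * pd i g (c *: x)).
Proof.
move=> sg; pose L (s : R) := g (s *: 'e_i + c *: x).
have d1 : is_derive (c * 0) 1 L (pd i g ((c * 0) *: 'e_i + c *: x)) := is_derive_line i (c *: x) (c * 0) sg.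
have d2 : is_derive (0 : R) 1 (fun t : R => c * t) c.
  have := @is_deriveZ R R R (id : R -> R) c 0 1 1 (is_derive_id (0 : R) 1).
  by rewrite [c *: 1]mulr1.
have := is_derive1_comp d1 d2; rewrite mulr0 scale0r add0r mulrC => -[h1 h2].
have E : (fun h : R => h^-1 *: (((L \o (fun t => c * t)) \o shift 0) (h *: 1) - (L \o (fun t => c * t)) 0)) =
    (fun h : R => h^-1 *: (((fun x => g (c *: x)) \o shift x) (h *: 'e_i) - g (c *: x))).
  apply/funext => h; rewrite /L /= mulr0 scale0r add0r addr0 [h *: 1]mulr1.
  by rewrite [c *: (_ + _)]scalerDr scalerA.
by apply: DeriveDef; move: h1 h2; rewrite /derivable /derive E.
Qed.

Lemma smooth_scale c g : smooth_r g -> smooth_r (fun x => g (c *: x)).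
Proof.
move=> sg; apply/smooth_Ck => k; elim: k g sg => [|k IH] g sg.
  by split => //; exact: cts_scale (smooth_cts sg).
apply: (Ck_S (g' := fun i x => c * pd i g (c *: x))) => [|i x|i].
- exact: cts_scale (smooth_cts sg).
- exact: is_derive_scale.
- by apply: CkM; [exact: Ck_cst|exact: (IH _ (smooth_pd i sg))].
Qed.

Lemma pdn_scale c g al : smooth_r g ->
  pdn al (fun x => g (c *: x)) = fun x => c ^+ size al * pdn al g (c *: x).
Proof.
elim/last_ind: al g => [|al i IH] g sg; first by apply/funext => x; rewrite mul1r.
have sgi := smooth_pd i sg.
rewrite pdn_rcons (is_derive_pd (g' := fun i x => c * pd i g (c *: x)) (fun x => is_derive_scale c i x sg)).
rewrite (pdnZ _ _ (smooth_scale c sgi)) (IH _ sgi) size_rcons.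
by apply/funext => x; rewrite exprS pdn_rcons mulrA.
Qed.

(** A step in the variable [|x|^2], which keeps it smooth at the origin. The plateau ends at
    [(1 + sg) / 2], strictly beyond 1: the collar between the two radii is what [dcut_deviation]
    lives on. *)
Lemma radial_cutoff (sg : R) : 1 < sg -> exists U : vec -> R, [/\ smooth_r U,
  forall x, 0 <= U x <= 1, forall x, enorm x < (1 + sg) / 2 -> U x = 1 &
  forall x, sg <= enorm x -> U x = 0].
Proof.
move=> s1; set al := (1 + sg) / 2; have al0 : 0 < al by rewrite divr_gt0//; lra.
have D0 : 0 < sg ^+ 2 - al ^+ 2.
  by rewrite subr_gt0 ltrXn2r ?nnegrE ?(ltW al0)//; rewrite /al; lra.
exists (fun x => smooth_step ((sg ^+ 2 - al ^+ 2)^-1 * (sg ^+ 2 - enorm x ^+ 2))); split.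
- apply: smooth_comp; first by move=> k; exact: C1_smooth_step.
  by apply: smoothZ; apply: smoothB; [exact: smooth_cst|exact: smooth_enorm2].
- by move=> x; rewrite smooth_step_ge0 smooth_step_le1.
- move=> x xa; apply: smooth_step_ge1; rewrite ler_pdivlMl// mulr1 lerB//.
  by rewrite lerXn2r ?nnegrE ?enorm_ge0 ?(ltW al0)// ltW.
- move=> x xs; apply: smooth_step_le0; rewrite pmulr_rle0 ?invr_gt0// subr_le0.
  by rewrite lerXn2r ?nnegrE ?enorm_ge0//; lra.
Qed.

Section cutoff_family.
Context (U : vec -> R) (sg : R) (sg1 : 1 < sg) (sU : smooth_r U) (U01 : forall x, 0 <= U x <= 1)
  (U1 : forall x, enorm x < (1 + sg) / 2 -> U x = 1) (U0 : forall x, sg <= enorm x -> U x = 0).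

Definition dcut y r : vec -> R[i] := fun z => (U (r^-1 *: (z + (- y))))%:C.

Lemma smooth_dcut y r : smooth_c (dcut y r).
Proof. exact: (smooth_c_real (smooth_shift (- y) (smooth_scale r^-1 sU))). Qed.

Lemma test_dcut y r : 0 < r -> test_fun (dcut y r).
Proof.
move=> r0; split; first exact: smooth_dcut.
exists (sg * r + enorm y) => x xr; rewrite /dcut U0//.
rewrite /enorm dotpZl dotpZr mulrA -expr2 sqrtrM ?sqr_ge0// sqrtr_sqr -/(enorm _).
rewrite gtr0_norm ?invr_gt0// ler_pdivlMl// mulrC.
by have := enormD (x - y) y; rewrite subrK; lra.
Qed.

Lemma cabs_dcut_le y r z : 0 < r -> cabs (dcut y r z) <= \1_(eball y (sg * r)) z.
Proof.
move=> r0; rewrite /dcut cabs_real indicE; have /andP[h0 h1] := U01 (r^-1 *: (z + - y)).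
case: (boolP (z \in _)) => [_|]; first by rewrite ger0_norm.
rewrite notin_setE /eball /= => /negP; rewrite -leNgt => zs.
rewrite U0 ?normr0//.
rewrite /enorm dotpZl dotpZr mulrA -expr2 sqrtrM ?sqr_ge0// sqrtr_sqr -/(enorm _).
by rewrite gtr0_norm ?invr_gt0// ler_pdivlMl// mulrC.
Qed.

Lemma dcut_one y r z : 0 < r -> eball y r z -> dcut y r z = 1.
Proof.
move=> r0 zr; rewrite /dcut U1 ?rmorph1//.
rewrite /enorm dotpZl dotpZr mulrA -expr2 sqrtrM ?sqr_ge0// sqrtr_sqr -/(enorm _).
rewrite gtr0_norm ?invr_gt0// ltr_pdivrMl//; apply: (lt_trans zr).
by rewrite ltr_pMr//; move: sg1; lra.
Qed.

(** If [|x - y| < r], the dilated point leaves the plateau only when [|z| >= (sg - 1) r / 2], and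
    there [1 <= 2 (1 + |z|) / ((sg - 1) r)]. Differentiation only adds factors [1 / r <= 1]. The
    constant is independent of [x], [y] and [r]. *)
Lemma dcut_deviation N : exists2 K, 0 <= K & forall r x y z be, 1 <= r -> enorm (x - y) < r ->
  (size be <= N)%N -> cabs (cpdn be (fun z => dcut y r (z + x) - 1) z) <= K / r * (1 + enorm z) ^+ 1.
Proof.
have [M UM] : exists M : R, forall z be, (size be <= N)%N -> `|pdn be U z| <= M.
  have TU : test_fun (fun x => (U x)%:C).
    by split; [exact: smooth_c_real|exists sg => x /ltW /U0 ->].
  have [M HM] := schwartz_snb N (test_schwartz TU); exists M => z be be_N.
  apply: le_trans (HM z be be_N); rewrite cpdnE; apply: (@le_trans _ _ (1 * `|pdn be U z|)); first by rewrite mul1r.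
  apply: ler_pM => //; first exact: exprn_ege1 (enorm1_ge1 z).
  exact: (Re_le_cabs (Complex _ _)).
have M0 : 0 <= M by apply: le_trans (UM 0 [::] isT); exact: normr_ge0.
have s10 : 0 < sg - 1 by rewrite subr_gt0.
pose V x := U x - 1; have sV : smooth_r V by apply: smoothB; [exact: sU|exact: smooth_cst].
have V0 x : enorm x < (1 + sg) / 2 -> V x = 0 by move=> /U1; rewrite /V => ->; rewrite subrr.
have VM z be : (size be <= N)%N -> `|pdn be V z| <= M + 1.
  move=> be_N; rewrite /V (pdnD _ sU (smooth_cst (-1))) pdn_cst (le_trans (ler_normD _ _))// lerD// ?UM//.
  by case: (be) => [|? ?]; rewrite ?normr0// normrN1.
have M10 : 0 <= M + 1 by rewrite addr_ge0.
have K0 : 0 <= 2 * (M + 1) / (sg - 1) by rewrite divr_ge0 ?mulr_ge0// ltW.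
exists (2 * (M + 1) / (sg - 1)) => //.
move=> r x y z be r1 xy be_N; have r0 : 0 < r by exact: lt_le_trans r1.
have E : (fun z => dcut y r (z + x) - 1) = fun z => (V (r^-1 *: (z + (x - y))))%:C.
  by apply/funext => p; rewrite /dcut /V rmorphB /= addrA.
rewrite E cpdnE (_ : imparts _ = fun=> 0)// pdn_cst (_ : (if be is [::] then _ else _) = 0); last by case: (be).
rewrite (_ : reparts _ = fun z => V (r^-1 *: (z + (x - y))))//.
rewrite (pdn_shift (g := fun p => V (r^-1 *: p)) (x - y) be (smooth_scale _ sV)) (pdn_scale _ _ sV).
set p := r^-1 *: _; rewrite -/((r^-1 ^+ size be * pdn be V p)%:C) cabs_real normrM.
have [pA|pA] := ltP (enorm p) ((1 + sg) / 2).
  by rewrite (pdn_zero_in be V0 pA) normr0 mulr0 mulr_ge0 ?exprn_ge0 ?(ltW (enorm1_gt0 z))// divr_ge0 ?(ltW r0).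
apply: (@le_trans _ _ (1 * (M + 1))).
  apply: ler_pM => //; last exact: VM.
  by rewrite normrX ger0_norm ?invr_ge0 ?(ltW r0)// exprn_ile1 ?invr_ge0 ?(ltW r0)// invf_le1.
rewrite mul1r expr1 (_ : _ * (1 + enorm z) = (M + 1) * (2 * (1 + enorm z) / (r * (sg - 1)))); last first.
  by field; rewrite !gt_eqF.
rewrite ler_peMr ?addr_ge0// ler_pdivlMr ?mulr_gt0// mul1r.
move: pA; rewrite /p /enorm dotpZl dotpZr mulrA -expr2 sqrtrM ?sqr_ge0// sqrtr_sqr -!/(enorm _).
rewrite gtr0_norm ?invr_gt0// ler_pdivlMl// => pA.
by have := enormD z (x - y); move: (enorm (z + _)) (enorm z) (enorm (x - y)) pA xy => A B C; nra.
Qed.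

End cutoff_family.

Lemma ft_shift s u x xi : schwartz u ->
  ft s (fun z => u (z + x)) xi = ep ((- s) *: x) xi * ft s u xi.
Proof.
move=> Su; have Iw := cintg_ep s xi (schwartz_cintg (schwartz_shift x Su)).
rewrite /ft -(cint_translation (- x) (cintg_cmeas Iw)) -cintZ; last exact: (cintg_ep s xi (schwartz_cintg Su)).
congr cint; apply/funext => z; rewrite subrK dotpDl dotpNl [s * (_ + _)]mulrDr expiD.
have -> : expi (s * - dotp x xi) = ep ((- s) *: x) xi by rewrite /ep dotpZr (dotpC xi) mulrN mulNr.
by ring.
Qed.

End dilated_cutoffs.

(** * The pointwise bound on balls *)

Section pointwise_bound.
Context {R : realType} {n : nat}.
Notation vec := 'rV[R]_n.+1.
Implicit Types (u v w F : vec -> R[i]) (r d : R) (x y z : vec) (a : (vec -> R[i]) -> R[i]).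

Let c0 : R[i] := ((2 * pi) ^- n.+1)%:C.

Lemma c0_mul : c0 * ((2 * pi) ^+ n.+1)%:C = 1.
Proof.
rewrite /c0 -rmorphM /= mulVf ?rmorph1// expf_neq0// mulf_neq0// gt_eqF//; exact: pi_gt0.
Qed.

(** The continuous function that represents [F^-1 a F u], as [mult_fun_dist] shows. *)
Definition mult_fun a u : vec -> R[i] := fun x => c0 * char_fun a (ft (-1) u) x.

Lemma normrN1R : `|-1| = 1 :> R. Proof. by rewrite normrN normr1. Qed.

Lemma mult_fun_cts a u : tempered a -> schwartz u -> ccont (mult_fun a u).
Proof.
move=> Ta Su; have [cR cI] := char_fun_cts Ta (schwartz_ft normrN1R Su).
split; rewrite /mult_fun.
  under eq_fun do rewrite Re_mul.
  by apply: ctsB; apply: ctsM => //; exact: cts_cst.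
under eq_fun do rewrite Im_mul.
by apply: ctsD; apply: ctsM => //; exact: cts_cst.
Qed.

Lemma mult_fun_dist a u : tempered a -> schwartz u -> dist_is_fun (multiplier_op a u) (mult_fun a u).
Proof.
move=> Ta Su; have cg := mult_fun_cts Ta Su; split; first exact: (cmeas_lmeas (ccont_cmeas cg)).
move=> phi Tphi; have Su' := schwartz_ft normrN1R Su.
have E : (fun x => mult_fun a u x * phi x) = fun x => phi x * mult_fun a u x.
  by apply/funext => x; rewrite mulrC.
rewrite E; split; first exact: (cintg_cintegrable (test_cintg_mul Tphi cg)).
rewrite /multiplier_op fourier_ft ifourier_ft -/c0.
have Sp := schwartz_mul (schwartz_moderate Su') (schwartz_ft (normr1 R) (test_schwartz Tphi)).
rewrite [RHS](_ : _ = a (fun xi => c0 * (ft (-1) u xi * ft 1 phi xi))); last first.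
  by congr a; apply/funext => xi; rewrite mulrCA.
rewrite (temperedZ c0 Ta Sp) (tempered_mul_ft Ta Su' Tphi) -cintZ; last exact: (test_cintg_mul Tphi (char_fun_cts Ta Su')).
by congr cint; apply/funext => x; rewrite mulrCA.
Qed.

Lemma mult_fun_shift a u x : schwartz u ->
  mult_fun a u x = c0 * a (ft (-1) (fun z => u (z + x))).
Proof.
move=> Su; congr (_ * a _); apply/funext => xi.
by rewrite (ft_shift (-1) x xi Su) opprK scale1r.
Qed.

(** The splitting is [th = th wx - (wx - 1) th], and in [th wx] the transform of [psi] is replaced
    by an exponential sum plus the remainder [E]. The term with [wx - 1] is small by the size of
    [r], the term with [E] by the mesh. Only [r1] has to be uniform in [y]; [I], [m] and [v] are
    chosen after [r] and [y]. *)
Lemma pointwise_bound a psi (sg e : R) : tempered a -> test_fun psi -> 1 < sg -> 0 < e ->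
  exists2 r1 : R, 1 <= r1 & forall r, r1 <= r -> forall y,
  exists (I : finType) (m : I -> R[i]) (v : I -> vec -> R[i]),
  [/\ \sum_k cabs (m k) <= rint (fun x => cabs (psi x)),
      forall k, [/\ schwartz (v k), forall x, eball y r x -> cabs (v k x) = 1 & forall x, cabs (v k x) <= \1_(eball y (sg * r)) x] &
      forall x, eball y r x -> cabs (a psi) <= \sum_k cabs (m k) * cabs (mult_fun a (v k) x) + e].
Proof.
move=> Ta Tpsi sg1 e0; have Spsi := test_schwartz Tpsi.
have Tb := tempered_ft normrN1R Ta; set b := (fun v => a (ft (-1) v)) in Tb.
have [C [N [C_0 bC]]] := tempered_bound Tb.
have Sf := schwartz_ft (normr1 R) Spsi.
pose th : vec -> R[i] := fun z => c0 * ft 1 psi z.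
have Sth : schwartz th := schwartzZ c0 Sf.
have bth : b th = a psi.
  rewrite /b /th (ftZ _ _ (schwartz_cintg Sf)); congr a; apply/funext => x.
  by rewrite (ft_inversion x (normr1 R) Spsi) mulrA c0_mul mul1r.
have [U [sU U01 U1 U0]] := @radial_cutoff R n sg sg1.
have [K K0 HK] := dcut_deviation sg1 sU U1 U0 N.
have [Mt thM] := schwartz_snb (N + 1) Sth; have Mt0 := snb_ge0 thM.
have [rr [Kp [_ Kp0 HR]]] := ft_riemann N Tpsi.
pose A := C * (4 * 2 ^+ N * (K * Mt)).
have A0 : 0 <= A by rewrite !mulr_ge0// exprn_ge0.
(* From here on [A / r <= e / 2], which disposes of the term with [wx - 1]. *)
exists (Num.max 1 (A / (e / 2))); first by rewrite le_max lexx.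
move=> r; rewrite ge_max => /andP[r1 rA] y; have r0 : 0 < r by exact: lt_le_trans r1.
have Tw := test_dcut sU U0 y r0; have Sw := test_schwartz Tw; have sw := schwartz_smooth Sw.
set w := dcut U y r in Tw Sw sw.
have [Mw wM] := schwartz_snb (N + 1) Sw; have Mw0 := snb_ge0 wM.
(* A seminorm bound for all translates [w (. + x)] with [x] in the ball, where [|x| <= |y| + r]. It
   depends on [y], and therefore the mesh [d] is fixed only afterwards. *)
pose M' := (1 + (enorm y + r)) ^+ (N + 1) * Mw.
have L0 : 0 <= 1 + (enorm y + r) by rewrite !addr_ge0 ?enorm_ge0// ltW.
have M'0 : 0 <= M' by rewrite mulr_ge0// exprn_ge0.
pose B := cabs c0 * (C * (4 * 2 ^+ N * (Kp * M'))).
have B0 : 0 <= B by rewrite !mulr_ge0 ?cabs_ge0// exprn_ge0.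
have B1 : 0 < B + 1 by rewrite ltr_wpDl.
pose d := Num.min 1 (e / 2 / (B + 1)).
have d0 : 0 < d by rewrite lt_min ltr01 !divr_gt0.
have d1 : d <= 1 by rewrite ge_min lexx.
have Bd : B * d <= e / 2.
  apply: (@le_trans _ _ ((B + 1) * d)); first by rewrite ler_wpM2r ?lerDl// ltW.
  by rewrite mulrC -ler_pdivlMr// ge_min lexx orbT.
have [I [m [p [m1 E1 _]]]] := HR d d0 d1.
pose v k : vec -> R[i] := fun z => ep (p k) z * w z.
have Sv k : schwartz (v k) := schwartz_mul (moderate_ep (p k)) Sw.
exists I, m, v; split => //.
  move=> k; split; first exact: Sv.
    by move=> x xy; rewrite /v /w (dcut_one sg1 U1 r0 xy) mulr1 cabs_ep.
  by move=> x; rewrite /v cabsM cabs_ep mul1r; exact: cabs_dcut_le.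
move=> x xB; have xy : enorm (x - y) < r := xB.
pose wx z := w (z + x); have Swx : schwartz wx := schwartz_shift x Sw.
have swx := schwartz_smooth Swx.
have wxM : snb (N + 1) wx M'.
  apply: snb_le (leqnn _) _ (snb_shift x sw wM); rewrite ler_wpM2r//.
  rewrite lerXn2r ?nnegrE ?(ltW (enorm1_gt0 _))// lerD2l -[x](subrKC y).
  by apply: le_trans (enormD _ _) _; rewrite lerD2l ltW.
pose D z := wx z - 1; have sD : smooth_c D.
  by have := smooth_cD swx (smooth_c_cst (-1)).
have Dle z be : (size be <= N)%N -> cabs (cpdn be D z) <= K / r * (1 + enorm z) ^+ 1.
  by move=> be_N; exact: HK.
pose E xi := ft 1 psi xi - \sum_k m k * ep (p k) xi.
have sS : smooth_c (fun xi => \sum_k m k * ep (p k) xi).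
  exact: (smooth_c_sum (index_enum I) (fun k => smooth_cZ (m k) (smooth_ep (p k)))).
have sE : smooth_c E.
  have := smooth_cD (schwartz_smooth Sf) (smooth_cZ (-1) sS).
  by under eq_fun do rewrite mulN1r.
have Sep k : schwartz (fun z => ep (p k) z * wx z) := schwartz_mul (moderate_ep (p k)) Swx.
have Smep k : schwartz (fun z => m k * (ep (p k) z * wx z)) := schwartzZ (m k) (Sep k).
have SDth : schwartz (fun z => D z * th z).
  rewrite (_ : (fun z => _) = fun z => wx z * th z + (-1) * th z); last first.
    by apply/funext => z; rewrite /D mulrBl mul1r mulN1r.
  by apply: schwartzD; [exact: (schwartz_mul (schwartz_moderate Swx) Sth)|exact: schwartzZ].
have SEw : schwartz (fun z => E z * wx z).
  rewrite (_ : (fun z => _) = fun z => ft 1 psi z * wx z + (-1) * \sum_k m k * (ep (p k) z * wx z)).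
    apply: schwartzD; first exact: (schwartz_mul (schwartz_moderate Sf) Swx).
    exact: (schwartzZ (-1) (schwartz_sum _ Smep)).
  apply/funext => z; rewrite /E mulrBl mulN1r; congr (_ - _).
  by rewrite mulr_suml; apply: eq_bigr => k _; rewrite mulrA.
have Sthw : schwartz (fun z => th z * wx z) := schwartz_mul (schwartz_moderate Sth) Swx.
(* Translating an exponential by [x] multiplies it by the unimodular constant [ep (p k) x], which
   the modulus does not see. *)
have gE k : cabs (mult_fun a (v k) x) = cabs (c0 * b (fun z => ep (p k) z * wx z)).
  rewrite (mult_fun_shift _ _ (Sv k)) (_ : (fun z => v k (z + x)) = fun z => ep (p k) x * (ep (p k) z * wx z)); last first.
    by apply/funext => z; rewrite /v /wx /ep dotpDl expiD; ring.
  rewrite -/(b _) (temperedZ _ Tb (Sep k)) mulrCA [LHS]cabsM cabs_ep mul1r.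
  by [].
have e1 : a psi = b (fun z => th z * wx z) - b (fun z => D z * th z).
  rewrite -(temperedB Tb Sthw SDth) -bth; congr b; apply/funext => z.
  by rewrite /D mulrBl mul1r [wx z * _]mulrC opprB addrC subrK.
have e2 : b (fun z => th z * wx z) = c0 * b (fun z => E z * wx z) + \sum_k m k * (c0 * b (fun z => ep (p k) z * wx z)).
  rewrite (_ : \sum_k _ = c0 * b (fun z => \sum_k m k * (ep (p k) z * wx z))); last first.
    rewrite (tempered_sum _ Tb Smep) mulr_sumr; apply: eq_bigr => k _.
    by rewrite (temperedZ _ Tb (Sep k)) mulrCA.
  rewrite -mulrDr -(temperedD Tb SEw (schwartz_sum _ Smep)) -(temperedZ c0 Tb); last first.
    by apply: schwartzD; [exact: SEw|exact: (schwartz_sum _ Smep)].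
  congr b; apply/funext => z; rewrite /th -mulrA; congr (_ * _).
  have -> : \sum_k m k * (ep (p k) z * wx z) = (\sum_k m k * ep (p k) z) * wx z.
    by rewrite mulr_suml; apply: eq_bigr => k _; rewrite mulrA.
  by rewrite /E -mulrDl subrK.
rewrite e1 e2; apply: le_trans (cabsB _ _) _.
have h1 : cabs (b (fun z => D z * th z)) <= e / 2.
  apply: le_trans (bC _ _ SDth (snb_mul sD (schwartz_smooth Sth) Dle thM)) _.
  rewrite (_ : C * _ = A / r); last by rewrite /A; field; rewrite gt_eqF.
  by rewrite ler_pdivrMr// mulrC -ler_pdivrMr// divr_gt0.
have h2 : cabs (c0 * b (fun z => E z * wx z)) <= e / 2.
  apply: le_trans Bd; rewrite cabsM.
  apply: le_trans (ler_wpM2l (cabs_ge0 c0) (bC _ _ SEw (snb_mul sE swx E1 wxM))) _.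
  by rewrite le_eqVlt; apply/orP; left; apply/eqP; rewrite /B; ring.
have h3 : cabs (\sum_k m k * (c0 * b (fun z => ep (p k) z * wx z))) <= \sum_k cabs (m k) * cabs (mult_fun a (v k) x).
  by apply: le_trans (cabs_sum _ _) _; apply: ler_sum => k _; rewrite cabsM gE.
apply: le_trans (lerD (le_trans (cabsD _ _) (lerD h2 h3)) h1) _.
by rewrite [e / 2 + _]addrC -addrA lerD2l -splitr.
Qed.

End pointwise_bound.

(** * Banach function norms, weak doubling and the L^1 bound *)

Section banach_function_norms.
Context {R : realType} {n : nat}.
Notation vec := 'rV[R]_n.+1.
Local Notation RnT := (Rn (R:=R) (n:=n.+1)).
Implicit Types (u v : vec -> R[i]) (r d : R) (x y z : vec) (a : (vec -> R[i]) -> R[i]).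

Lemma Mplus_borel (f : vec -> R) : measurable_fun setT (f : RnT -> R) -> (forall x, 0 <= f x) ->
  Mplus (fun x => (f x)%:E).
Proof.
move=> mf f0; split; last by move=> x; rewrite lee_fin.
by move=> c; have := borel_lmeas_rfun mf c; congr (lebesgue_measurable_set _).
Qed.

Lemma Mplus_ebs u : cmeas u -> Mplus (ebs u).
Proof. by move=> mu; apply: Mplus_borel; [exact: cmeas_cabs|move=> x; exact: cabs_ge0]. Qed.

Lemma Mplus_chi_ball y r : Mplus (chi (eball y r)).
Proof.
by apply: Mplus_borel => [|x]; [apply: measurable_indic; exact: measurable_eball|rewrite indicE].
Qed.

Context (rho : (vec -> \bar R) -> \bar R) (bfn : banach_function_norm rho).

Lemma aeT (P : vec -> Prop) : (forall x, P x) -> ae P.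
Proof. by move=> HP; exists set0; split; [exact: lebesgue_outer0|]. Qed.

(** [rho] takes values in all of the extended reals, so nonnegativity is deduced by comparing with
    [rho 0 = 0]. *)
Lemma bfn_ge0 f : Mplus f -> (0 <= rho f)%E.
Proof.
have [A1 [_ [_ [A2 _]]]] := bfn; move=> Mf.
have M0 : Mplus (fun _ : vec => 0%E).
  by have := @Mplus_borel (fun=> 0) (measurable_cst _) (fun=> lexx 0).
have <- : rho (fun=> 0%E) = 0%E by apply/(A1 _ M0); exact: aeT.
by apply: A2 => //; apply: aeT => x; exact: Mf.2.
Qed.

Lemma bfn_le f g : Mplus f -> Mplus g -> (forall x, (f x <= g x)%E) -> (rho f <= rho g)%E.
Proof. by have [_ [_ [_ [A2 _]]]] := bfn; move=> Mf Mg fg; apply: A2 => //; exact: aeT. Qed.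

Lemma bfn_sum (I : Type) (s : seq I) (c : I -> R) (f : I -> vec -> R) :
  (forall k, 0 <= c k) -> (forall k, measurable_fun setT (f k : RnT -> R)) -> (forall k x, 0 <= f k x) ->
  (rho (fun x => (\sum_(k <- s) c k * f k x)%:E) <= \sum_(k <- s) (c k)%:E * rho (fun x => (f k x)%:E))%E.
Proof.
have [A1 [A1b [A1c _]]] := bfn; move=> c0 mf f0.
have Mf k : Mplus (fun x => (f k x)%:E) by exact: Mplus_borel.
have Mcf k : Mplus (fun x => (c k * f k x)%:E).
  by apply: Mplus_borel => [|x]; [exact: measurable_funM|rewrite mulr_ge0].
elim: s => [|k s IH].
  rewrite big_nil; under eq_fun do rewrite big_nil.
  have M0 : Mplus (fun _ : vec => 0%E).
    by have := @Mplus_borel (fun=> 0) (measurable_cst _) (fun=> lexx 0).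
  by rewrite (_ : rho _ = 0%E)//; apply/(A1 _ M0); exact: aeT.
have Ms : Mplus (fun x => (\sum_(k <- s) c k * f k x)%:E).
  apply: Mplus_borel => [|x]; last by apply: sumr_ge0 => j _; rewrite mulr_ge0.
  by apply: measurable_sum => j; exact: measurable_funM.
rewrite big_cons; under eq_fun do rewrite big_cons EFinD.
apply: le_trans (A1c _ _ (Mcf k) Ms) _; apply: leeD => //.
by rewrite -(A1b _ _ (Mf k) (c0 k)); under eq_fun do rewrite EFinM.
Qed.

Definition ballnorm y r : R := fine (rho (chi (eball y r))).

Lemma bfn_ball_fin y r : (rho (chi (eball y r)) < +oo)%E.
Proof.
have [_ [_ [_ [_ [_ [A4 _]]]]]] := bfn.
by apply: A4; [exact: borel_lebesgue (measurable_eball y r)|exact: lebesgue_outer_eball].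
Qed.

Lemma ballnormE y r : rho (chi (eball y r)) = (ballnorm y r)%:E.
Proof. by rewrite fineK// ge0_fin_numE ?bfn_ball_fin// bfn_ge0//; exact: Mplus_chi_ball. Qed.

Lemma ballnorm_gt0 y r : 0 < r -> 0 < ballnorm y r.
Proof.
move=> r0; rewrite -lte_fin -ballnormE lt_def bfn_ge0 ?andbT; last exact: Mplus_chi_ball.
apply/eqP => /bfn.1; case; first exact: Mplus_chi_ball.
move=> N [N0 NP]; have := lebesgue_outer_eball_gt0 y r0; rewrite -N0 ltNge => /negP; apply.
apply: le_lebesgue_outer => x xB; apply: contrapT => /NP.
by rewrite /chi indicE mem_set// => -[] /eqP; rewrite oner_eq0.
Qed.

Lemma mult_norm_le a u : tempered a -> schwartz u -> (exists x, u x != 0) -> (rho (ebs u) < +oo)%E ->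
  0 < fine (rho (ebs u)) -> (mult_norm rho a < +oo)%E ->
  (0 <= mult_norm rho a)%E /\
  (rho (ebs (mult_fun a u)) <= (fine (mult_norm rho a) * fine (rho (ebs u)))%:E)%E.
Proof.
move=> Ta Su u0 ufin t0 afin; set t := fine _ in t0 *.
have Mg := Mplus_ebs (ccont_cmeas (mult_fun_cts Ta Su)).
have q0 : (0 <= rho (ebs (mult_fun a u)) * (t^-1)%:E)%E.
  by rewrite mule_ge0 ?bfn_ge0// lee_fin invr_ge0 ltW.
have qM : (rho (ebs (mult_fun a u)) * (t^-1)%:E <= mult_norm rho a)%E.
  apply: ereal_sup_ubound; exists u, (mult_fun a u); split => //.
  exact: mult_fun_dist.
have M0 := le_trans q0 qM.
have ME : (fine (mult_norm rho a))%:E = mult_norm rho a by rewrite fineK// ge0_fin_numE.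
split => //.
by rewrite EFinM ME -lee_pdivrMr.
Qed.

(* Otherwise the ball norms would grow by more than [1 + d] at each of [m] dilations by the
   [m]-th root of [tau], which contradicts weak doubling for large [m]. *)
Lemma doubling_near1 d : weak_doubling rho -> 0 < d -> exists2 sg : R, 1 < sg &
  forall r0, exists r y, r0 <= r /\ ballnorm y (sg * r) <= (1 + d) * ballnorm y r.
Proof.
move=> [tau [tau1]]; set S := ereal_sup _ => Sfin d0.
have [C SC] : exists C : R, (S < C%:E)%E.
  move: Sfin; case: S => [s _|//|_]; last by exists 0; exact: ltNye.
  by exists (s + 1); rewrite lte_fin ltrDl.
have HC r0 : exists r y, [/\ r0 <= r, 0 < r & ballnorm y (tau * r) < C * ballnorm y r].
  (* Radii below 1 are excluded, so that the ball norms are positive and the quotient can be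
     cleared. *)
  have : (ereal_inf [set ratio_inf rho tau r | r in [set r | (Num.max 1 r0 <= r)%R]] < C%:E)%E.
    by apply: le_lt_trans SC; apply: ereal_sup_ubound; exists (Num.max 1 r0).
  move=> /ereal_inf_lt[_ [r /= rr <-]] /ereal_inf_lt[_ [y _ <-]].
  move: rr; rewrite ge_max => /andP[r1 rr]; have r0' : 0 < r by exact: lt_le_trans r1.
  rewrite !ballnormE /= -EFinM lte_fin ltr_pdivrMr ?ballnorm_gt0// => H.
  by exists r, y.
pose m := (Num.bound (`|C| / d)).+1.
(* Bernoulli's inequality, as [m > |C| / d]. *)
have Cm : C <= (1 + d) ^+ m.
  have bern k : 1 + k%:R * d <= (1 + d) ^+ k.
    elim: k => [|k IH]; first by rewrite mul0r addr0.
    rewrite exprS; apply: le_trans (ler_wpM2l _ IH); last by rewrite addr_ge0// ltW.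
    have : 0 <= k%:R * d * d by rewrite !mulr_ge0// ltW.
    by rewrite -natr1; move: (k%:R : R) => q; nra.
  apply: le_trans (bern m); have : `|C| / d < (Num.bound (`|C| / d))%:R.
    by apply: archi_boundP; rewrite divr_ge0// ltW.
  rewrite ltr_pdivrMr// /m -natr1; have := ler_norm C; move: (_%:R : R) => q.
  by nra.
have m0 : m%:R != 0 :> R by rewrite pnatr_eq0.
have m1 : 0 < m%:R :> R by rewrite ltr0n.
clearbody m; pose sg := expR (ln tau / m%:R); have tau0 : 0 < tau by exact: lt_trans tau1.
have sgm : sg ^+ m = tau.
  by rewrite /sg -expRM_natl (_ : _ * _ = ln tau) ?lnK ?posrE//; field.
have sg1 : 1 < sg by rewrite expR_gt1 divr_gt0// ln_gt0.
exists sg => // r0; apply: contrapT => H.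
have {}H r y : r0 <= r -> (1 + d) * ballnorm y r < ballnorm y (sg * r).
  by move=> rr; rewrite ltNge; apply/negP => Hr; apply: H; exists r, y.
have [r [y [rr rp]]] := HC r0; apply/negP; rewrite -leNgt -sgm.
have X0 := ballnorm_gt0 y rp.
apply: (@le_trans _ _ ((1 + d) ^+ m * ballnorm y r)); first by rewrite ler_wpM2r// ltW.
have chain k : (1 + d) ^+ k * ballnorm y r <= ballnorm y (sg ^+ k * r).
  elim: k => [|k IH]; first by rewrite !mul1r.
  rewrite !exprS -!mulrA; apply: le_trans (ler_wpM2l _ IH) _; first by rewrite addr_ge0// ltW.
  apply/ltW/H; apply: (le_trans rr); rewrite ler_peMl ?(ltW rp)//.
  by rewrite exprn_ege1// ltW.
exact: chain.
Qed.

(** [|u|] lies between the indicators of the two balls: the lower one makes the norm of [u]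
    positive, the upper one makes it finite and gives the estimate. *)
Lemma bump_bound a u y r r' : tempered a -> schwartz u -> 0 < r ->
  (forall x, eball y r x -> cabs (u x) = 1) -> (forall x, cabs (u x) <= \1_(eball y r') x) ->
  (mult_norm rho a < +oo)%E -> (0 <= mult_norm rho a)%E /\
  (rho (ebs (mult_fun a u)) <= (fine (mult_norm rho a) * ballnorm y r')%:E)%E.
Proof.
move=> Ta Su r0 u1 ule afin; have X0 := ballnorm_gt0 y r0.
have Mu := Mplus_ebs (cintg_cmeas (schwartz_cintg Su)).
have ule' : (rho (ebs u) <= (ballnorm y r')%:E)%E.
  by rewrite -ballnormE; apply: bfn_le => //; exact: Mplus_chi_ball.
have uge : ((ballnorm y r)%:E <= rho (ebs u))%E.
  rewrite -ballnormE; apply: bfn_le => //; first exact: Mplus_chi_ball.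
  move=> x; rewrite lee_fin indicE; case: (boolP (x \in _)) => [/set_mem /u1 ->//|_].
  exact: cabs_ge0.
have ufin : (rho (ebs u) < +oo)%E by apply: le_lt_trans ule' (ltry _).
have uE : rho (ebs u) = (fine (rho (ebs u)))%:E by rewrite fineK// ge0_fin_numE ?bfn_ge0.
have u0 : 0 < fine (rho (ebs u)) by rewrite (lt_le_trans X0)// -lee_fin -uE.
have uy : exists x, u x != 0.
  exists y; apply/eqP => uy; have := u1 y; rewrite uy cabs0 /eball /= subrr enorm0 => /(_ r0)/esym/eqP.
  by rewrite oner_eq0.
have [M0 gM] := mult_norm_le Ta Su uy ufin u0 afin.
split => //; apply: (le_trans gM); rewrite lee_fin ler_wpM2l ?fine_ge0//.
by rewrite -lee_fin -uE.
Qed.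

(** The supremum of an empty set would be [-oo]; a smooth cutoff shows that there is an admissible
    [u]. *)
Lemma mult_norm_ge0 a : tempered a -> (mult_norm rho a < +oo)%E -> (0 <= mult_norm rho a)%E.
Proof.
move=> Ta afin; have l2 : 1 < 2 :> R by rewrite ltr1n.
have [U [sU U01 U1 U0]] := @radial_cutoff R n 2 l2.
have Sw := test_schwartz (test_dcut sU U0 0 ltr01).
apply: (bump_bound (y := 0) (r' := 2 * 1) Ta Sw ltr01 _ _ afin).1 => x.
  by move=> x1; rewrite (dcut_one l2 U1 ltr01 x1) cabs1.
exact: cabs_dcut_le.
Qed.

(** The single parameter [d] is both the additive error of the pointwise bound and the relative loss
    in the ratio of ball norms; letting it tend to 0 leaves exactly the multiplier norm. *)
Lemma schwartz_L1_bound a psi : weak_doubling rho -> tempered a -> (mult_norm rho a < +oo)%E ->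
  test_fun psi -> cabs (a psi) <= fine (mult_norm rho a) * rint (fun x => cabs (psi x)).
Proof.
move=> wd Ta afin Tpsi; set M := fine _; set J := rint _.
have J0 : 0 <= J by apply: rint_ge0 => x; exact: cabs_ge0.
have key d : 0 < d -> cabs (a psi) <= M * J * (1 + d) + d.
  move=> d0; have [sg sg1 Hsg] := doubling_near1 wd d0.
  have [r1 r11 H] := pointwise_bound Ta Tpsi sg1 d0.
  have [r [y [r1r Xr]]] := Hsg r1; have r0 : 0 < r by apply: lt_le_trans (le_trans r11 r1r).
  have [I [m [v [mJ vP aP]]]] := H r r1r y.
  have X0 := ballnorm_gt0 y r0.
  have gle k : (0 <= mult_norm rho a)%E /\ (rho (ebs (mult_fun a (v k))) <= (M * ballnorm y (sg * r))%:E)%E.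
    by have [Sv v1 vle] := vP k; exact: (bump_bound Ta Sv r0 v1 vle).
  have M0 : 0 <= M := fine_ge0 (mult_norm_ge0 Ta afin).
  rewrite -lerBlDr.
  (* Homogeneity of [rho] is given for nonnegative factors; in the other case the claim is clear by
     sign. *)
  have [a0|a0] := ltP (cabs (a psi) - d) 0.
    by apply: le_trans (ltW a0) _; rewrite !mulr_ge0// addr_ge0// ltW.
  have [A1 [A1b _]] := bfn.
  have mg k : measurable_fun setT ((fun x => cabs (mult_fun a (v k) x)) : RnT -> R).
    by have [Sv _ _] := vP k; exact: cmeas_cabs (ccont_cmeas (mult_fun_cts Ta Sv)).
  have Mg : Mplus (fun x => (\sum_k cabs (m k) * cabs (mult_fun a (v k) x))%:E).
    apply: Mplus_borel => [|x]; first by apply: measurable_sum => k; exact: measurable_funM.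
    by apply: sumr_ge0 => k _; rewrite mulr_ge0 ?cabs_ge0.
  have Mc : Mplus (fun x => ((cabs (a psi) - d)%:E * chi (eball y r) x)%E).
    under eq_fun do rewrite -EFinM.
    apply: Mplus_borel => [|x]; last by rewrite mulr_ge0// indicE.
    by apply: measurable_funM => //; apply: measurable_indic; exact: measurable_eball.
  have h1 : (((cabs (a psi) - d) * ballnorm y r)%:E <= rho (fun x => (\sum_k cabs (m k) * cabs (mult_fun a (v k) x))%:E))%E.
    rewrite EFinM -ballnormE -(A1b _ _ (Mplus_chi_ball y r) a0); apply: bfn_le => // x.
    rewrite -EFinM lee_fin indicE; case: (boolP (x \in _)) => [/set_mem/aP|_].
      by rewrite mulr1 lerBlDr.
    by rewrite mulr0; apply: sumr_ge0 => k _; rewrite mulr_ge0 ?cabs_ge0.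
  have h2 := le_trans h1 (bfn_sum (index_enum I) (fun k => cabs_ge0 (m k)) mg (fun k x => cabs_ge0 _)).
  have h3 : (\sum_k (cabs (m k))%:E * rho (fun x => (cabs (mult_fun a (v k) x))%:E) <=
      (\sum_k cabs (m k) * (M * ballnorm y (sg * r)))%:E)%E.
    rewrite -sumEFin; apply: lee_sum => k _; rewrite [leRHS]EFinM; apply: lee_wpmul2l; [rewrite lee_fin; exact: cabs_ge0|exact: (gle k).2].
  have h4 := le_trans h2 h3; rewrite lee_fin -mulr_suml in h4.
  have X1 : 0 <= ballnorm y (sg * r) by rewrite ltW// ballnorm_gt0// mulr_gt0//; lra.
  have h5 : (cabs (a psi) - d) * ballnorm y r <= M * J * (1 + d) * ballnorm y r.
    apply: (le_trans h4); apply: (le_trans (ler_wpM2r (mulr_ge0 M0 X1) mJ)).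
    rewrite -!mulrA mulrCA; rewrite ler_wpM2l// ler_wpM2l//.
  by rewrite -(ler_pM2r X0).
have M0 : 0 <= M := fine_ge0 (mult_norm_ge0 Ta afin).
apply/ler_addgt0Pr => e e0; have MJ0 : 0 <= M * J by rewrite mulr_ge0.
have D0 : 0 < M * J + 1 by rewrite ltr_wpDl.
have d0 : 0 < e / (M * J + 1) by rewrite divr_gt0.
apply: le_trans (key _ d0) _; rewrite mulrDr mulr1 -addrA lerD2l.
rewrite -[X in _ + X]mul1r -mulrDl mulrCA mulfV ?mulr1 ?gt_eqF//.
Qed.

End banach_function_norms.

(** * Functionals bounded for the L^1 norm *)

Section test_approximation.
Context {R : realType} {n : nat}.
Notation vec := 'rV[R]_n.+1.
Local Notation RnT := (Rn (R:=R) (n:=n.+1)).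
Local Notation lam := (@lam R n.+1).
Implicit Types (k phi psi : vec -> R) (A : set RnT) (e r : R).

Definition rtest phi := smooth_r phi /\ exists r : R, forall x, r < enorm x -> phi x = 0.

Lemma rtest_test phi : rtest phi -> test_fun (fun x => (phi x)%:C).
Proof. by move=> [sp [r pr]]; split; [exact: smooth_c_real|exists r => x /pr ->]. Qed.

Lemma rtestD phi psi : rtest phi -> rtest psi -> rtest (fun x => phi x + psi x).
Proof.
move=> [sp [r pr]] [sq [r' pr']]; split; first exact: smoothD.
exists (Num.max r r') => x; rewrite gt_max => /andP[h1 h2].
by rewrite pr// pr'// addr0.
Qed.

Lemma rtestM phi psi : smooth_r psi -> rtest phi -> rtest (fun x => phi x * psi x).
Proof.
move=> sq [sp [r pr]]; split; first exact: smoothM.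
by exists r => x /pr ->; rewrite mul0r.
Qed.

Lemma rtest0 : rtest (fun _ : vec => 0).
Proof. by split; [exact: smooth_cst|exists 0]. Qed.

Lemma rtestZ (c : R) phi : rtest phi -> rtest (fun x => c * phi x).
Proof.
by move=> [sp [r pr]]; split; [exact: smoothZ|exists r => x /pr ->; rewrite mulr0].
Qed.

Lemma rtest_sum (s : seq nat) (F : nat -> vec -> R) : (forall i, rtest (F i)) ->
  rtest (fun x => \sum_(i <- s) F i x).
Proof.
move=> TF; elim: s => [|i s IH]; first by under eq_fun do rewrite big_nil; exact: rtest0.
by under eq_fun do rewrite big_cons; exact: rtestD.
Qed.

Lemma rtest_meas phi : rtest phi -> measurable_fun setT (phi : RnT -> R).
Proof. by move=> [sp _]; apply: continuous_measurable_Rn; exact: smooth_cts. Qed.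

Lemma rtest_bounded phi : rtest phi -> exists2 M : R, 0 <= M & forall x, `|phi x| <= M.
Proof.
move=> [sp [r pr]]; have [M HM] := continuous_bounded_eball r (smooth_cts sp).
exists `|M| => // x; have [xr|xr] := leP (enorm x) r; last by rewrite pr ?normr0.
by apply: le_trans (HM x xr) _; exact: ler_norm.
Qed.

Lemma rtest_rintg phi : rtest phi -> rintg phi.
Proof. by move=> /rtest_test/test_schwartz/schwartz_cintg[]. Qed.

(** Dominated convergence for sequences that vanish from some rank on at every point, the only kind
    that occurs below. *)
Lemma rint_eventually0 (h : nat -> vec -> R) k : rintg k ->
  (forall j, measurable_fun setT (h j : RnT -> R)) -> (forall j x, `|h j x| <= k x) ->
  (forall x, exists J, forall j, (J <= j)%N -> h j x = 0) ->
  forall e, 0 < e -> exists J, forall j, (J <= j)%N -> rint (fun x => `|h j x|) <= e.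
Proof.
move=> ik mh hk h0 e e0.
have [] := @dominated_convergence _ RnT R lam setT measurableT
  (fun j x => (`|h j x|)%:E) (fun=> 0%E) (fun x => (k x)%:E).
- by move=> j; apply/measurable_EFinP; apply: measurableT_comp.
- exact: measurable_cst.
- apply: aeW => x _; have [J HJ] := h0 x.
  apply: cvg_near_cst; near=> j; rewrite HJ ?normr0//.
  by near: j; exact: nbhs_infty_ge.
- exact: ik.
- by apply: aeW => x j _; rewrite lee_fin normr_id.
move=> _ _; rewrite integral0 => /fine_cvgP[_] /cvgrPdist_lt /(_ e e0)[J _ H].
by exists J => j Jj; have := H j Jj; rewrite /= sub0r normrN => /ltW/(le_trans (ler_norm _)).
Unshelve. all: by end_near. Qed.

Lemma indic01 A x : (\1_A x : R) = 0 \/ (\1_A x : R) = 1.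
Proof. by rewrite indicE; case: (_ \in _); [right|left]. Qed.

(** Approximation in L^1 of the measure [k dx]. With [k] integrable this measure is finite, so the
    whole space and complements remain in the class, as Dynkin's theorem demands. *)
Definition approximable k A := forall e, 0 < e -> exists2 phi, rtest phi &
  rint (fun x => `|\1_A x - phi x| * k x) <= e.

Lemma rintg_bounded_mul k (f : vec -> R) (M : R) : rintg k -> measurable_fun setT (f : RnT -> R) ->
  (forall x, `|f x| <= M) -> rintg (fun x => f x * k x).
Proof.
move=> ik mf fM; have ik' : rintg (fun x => M * `|k x|) by apply: rintgZ; exact: rintg_norm.
apply: (rintg_le _ _ ik'); first by apply: measurable_funM => //; exact: rintg_meas.
by move=> x; rewrite normrM ler_wpM2r.
Qed.

Lemma rintg_approx k A phi : rintg k -> measurable A -> rtest phi ->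
  rintg (fun x => `|\1_A x - phi x| * k x).
Proof.
move=> ik mA Tphi; have [M M0 HM] := rtest_bounded Tphi.
apply: (rintg_bounded_mul (M := 1 + M)) => //.
  apply: measurableT_comp => //; apply: measurable_funB; last exact: rtest_meas.
  exact: measurable_indic.
move=> x; rewrite normr_id (le_trans (ler_normB _ _))// lerD//.
by case: (indic01 A x) => ->; rewrite ?normr0 ?normr1.
Qed.

Section approx.
Context (k : vec -> R) (ik : rintg k) (k0 : forall x, 0 <= k x).

Lemma approximable_seq A (phi : nat -> vec -> R) : measurable A -> (forall j, rtest (phi j)) ->
  (forall j x, 0 <= phi j x <= 1) ->
  (forall x, exists J, forall j, (J <= j)%N -> phi j x = \1_A x) -> approximable k A.
Proof.
move=> mA Tphi p01 pA e e0.
have [] := @rint_eventually0 (fun j x => (\1_A x - phi j x) * k x) k ik _ _ _ e e0.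
- move=> j; apply: measurable_funM; last exact: rintg_meas.
  by apply: measurable_funB; [exact: measurable_indic|exact: rtest_meas].
- move=> j x; rewrite normrM (ger0_norm (k0 x)) ler_piMl// ler_norml.
  by have /andP[h0 h1] := p01 j x; case: (indic01 A x) => ->; apply/andP; split; lra.
- by move=> x; have [J HJ] := pA x; exists J => j /HJ ->; rewrite subrr mul0r.
move=> j /(_ j (leqnn j)) Hj; exists (phi j) => //; apply: le_trans Hj; rewrite le_eqVlt; apply/orP; left; apply/eqP.
by congr rint; apply/funext => x; rewrite normrM (ger0_norm (k0 x)).
Qed.

(** Products of steps of width [1 / j] vanish off the open box, and equal 1 at a given point of it
    once [j] exceeds the reciprocals of its distances to the faces. *)
Lemma approximable_box (a b : vec) : approximable k (obox a b).
Proof.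
pose f (j : nat) i (x : vec) := smooth_step (j%:R * (x ord0 i - a ord0 i)) * smooth_step (j%:R * (b ord0 i - x ord0 i)) : R.
have sf j i : smooth_r (f j i).
  by apply: smoothM; apply: smooth_comp => [m|]; [exact: C1_smooth_step| |exact: C1_smooth_step|];
    apply: smoothZ; apply: smoothB; [exact: smooth_coord|exact: smooth_cst|exact: smooth_cst|exact: smooth_coord].
have f01 j i x : 0 <= f j i x <= 1.
  by rewrite mulr_ge0 ?smooth_step_ge0// mulr_ile1 ?smooth_step_ge0 ?smooth_step_le1.
have out j x : ~ obox a b x -> \prod_i f j i x = 0.
  move=> xB; apply/eqP/prodf_eq0; apply: contrapT => H; apply: xB => i.
  have fi : f j i x != 0 by apply/eqP => fi; apply: H; exists i => //; apply/eqP.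
  apply: contraT; rewrite negb_and -!leNgt => /orP[h|h]; exfalso; apply/negP: fi; rewrite negbK.
    by rewrite /f smooth_step_le0 ?mul0r// mulr_ge0_le0// subr_le0.
  by rewrite /f [X in _ * X]smooth_step_le0 ?mulr0// mulr_ge0_le0// subr_le0.
apply: (approximable_seq (phi := fun j x => \prod_i f j i x)).
- exact: measurable_obox.
- move=> j; split; first exact: smooth_prod.
  exists (\sum_i (`|a ord0 i| + `|b ord0 i|)) => x xr; apply: out => xB.
  move: xr; rewrite ltNge => /negP; apply; apply: le_trans (enorm_le_sum _) _.
  apply: ler_sum => i _; have /andP[h1 h2] := xB i.
  rewrite ler_norml; have := ler_norm (b ord0 i); have := ler_norm (- a ord0 i); rewrite normrN.
  by have := normr_ge0 (a ord0 i); have := normr_ge0 (b ord0 i) => ? ? ? ?; apply/andP; split; lra.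
- move=> j x; apply/andP; split; first by apply: prodr_ge0 => i _; case/andP: (f01 j i x).
  by apply: prodr_ile1 => i _; exact: f01.
- move=> x; have [xB|xB] := pselect (obox a b x); last first.
    by exists 0%N => j _; rewrite out// indicE memNset.
  have ex i : exists J : nat, forall j, (J <= j)%N -> f j i x = 1.
    have /andP[h1 h2] := xB i.
    exists (maxn (Num.bound (x ord0 i - a ord0 i)^-1) (Num.bound (b ord0 i - x ord0 i)^-1)) => j.
    rewrite geq_max => /andP[j1 j2].
    have st (t : R) : 0 < t -> (Num.bound t^-1 <= j)%N -> smooth_step (j%:R * t) = 1.
      move=> t0 tj; apply: smooth_step_ge1; rewrite -ler_pdivrMr// div1r.
      by apply: le_trans (ltW (archi_boundP _)) _; [rewrite invr_ge0 ltW|rewrite ler_nat].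
    by rewrite /f !st ?mulr1// subr_gt0.
  have [J HJ] := choice ex; exists (\sum_i J i)%N => j Jj.
  rewrite indicE mem_set//; apply: big1 => i _; apply: HJ; apply: leq_trans Jj.
  by rewrite (bigD1 i)//= leq_addr.
Qed.

Lemma approximable_setT : approximable k [set: RnT].
Proof.
have l2 : 1 < 2 :> R by rewrite ltr1n.
have [U [sU U01 U1 U0]] := @radial_cutoff R n 2 l2.
have en (j : nat) (x : vec) : enorm (j.+1%:R^-1 *: x) = j.+1%:R^-1 * enorm x.
  by rewrite /enorm dotpZl dotpZr mulrA -expr2 sqrtrM ?sqr_ge0// sqrtr_sqr ger0_norm.
apply: (approximable_seq (phi := fun j x => U (j.+1%:R^-1 *: x))) => //.
- move=> j; split; first exact: smooth_scale.
  exists (2 * j.+1%:R) => x xr; rewrite U0// en mulrC ler_pdivlMr//; exact: ltW.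
- move=> x; exists (Num.bound (enorm x)) => j xj; rewrite indicT U1// en mulrC ltr_pdivrMr//.
  apply: (lt_le_trans (archi_boundP (enorm_ge0 x))).
  apply: (@le_trans _ _ j.+1%:R); first by rewrite ler_nat (leq_trans xj).
  by rewrite ler_peMl//; lra.
Qed.

(** Dynkin's theorem for the intersection-stable family of boxes. The complement of [S] is
    approximated by [q - p] with [q] a test function close to 1, because [1 - p] has no bounded
    support. A disjoint union is truncated to [J] sets, each approximated up to a share of the
    error. *)
Lemma approximableP A : measurable A -> approximable k A.
Proof.
move=> mA; apply: (@dynkin_induction _ RnT (@boxes R n.+1) (approximable k)) => //.
- exact: setI_closed_boxes.
- exact: approximable_setT.
- by move=> _ [a [b ->]]; exact: approximable_box.
- move=> S mS aS e e0; have e20 : 0 < e / 2 by rewrite divr_gt0.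
  have [p Tp Hp] := aS _ e20; have [q Tq Hq] := approximable_setT e20.
  have Tpq : rtest (fun x => q x + (-1) * p x) by apply: rtestD => //; exact: rtestZ.
  exists (fun x => q x + (-1) * p x) => //.
  have ip := rintg_approx ik mS Tp; have iq := rintg_approx ik measurableT Tq.
  apply: (@le_trans _ _ (rint (fun x => `|\1_S x - p x| * k x + `|\1_setT x - q x| * k x))).
    apply: le_rint; [exact: rintg_approx (measurableC mS) Tpq|exact: rintgD|] => x.
    rewrite -mulrDl ler_wpM2r//.
    have -> : \1_(~` S) x = 1 - \1_S x :> R by rewrite !indicE in_setC; case: (x \in S); rewrite ?subrr ?subr0.
    have -> : \1_[set: RnT] x = 1 :> R by rewrite indicE in_setT.
    have -> : 1 - \1_S x - (q x + (-1) * p x) = (1 - q x) - (\1_S x - p x) by ring.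
    by rewrite [leRHS]addrC; exact: ler_normB.
  by rewrite rintD// [leRHS]splitr lerD.
- move=> F mF tF aF e e0; have e20 : 0 < e / 2 by rewrite divr_gt0.
  have Fi i j x : F i x -> F j x -> i = j by move=> Fx Fjx; apply: (tF i j) => //; exists x.
  have sumE j x : \sum_(i < j) \1_(F i) x = (if pselect (exists2 i, (i < j)%N & F i x) then 1 else 0 : R).
    case: pselect => [[i ij Fx]|H].
      rewrite (bigD1 (Ordinal ij))//= indicE mem_set// big1 ?addr0// => l li.
      rewrite indicE memNset// => Fl; move/eqP: li; apply; apply/val_inj; exact: Fi Fl Fx.
    by apply: big1 => i _; rewrite indicE memNset// => Fx; apply: H; exists i.
  pose g j x : R := \1_(\bigcup_i F i) x - \sum_(i < j) \1_(F i) x.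
  have mg j : measurable_fun setT (g j : RnT -> R).
    apply: measurable_funB; first by apply: measurable_indic; exact: bigcupT_measurable.
    by apply: measurable_sum => i; exact: measurable_indic.
  have g01 j x : `|g j x| <= 1.
    rewrite /g sumE; case: (indic01 (\bigcup_i F i) x) => ->; case: pselect => ? /=;
      by rewrite ?subrr ?subr0 ?sub0r ?normrN ?normr0 ?normr1.
  have [] := @rint_eventually0 (fun j x => g j x * k x) k ik _ _ _ _ e20.
  + by move=> j; apply: measurable_funM; [exact: mg|exact: rintg_meas].
  + by move=> j x; rewrite normrM (ger0_norm (k0 x)) ler_piMl.
  + move=> x; have [[i _ Fx]|H] := pselect ((\bigcup_i F i) x).
      exists i.+1 => j ij; rewrite /g sumE indicE mem_set; last by exists i.
      by case: pselect => [?|[]]; [rewrite subrr mul0r|exists i].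
    exists 0%N => j _; rewrite /g sumE indicE memNset//.
    by case: pselect => [ex|?]; [exfalso; case: ex => i _ Fx; apply: H; exists i|rewrite subrr mul0r].
  move=> J /(_ J (leqnn J)) HJ; have eJ : 0 < e / 2 / J.+1%:R by rewrite divr_gt0.
  have ex i : exists p : vec -> R, rtest p /\ rint (fun x => `|\1_(F i) x - p x| * k x) <= e / 2 / J.+1%:R.
    by have [p Tp Hp] := aF i _ eJ; exists p.
  have [p Hp] := choice ex.
  have Tp i := (Hp i).1; have iF i := rintg_approx ik (mF i) (Tp i).
  have Ts : rtest (fun x => \sum_(0 <= i < J) p i x) by exact: rtest_sum.
  exists (fun x => \sum_(0 <= i < J) p i x) => //.
  have ig : rintg (fun x => `|g J x * k x|).
    by apply: rintg_norm; exact: (rintg_bounded_mul ik (mg J) (g01 J)).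
  have isum : rintg (fun x => \sum_(i < J) `|\1_(F i) x - p i x| * k x) by apply: rintg_sum => i; exact: iF.
  apply: (@le_trans _ _ (rint (fun x => `|g J x * k x| + \sum_(i < J) `|\1_(F i) x - p i x| * k x))).
    apply: le_rint; [by apply: rintg_approx => //; exact: bigcupT_measurable|exact: rintgD|] => x.
    rewrite normrM (ger0_norm (k0 x)) -mulr_suml -mulrDl ler_wpM2r//.
    rewrite (_ : _ - _ = g J x + \sum_(i < J) (\1_(F i) x - p i x)); last first.
      by rewrite /g sumrB big_mkord addrA subrK.
    by apply: le_trans (ler_normD _ _) _; rewrite lerD2l; exact: ler_norm_sum.
  rewrite rintD// [leRHS]splitr lerD//.
  rewrite (rint_sum (index_enum _) (fun i : 'I_J => iF i)).
  apply: (@le_trans _ _ (\sum_(i < J) e / 2 / J.+1%:R)); first by apply: ler_sum => i _; exact: (Hp i).2.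
  rewrite sumr_const card_ord -[leLHS]mulr_natr mulrAC ler_pdivrMr//.
  by apply: ler_wpM2l; [exact: ltW|rewrite ler_nat].
Qed.

End approx.

End test_approximation.

(** * From integral inequalities to inequalities almost everywhere *)

Section almost_everywhere.
Context {R : realType} {n : nat}.
Notation vec := 'rV[R]_n.+1.
Local Notation RnT := (Rn (R:=R) (n:=n.+1)).
Local Notation lam := (@lam R n.+1).
Local Notation lo := (@lebesgue_outer R n.+1).
Implicit Types (k g h phi psi : vec -> R) (A N : set RnT) (e r M : R).

Lemma rint_null g h (N : set vec) : lo N = 0%E -> (forall x, ~ N x -> g x = h x) -> rint g = rint h.
Proof.
move=> N0 gh; have := lint_null N0 (f := fun x => (g x)%:E) (g := fun x => (h x)%:E).
by rewrite /lint /rint /Rintegral => -> // x /gh ->.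
Qed.

Lemma rintg_indic A k : rintg k -> measurable A -> rintg (fun x => \1_A x * k x).
Proof.
move=> ik mA; apply: (rintg_bounded_mul (M := 1)) => //.
by move=> x; case: (indic01 A x) => ->; rewrite ?normr0 ?normr1.
Qed.

(** The hypothesis is used for the set where [k] is positive: there a nonnegative function has
    integral at most 0. *)
Lemma nonpos_ae k : rintg k -> (forall A, measurable A -> rint (fun x => \1_A x * k x) <= 0) ->
  exists N, [/\ measurable N, lam N = 0%E & forall x, ~ N x -> k x <= 0].
Proof.
move=> ik Hk; pose N : set RnT := [set x : vec | 0 < k x].
have mN : measurable N.
  have := rintg_meas ik measurableT (measurable_itv `]0, +oo[).
  by rewrite setTI; congr measurable; apply/seteqP; split => x /=; rewrite in_itv /= andbT.
have iN := rintg_indic ik mN.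
have f0 (x : vec) : 0 <= \1_N x * k x.
  rewrite indicE; case: (boolP (x \in _)) => [/set_mem kx|_]; first by rewrite mul1r ltW.
  by rewrite mul0r.
have z : (\int[lam]_(x in setT) `|((\1_N x * k x)%:E)| = 0)%E.
  under eq_integral do rewrite /= (ger0_norm (f0 _)).
  have := Hk N mN; rewrite /rint /Rintegral => h0.
  have fin : (\int[lam]_x (\1_N x * k x)%:E)%E \is a fin_num by exact: integral_fune_fin_num.
  rewrite -(fineK fin); congr (_%:E); apply/eqP; rewrite eq_le h0 fine_ge0//.
  by apply: integral_ge0 => x _; rewrite lee_fin.
have mf : measurable_fun setT ((fun x => (\1_N x * k x)%:E) : RnT -> \bar R).
  by apply/measurable_EFinP; exact: rintg_meas iN.
have [B [mB B0 BP]] := (ae_eq_integral_abs lam measurableT mf).1 z.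
exists B; split => // x Bx; rewrite leNgt; apply/negP => kx; apply: Bx; apply: BP => /= H.
have := H I => -[] /eqP; rewrite indicE mem_set// mul1r => /eqP k0.
by rewrite k0 ltxx in kx.
Qed.

(** The Gaussian weight makes [(w - M) G] integrable. Its integral over a Borel set is compared with
    the hypothesis for the test function [p G], where [p] approximates the indicator in L^1 of
    [G dx]; in the end [G > 0] is divided out. *)
Lemma rint_test_le_ae (w : vec -> R) (C M : R) : measurable_fun setT (w : RnT -> R) ->
  (forall x, `|w x| <= C) ->
  (forall phi, rtest phi -> rint (fun x => w x * phi x) <= M * rint (fun x => `|phi x|)) -> 0 <= M ->
  exists N, [/\ measurable N, lam N = 0%E & forall x, ~ N x -> w x <= M].
Proof.
move=> mw wC wM M0; pose G : vec -> R := gauss 1.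
have iG : rintg G := rintg_gauss ltr01; have G0 x : 0 < G x := gauss_gt0 1 x.
have C0 : 0 <= C := le_trans (normr_ge0 _) (wC 0).
have iwG : rintg (fun x => w x * G x) := rintg_bounded_mul iG mw wC.
have ik : rintg (fun x => w x * G x + (- M) * G x) by apply: rintgD => //; exact: rintgZ.
have [N [mN N0 NP]] : exists N, [/\ measurable N, lam N = 0%E & forall x, ~ N x -> w x * G x + (- M) * G x <= 0].
  apply: (nonpos_ae ik) => A mA; apply/ler_addgt0Pr => e e0; rewrite add0r.
  have e0' : 0 < e / (C + M + 1) by rewrite divr_gt0// ltr_wpDl// addr_ge0.
  have [p Tp Hp] := approximableP iG (fun x => ltW (G0 x)) mA e0'.
  have TpG : rtest (fun x => p x * G x) by apply: rtestM => //; exact: smooth_gauss.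
  have iA := rintg_indic iG mA; have ip := rtest_rintg TpG.
  have id := rintg_approx iG mA Tp.
  have iwA : rintg (fun x => w x * (\1_A x * G x)) := rintg_bounded_mul iA mw wC.
  have iwp : rintg (fun x => w x * (p x * G x)) := rintg_bounded_mul ip mw wC.
  have E : (fun x => \1_A x * (w x * G x + - M * G x)) = fun x => w x * (\1_A x * G x) + (- M) * (\1_A x * G x).
    by apply/funext => x; ring.
  rewrite E (rintD iwA (rintgZ _ iA)) (rintZ _ iA).
  have h1 : rint (fun x => w x * (\1_A x * G x)) <= rint (fun x => w x * (p x * G x)) + C * rint (fun x => `|\1_A x - p x| * G x).
    rewrite -rintZ// -rintD//; last exact: rintgZ.
    apply: le_rint => //; first by apply: rintgD => //; exact: rintgZ.
    move=> x; rewrite -lerBlDl -mulrBr -mulrBl mulrA [C * _]mulrA ler_wpM2r ?(ltW (G0 x))//.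
    apply: le_trans (ler_norm _) _; rewrite normrM ler_wpM2r//.
  have h2 : rint (fun x => `|p x * G x|) <= rint (fun x => \1_A x * G x) + rint (fun x => `|\1_A x - p x| * G x).
    rewrite -rintD//; apply: le_rint; [exact: rintg_norm|exact: rintgD|] => x.
    rewrite normrM (gtr0_norm (G0 x)) -mulrDl ler_wpM2r ?(ltW (G0 x))//.
    have -> : `|p x| = `|\1_A x - (\1_A x - p x)| by congr (`|_|); ring.
    apply: le_trans (ler_normB _ _) _; rewrite lerD2r.
    by case: (indic01 A x) => ->; rewrite ?normr0 ?normr1.
  have h3 := wM _ TpG; have h4 := ler_wpM2l M0 h2; have h5 := ler_wpM2l C0 Hp; have h6 := ler_wpM2l M0 Hp.
  have h7 : (C + M) * (e / (C + M + 1)) <= e.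
    by rewrite mulrA ler_pdivrMr ?ltr_wpDl ?addr_ge0// mulrC ler_wpM2l ?(ltW e0)// lerDl.
  move: h1 h3 h4 h5 h6 h7; rewrite mulNr mulrDr mulrDl.
  move: (rint _) (rint _) (rint _) (rint _) => a b c d; lra.
exists N; split => // x /NP; rewrite -mulrDl pmulr_lle0// subr_le0.
by [].
Qed.

End almost_everywhere.

(** * Extension of an L^1-bounded functional and its density *)

Section l1_functionals.
Context {R : realType} {n : nat}.
Notation vec := 'rV[R]_n.+1.
Local Notation RnT := (Rn (R:=R) (n:=n.+1)).
Local Notation lam := (@lam R n.+1).
Implicit Types (g h phi psi : vec -> R) (A N : set RnT) (c e r : R).

Context (l : (vec -> R) -> R) (M : R) (M0 : 0 <= M)
  (lD : forall phi psi, rtest phi -> rtest psi -> l (fun x => phi x + psi x) = l phi + l psi)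
  (lZ : forall c phi, rtest phi -> l (fun x => c * phi x) = c * l phi)
  (lM : forall phi, rtest phi -> `|l phi| <= M * rint (fun x => `|phi x|)).

Lemma ler0_eps (x : R) : (forall e : R, 0 < e -> x <= e) -> x <= 0.
Proof. by move=> H; apply/ler_addgt0Pr => e e0; rewrite add0r; exact: H. Qed.

Definition l1dist g h : R := rint (fun x => `|g x - h x|).

(* Any Lipschitz function extends from a subset by such a supremum (McShane); linearity of the
   extension on the closure of the test functions then follows by density. *)
Definition ext g : R := sup [set l phi - M * l1dist g phi | phi in @rtest R n].

Lemma rintgB g h : rintg g -> rintg h -> rintg (fun x => g x - h x).
Proof.
move=> ig ih; have := rintgD ig (rintgZ (-1) ih).
by under eq_fun do rewrite mulN1r.
Qed.

Lemma l1distD g h g' h' : rintg g -> rintg h -> rintg g' -> rintg h' ->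
  l1dist (fun x => g x + g' x) (fun x => h x + h' x) <= l1dist g h + l1dist g' h'.
Proof.
move=> ig ih ig' ih'; have i1 := rintg_norm (rintgB ig ih); have i2 := rintg_norm (rintgB ig' ih').
rewrite /l1dist -rintD//; apply: le_rint; [|exact: rintgD|].
  by apply: rintg_norm; apply: rintgB; exact: rintgD.
by move=> x; rewrite opprD addrACA; exact: ler_normD.
Qed.

Lemma l1dist_tri g h k : rintg g -> rintg h -> rintg k -> l1dist h k <= l1dist g h + l1dist g k.
Proof.
move=> ig ih ik; have i1 := rintg_norm (rintgB ig ih); have i2 := rintg_norm (rintgB ig ik).
rewrite /l1dist -rintD//; apply: le_rint; [exact: rintg_norm (rintgB ih ik)|exact: rintgD|] => x.
rewrite (distrC (g x)) (_ : h x - k x = (h x - g x) + (g x - k x)); last by ring.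
exact: ler_normD.
Qed.

(** Above, each term of the supremum is estimated by the bound on [l] and the triangle inequality;
    below, [phi] contributes its own term. Linearity of [ext] is derived from this estimate
    alone. *)
Lemma ext_near g phi : rintg g -> rtest phi -> `|ext g - l phi| <= M * l1dist g phi.
Proof.
move=> ig Tp; have ip := rtest_rintg Tp.
have ub : ubound [set l phi - M * l1dist g phi | phi in @rtest R n] (l phi + M * l1dist g phi).
  move=> _ [q Tq <-]; have iq := rtest_rintg Tq.
  have Tqp : rtest (fun x => q x + (-1) * phi x) by apply: rtestD => //; exact: rtestZ.
  have := le_trans (ler_norm _) (lM Tqp); rewrite lD ?lZ ?mulN1r//; last exact: rtestZ.
  have -> : rint (fun x => `|q x + (-1) * phi x|) = l1dist q phi.
    by congr rint; apply/funext => x; rewrite mulN1r.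
  have := ler_wpM2l M0 (l1dist_tri ig iq ip); rewrite mulrDr; lra.
have nE : [set l phi - M * l1dist g phi | phi in @rtest R n] !=set0 by exists (l phi - M * l1dist g phi), phi.
have h1 : ext g <= l phi + M * l1dist g phi by exact: ge_sup nE ub.
have h2 : l phi - M * l1dist g phi <= ext g.
  by apply: ub_le_sup; [exists (l phi + M * l1dist g phi)|exists phi].
by rewrite ler_norml; apply/andP; split; lra.
Qed.

(** The L^1 closure of the test functions, on which [ext] is linear. *)
Definition l1approx g := rintg g /\ forall e, 0 < e -> exists2 phi, rtest phi & l1dist g phi <= e.

Lemma l1approxD g h : l1approx g -> l1approx h -> l1approx (fun x => g x + h x).
Proof.
move=> [ig ag] [ih ah]; split; first exact: rintgD.
move=> e e0; have e20 : 0 < e / 2 by rewrite divr_gt0.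
have [p Tp Hp] := ag _ e20; have [q Tq Hq] := ah _ e20.
exists (fun x => p x + q x); first exact: rtestD.
apply: le_trans (l1distD ig (rtest_rintg Tp) ih (rtest_rintg Tq)) _.
by rewrite [leRHS]splitr lerD.
Qed.

Lemma l1distZ c g h : rintg g -> rintg h -> l1dist (fun x => c * g x) (fun x => c * h x) = `|c| * l1dist g h.
Proof.
move=> ig ih; rewrite /l1dist -rintZ; last exact: rintg_norm (rintgB ig ih).
by congr rint; apply/funext => x; rewrite -mulrBr normrM.
Qed.

Lemma l1approxZ c g : l1approx g -> l1approx (fun x => c * g x).
Proof.
move=> [ig ag]; split; first exact: rintgZ.
move=> e e0; have c1 : 0 < `|c| + 1 by rewrite ltr_wpDl.
have e20 : 0 < e / (`|c| + 1) by rewrite divr_gt0.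
have [p Tp Hp] := ag _ e20; exists (fun x => c * p x); first exact: rtestZ.
rewrite (l1distZ _ ig (rtest_rintg Tp)).
apply: le_trans (ler_wpM2l (normr_ge0 c) Hp) _.
by rewrite mulrA ler_pdivrMr// mulrC ler_wpM2l ?(ltW e0)// lerDl.
Qed.

Lemma extD g h : l1approx g -> l1approx h -> ext (fun x => g x + h x) = ext g + ext h.
Proof.
move=> ag ah; have [igh _] := l1approxD ag ah; move: ag ah => [ig ag] [ih ah].
apply/eqP; rewrite -subr_eq0 -normr_le0; apply: ler0_eps => e e0.
(* Four errors [M * d] occur, two for the sum and one for each summand; [M + 1] allows for
   [M = 0]. *)
have M1 : 0 < 4 * (M + 1) by rewrite mulr_gt0// ltr_wpDl.
have d0 : 0 < e / (4 * (M + 1)) by rewrite divr_gt0.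
have [p Tp Hp] := ag _ d0; have [q Tq Hq] := ah _ d0.
have h1 := ext_near igh (rtestD Tp Tq); have h2 := ext_near ig Tp; have h3 := ext_near ih Tq.
have h4 := l1distD ig (rtest_rintg Tp) ih (rtest_rintg Tq).
rewrite (lD Tp Tq) in h1.
set d : R := e / _ in Hp Hq d0; have ed : e = 4 * (M + 1) * d by rewrite /d mulrC divfK// gt_eqF.
have k1 := ler_wpM2l M0 h4; have k2 := ler_wpM2l M0 Hp; have k3 := ler_wpM2l M0 Hq.
rewrite mulrDr in k1; rewrite ed.
rewrite (_ : ext _ - _ = (ext (fun x => g x + h x) - (l p + l q)) - (ext g - l p) - (ext h - l q)); last by ring.
apply: le_trans (ler_normB _ _) _; apply: le_trans (lerD (ler_normB _ _) (lexx _)) _.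
have Md : 0 <= M * d by rewrite mulr_ge0// ltW.
rewrite (_ : 4 * (M + 1) * d = 4 * (M * d) + 4 * d); last by ring.
apply: le_trans (lerD (lerD (le_trans (le_trans h1 k1) (lerD k2 k3)) (le_trans h2 k2)) (le_trans h3 k3)) _.
rewrite (_ : M * d + M * d + _ + _ = 4 * (M * d)); last by ring.
by rewrite lerDl mulr_ge0// ltW.
Qed.

Lemma extZ c g : l1approx g -> ext (fun x => c * g x) = c * ext g.
Proof.
move=> ag; have [icg _] := l1approxZ c ag; move: ag => [ig ag].
apply/eqP; rewrite -subr_eq0 -normr_le0; apply: ler0_eps => e e0.
have M1 : 0 < 2 * (`|c| + 1) * (M + 1) by rewrite mulr_gt0 ?ltr_wpDl// mulr_gt0// ltr_wpDl.
have d0 : 0 < e / (2 * (`|c| + 1) * (M + 1)) by rewrite divr_gt0.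
have [p Tp Hp] := ag _ d0.
have h1 := ext_near icg (rtestZ c Tp); have h2 := ext_near ig Tp.
rewrite (lZ _ Tp) (l1distZ _ ig (rtest_rintg Tp)) in h1.
set d : R := e / _ in Hp d0; have ed : e = 2 * (`|c| + 1) * (M + 1) * d by rewrite /d mulrC divfK// gt_eqF.
have k2 := ler_wpM2l (normr_ge0 c) (ler_wpM2l M0 Hp).
have k3 := ler_wpM2l (normr_ge0 c) h2.
rewrite (_ : ext _ - _ = (ext (fun x => c * g x) - c * l p) - c * (ext g - l p)); last by ring.
apply: le_trans (ler_normB _ _) _; rewrite normrM ed.
have k4 : 0 <= `|c| * d by rewrite mulr_ge0// ltW.
have k5 : 0 <= M * d by rewrite mulr_ge0// ltW.
rewrite (_ : 2 * (`|c| + 1) * (M + 1) * d = 2 * (`|c| * (M * d)) + 2 * (`|c| * d) + 2 * (M * d) + 2 * d); last by ring.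
rewrite mulrCA in h1.
apply: le_trans (lerD (le_trans h1 k2) (le_trans k3 k2)) _.
rewrite (_ : _ + `|c| * (M * d) = 2 * (`|c| * (M * d))); last by ring.
by rewrite -!addrA lerDl !addr_ge0// mulr_ge0// ltW.
Qed.

Lemma ext_rtest phi : rtest phi -> l1approx phi /\ ext phi = l phi.
Proof.
move=> Tp; have ip := rtest_rintg Tp; have d0 : l1dist phi phi = 0.
  by rewrite /l1dist /rint /Rintegral; under eq_integral do rewrite subrr normr0; rewrite integral0.
split; first by split => // e e0; exists phi => //; rewrite d0 ltW.
by apply/eqP; rewrite -subr_eq0 -normr_le0 -[leRHS](mulr0 M) -d0; exact: ext_near.
Qed.

Lemma functional0 : l (fun=> 0) = 0.
Proof.
rewrite -[RHS](mul0r (l (fun=> 0))) -(lZ 0 (@rtest0 R n)); congr l.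
by apply/funext => x; rewrite mul0r.
Qed.

Lemma ext_le g : rintg g -> `|ext g| <= M * rint (fun x => `|g x|).
Proof.
move=> ig; have T0 := @rtest0 R n; have := ext_near ig T0.
by rewrite functional0 subr0 /l1dist; under eq_fun do rewrite subr0.
Qed.

Let G : vec -> R := gauss 1.
Let iG : rintg G := rintg_gauss ltr01.
Let G0 x : 0 < G x := gauss_gt0 1 x.

Lemma l1approx_indic A : measurable A -> l1approx (fun x => \1_A x * G x).
Proof.
move=> mA; split; first exact: rintg_indic.
move=> e e0; have [p Tp Hp] := approximableP iG (fun x => ltW (G0 x)) mA e0.
exists (fun x => p x * G x); first by apply: rtestM => //; exact: smooth_gauss.
apply: le_trans Hp; rewrite le_eqVlt; apply/orP; left; apply/eqP; congr rint.
by apply/funext => x; rewrite -mulrBl normrM (gtr0_norm (G0 x)).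
Qed.

(** The Gaussian weight makes the charge finite on all Borel sets, also those of infinite Lebesgue
    measure. It is divided out in [real_l1_dual]. *)
Definition ext_set A : \bar R := (ext (fun x => \1_A x * G x))%:E.

Lemma ext_set_sum (F : nat -> set RnT) (j : nat) : (forall i, measurable (F i)) ->
  l1approx (fun x => \sum_(0 <= i < j) \1_(F i) x * G x) /\
  ext (fun x => \sum_(0 <= i < j) \1_(F i) x * G x) = \sum_(0 <= i < j) ext (fun x => \1_(F i) x * G x).
Proof.
move=> mF; elim: j => [|j [IH1 IH2]].
  have [a0 e0] := ext_rtest (@rtest0 R n).
  have E : (fun x : vec => \sum_(0 <= i < 0) \1_(F i) x * G x) = fun=> 0.
    by apply/funext => x; rewrite big_nil.
  by rewrite E big_nil e0 functional0.
have E : (fun x : vec => \sum_(0 <= i < j.+1) \1_(F i) x * G x) =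
    fun x => \sum_(0 <= i < j) \1_(F i) x * G x + \1_(F j) x * G x.
  by apply/funext => x; rewrite big_nat_recr.
have aj := l1approx_indic (mF j).
by rewrite E big_nat_recr//= extD// IH2; split => //; exact: l1approxD.
Qed.

Let ext_set0 : ext_set set0 = 0%E.
Proof.
rewrite /ext_set; congr (_%:E); apply/eqP; rewrite -normr_le0.
apply: le_trans (ext_le (rintg_indic iG measurable0)) _.
rewrite /rint /Rintegral; under eq_integral do rewrite indic0 mul0r normr0.
by rewrite integral0 mulr0.
Qed.

Let ext_set_fin A : measurable A -> ext_set A \is a fin_num. Proof. by []. Qed.

(** The tail [g j] is dominated by [G] and vanishes eventually at each point, so it tends to 0 in
    L^1, and [ext_le] carries this over to the charge. *)
Let ext_set_sigma : semi_sigma_additive ext_set.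
Proof.
move=> F mF tF mUF; rewrite /ext_set; under eq_fun do rewrite sumEFin.
apply: cvg_EFin; first by near=> j.
apply/cvgrPdist_le => e e0; have M1 : 0 < M + 1 by rewrite ltr_wpDl.
have e10 : 0 < e / (M + 1) by rewrite divr_gt0.
pose g j x : R := \1_(\bigcup_i F i) x * G x - \sum_(0 <= i < j) \1_(F i) x * G x.
have [] := @rint_eventually0 _ _ g (fun x => G x) iG _ _ _ _ e10.
- move=> j; apply: measurable_funB; first exact: rintg_meas (rintg_indic iG mUF).
  exact: rintg_meas (ext_set_sum j mF).1.1.
- move=> j x; rewrite /g -mulr_suml -mulrBl normrM (gtr0_norm (G0 x)) ler_piMl ?(ltW (G0 x))//.
  have sle : 0 <= (\sum_(0 <= i < j) \1_(F i) x : R) <= \1_(\bigcup_i F i) x.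
    rewrite big_mkord; have [[i ij Fx]|H] := pselect (exists2 i, (i < j)%N & F i x).
      rewrite (bigD1 (Ordinal ij))//= !indicE mem_set// mem_set; last by exists i.
      rewrite big1 ?addr0 ?lexx ?ler01// => k ki; rewrite indicE memNset// => Fk.
      by move/eqP: ki; apply; apply/val_inj; apply: (tF k i) => //; exists x.
    rewrite big1 => [|i _]; first by rewrite lexx; case: (indic01 (\bigcup_i F i) x) => ->; rewrite ?lexx ?ler01.
    by rewrite indicE memNset// => Fx; apply: H; exists i.
  move: sle => /andP[s0 s1]; have : (\1_(\bigcup_i F i) x : R) <= 1 by case: (indic01 (\bigcup_i F i) x) => ->.
  by rewrite ler_norml => s2; apply/andP; split; lra.
- move=> x; have [[i _ Fx]|H] := pselect ((\bigcup_i F i) x).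
    exists i.+1 => j ij; rewrite /g big_mkord indicE mem_set; last by exists i.
    rewrite (bigD1 (Ordinal ij))//= indicE mem_set// big1 ?addr0 ?subrr// => k ki.
    rewrite indicE memNset ?mul0r// => Fk.
    by move/eqP: ki; apply; apply/val_inj; apply: (tF k i) => //; exists x.
  exists 0%N => j _; rewrite /g indicE memNset// mul0r big1 ?subrr// => i _.
  by rewrite indicE memNset ?mul0r// => Fx; apply: H; exists i.
move=> J HJ; near=> j; have [as1 esum] := ext_set_sum j mF; rewrite /= -esum.
have aU := l1approx_indic mUF.
have aN : l1approx (fun x => (-1) * \sum_(0 <= i < j) \1_(F i) x * G x) := l1approxZ (-1) as1.
rewrite -mulN1r -(extZ (-1) as1) -(extD aU aN).
apply: le_trans (ext_le (l1approxD aU aN).1) _.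
have Jj : (J <= j)%N by near: j; exact: nbhs_infty_ge.
have := HJ j Jj; rewrite /g; under eq_fun do rewrite -mulN1r.
move/(ler_wpM2l M0)/le_trans; apply.
by rewrite mulrA ler_pdivrMr// mulrC ler_wpM2l ?(ltW e0)// lerDl.
Unshelve. all: by end_near. Qed.

HB.instance Definition _ := isCharge.Build _ RnT R ext_set ext_set0 ext_set_fin ext_set_sigma.

Lemma ext_set_density : exists f : vec -> R, rintg f /\
  forall A, measurable A -> ext (fun x => \1_A x * G x) = rint (fun x => \1_A x * f x).
Proof.
pose nu : {charge set RnT -> \bar R} := ext_set.
pose mu : {sigma_finite_measure set RnT -> \bar R} := lam.
have dom : (nu : set RnT -> \bar R) `<< mu.
  apply/null_content_dominatesP => A mA A0; rewrite /nu /= /ext_set; congr (_%:E).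
  apply/eqP; rewrite -normr_le0; apply: le_trans (ext_le (rintg_indic iG mA)) _.
  rewrite (rint_null (h := fun=> 0) A0) => [|x Ax].
    by rewrite /rint /Rintegral integral0 mulr0.
  by rewrite indicE memNset// mul0r normr0.
pose h := Radon_Nikodym nu mu; pose f (x : vec) : R := fine (h x).
have hE x : h x = (f x)%:E by rewrite fineK//; exact: Radon_Nikodym_fin_num.
have ih : mu.-integrable setT h := Radon_Nikodym_integrable dom.
have if_ : rintg f by move: ih; congr (integrable _ _ _); apply/funext => x; rewrite hE.
exists f; split => // A mA.
have := Radon_Nikodym_integral dom mA; rewrite /nu /= /ext_set.
rewrite integral_mkcond => H.
rewrite /rint /Rintegral -[LHS]/(fine (ext (fun x => \1_A x * G x))%:E) H; congr fine.
apply: eq_integral => x _; rewrite patchE indicE -/(h x) hE.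
by case: (x \in A); rewrite ?mul1r ?mul0r.
Qed.

End l1_functionals.

(** * Representation by a bounded function *)

Section l1_dual.
Context {R : realType} {n : nat}.
Notation vec := 'rV[R]_n.+1.
Local Notation RnT := (Rn (R:=R) (n:=n.+1)).
Local Notation lam := (@lam R n.+1).
Local Notation lo := (@lebesgue_outer R n.+1).
Implicit Types (g h phi psi : vec -> R) (A N : set RnT) (c e r : R).

(** The sum counts the levels [eta, 2 eta, ..., K eta] that do not exceed [t], so [t] is rounded
    down to a multiple of [eta]. Applied pointwise, it approximates a bounded function uniformly by
    indicators of its superlevel sets. *)
Lemma layer_cake (eta t : R) (K : nat) : 0 < eta -> 0 <= t -> t < K.+1%:R * eta ->
  `|t - eta * \sum_(0 <= j < K) (j.+1%:R * eta <= t)%R%:R| <= eta.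
Proof.
move=> eta0 t0; elim: K => [|K IH] tK.
  by rewrite big_nil mulr0 subr0 ger0_norm// ltW// -[eta]mul1r.
rewrite big_nat_recr//=; have [h|h] := leP (K.+1%:R * eta) t; last by rewrite addr0; exact: IH.
rewrite (_ : \sum_(0 <= j < K) _ = K%:R).
  rewrite (_ : K%:R + true%:R = K.+1%:R :> R) ?natr1// mulrC ger0_norm ?subr_ge0//.
  by rewrite lerBlDr (le_trans (ltW tK))// -[K.+2%:R]natr1 mulrDl mul1r addrC.
rewrite (eq_big_nat _ _ (F2 := fun=> 1)) => [|j /andP[_ jK]].
  by rewrite big_mkord sumr_const card_ord.
by rewrite (le_trans _ h)// ler_pM2r// ler_nat ltnW.
Qed.

Lemma le_cabs_rint (w g : vec -> R) (C : R) : rintg g -> measurable_fun setT (w : RnT -> R) ->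
  (forall x, `|w x| <= C) -> `|rint (fun x => w x * g x)| <= C * rint (fun x => `|g x|).
Proof.
move=> ig mw wC; have iwg := rintg_bounded_mul ig mw wC.
apply: le_trans (le_normr_Rintegral measurableT iwg) _.
rewrite -rintZ; last exact: rintg_norm.
apply: (le_rint (rintg_norm iwg)); first exact/rintgZ/rintg_norm.
by move=> x; rewrite normrM ler_wpM2r.
Qed.

(** [h] is the density divided by the Gaussian and clamped to [[-M, M]]; the clamping acts only on a
    null set and makes the bound hold everywhere. The identity is known for indicators times [G],
    and passes to [phi] by writing [phi = v G] and approximating [v] uniformly with [layer_cake]. *)
Lemma real_l1_dual (l : (vec -> R) -> R) (M : R) : 0 <= M ->
  (forall phi psi, rtest phi -> rtest psi -> l (fun x => phi x + psi x) = l phi + l psi) ->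
  (forall c phi, rtest phi -> l (fun x => c * phi x) = c * l phi) ->
  (forall phi, rtest phi -> `|l phi| <= M * rint (fun x => `|phi x|)) ->
  exists h : vec -> R, [/\ measurable_fun setT (h : RnT -> R), forall x, `|h x| <= M &
    forall phi, rtest phi -> l phi = rint (fun x => h x * phi x)].
Proof.
move=> M0 lD lZ lM; have [f [if_ fE]] := ext_set_density M0 lD lZ lM.
pose G : vec -> R := gauss 1; have iG : rintg G := rintg_gauss ltr01.
have G0 x : 0 < G x := gauss_gt0 1 x.
have fA A : measurable A -> `|rint (fun x => \1_A x * f x)| <= M * rint (fun x => \1_A x * G x).
  move=> mA; rewrite -fE//; apply: le_trans (ext_le M0 lD lZ lM (rintg_indic iG mA)) _.
  rewrite ler_wpM2l//; apply: le_rint; [exact: rintg_norm (rintg_indic iG mA)|exact: rintg_indic|] => x.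
  by rewrite ger0_norm// mulr_ge0 ?(ltW (G0 x))// indicE.
have ae_bound (s : R) : `|s| = 1 -> exists N, [/\ measurable N, lam N = 0%E & forall x, ~ N x -> s * f x + (- M) * G x <= 0].
  move=> s1; have ik : rintg (fun x => s * f x + (- M) * G x) by apply: rintgD; exact: rintgZ.
  apply: (nonpos_ae ik) => A mA.
  have E : (fun x => \1_A x * (s * f x + - M * G x)) = fun x => s * (\1_A x * f x) + (- M) * (\1_A x * G x).
    by apply/funext => x; ring.
  have i1 := rintg_indic if_ mA; have i2 := rintg_indic iG mA.
  rewrite E rintD ?rintZ//; [|exact: rintgZ|exact: rintgZ].
  rewrite mulNr subr_le0; apply: le_trans (fA A mA); apply: le_trans (ler_norm _) _.
  by rewrite normrM s1 mul1r.
have [N1 [mN1 N10 N1P]] := ae_bound 1 (normr1 _).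
have [N2 [mN2 N20 N2P]] := ae_bound (-1) normrN1R.
pose h (x : vec) : R := Num.max (- M) (Num.min M (f x * gauss (-1) x)).
have GG (x : vec) : gauss (-1) x * G x = 1 by rewrite /G /gauss -expRD mulN1r mul1r opprK subrr expR0.
have G'0 (x : vec) : 0 < gauss (-1) x := gauss_gt0 (-1) x.
have mh : measurable_fun setT (h : RnT -> R).
  apply: measurable_maxr => //; apply: measurable_minr => //.
  apply: measurable_funM; first exact: rintg_meas.
  by apply: continuous_measurable_Rn; exact: smooth_cts (smooth_gauss _).
have hM x : `|h x| <= M.
  by rewrite /h ler_norml; apply/andP; split; rewrite ?le_max ?lexx// ge_max ge_min lexx /= andbT; lra.
have hf x : ~ (N1 `|` N2) x -> h x * G x = f x.
  move=> NN; have n1 : ~ N1 x by move=> ?; apply: NN; left.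
  have n2 : ~ N2 x by move=> ?; apply: NN; right.
  have b1 : f x * gauss (-1) x <= M.
    have := N1P x n1; rewrite mul1r mulNr subr_le0 => /(ler_wpM2r (ltW (G'0 x))).
    by rewrite -(mulrA M) [G x * _]mulrC GG mulr1.
  have b2 : - M <= f x * gauss (-1) x.
    have := N2P x n2; rewrite mulN1r mulNr subr_le0 => /(ler_wpM2r (ltW (G'0 x))).
    by rewrite -(mulrA M) [G x * _]mulrC GG mulr1 mulNr lerNl.
  by rewrite /h (min_idPr b1) (max_idPr b2) -mulrA GG mulr1.
have null : lo (N1 `|` N2) = 0%E.
  apply/eqP; rewrite eq_le lebesgue_outer_ge0 andbT.
  apply: (le_trans (measureU2 lam mN1 mN2)).
  by rewrite [X in (X + _ <= _)%E]N10 [X in (_ + X <= _)%E]N20 adde0.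
have hE A : measurable A -> ext l M (fun x => \1_A x * G x) = rint (fun x => h x * (\1_A x * G x)).
  move=> mA; rewrite fE//; apply: (rint_null null) => x /hf <-; ring.
exists h; split => // phi Tphi; apply/eqP; rewrite -subr_eq0 -normr_le0; apply: ler0_eps => e e0.
(* [v] is [phi] divided by [G]; it is again a test function and in particular bounded. *)
pose v x := phi x * gauss (-1) x; have Tv : rtest v by apply: rtestM => //; exact: smooth_gauss.
have [V V0 vV] := rtest_bounded Tv; have ip := rtest_rintg Tphi.
pose J := rint G; have J0 : 0 <= J by apply: rint_ge0 => x; exact: ltW (G0 x).
have D0 : 0 < 2 * M * J + 1 by rewrite ltr_wpDl// !mulr_ge0.
(* The functional and its candidate representation each contribute at most [M * eta * J]. *)
pose eta : R := e / (2 * M * J + 1); have eta0 : 0 < eta by rewrite divr_gt0.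
pose K := Num.bound (2 * V / eta).
have VK : 2 * V < K.+1%:R * eta.
  rewrite -ltr_pdivrMr//; have : 2 * V / eta < K%:R by apply: archi_boundP; exact: (divr_ge0 (mulr_ge0 (ler0n _ 2) V0) (ltW eta0)).
  by move=> /lt_trans; apply; rewrite ltr_nat.
pose B (j : nat) : set RnT := [set x : vec | j.+1%:R * eta <= v x + V].
have mB j : measurable (B j).
  have mv : measurable_fun setT ((fun x => v x + V) : RnT -> R) by apply: measurable_funD => //; exact: rtest_meas.
  have := mv measurableT _ (measurable_itv `[j.+1%:R * eta, +oo[).
  by rewrite setTI; congr measurable; apply/seteqP; split => x /=; rewrite in_itv /= andbT.
have [as1 as2] := ext_set_sum M0 lD lZ lM K mB.
have aT := l1approx_indic (@measurableT _ RnT).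
(* The superlevel sets are those of [v + V], which is nonnegative; the term [- V] on the whole space
   undoes the shift. *)
pose g x := (- V) * (\1_[set: RnT] x * G x) + eta * \sum_(0 <= i < K) \1_(B i) x * G x.
have ag : l1approx g by apply: l1approxD; exact: l1approxZ.
have ig := ag.1.
have Eg : ext l M g = rint (fun x => h x * g x).
  rewrite (extD M0 lD lZ lM (l1approxZ _ aT) (l1approxZ _ as1)) (extZ M0 lD lZ lM _ aT) (extZ M0 lD lZ lM _ as1) as2.
  have i1 : rintg (fun x => h x * (\1_[set: RnT] x * G x)) := rintg_bounded_mul aT.1 mh hM.
  have i2 j : rintg (fun x => h x * (\1_(B j) x * G x)) := rintg_bounded_mul (rintg_indic iG (mB j)) mh hM.
  rewrite (hE _ measurableT) (eq_bigr (fun j => rint (fun x => h x * (\1_(B j) x * G x)))); last by move=> j _; exact: hE.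
  rewrite -(rint_sum _ i2) -(rintZ _ i1) -rintZ; last exact: rintg_sum.
  rewrite -rintD; [|exact: rintgZ|by apply: rintgZ; exact: rintg_sum].
  congr rint; apply/funext => x; rewrite /g [RHS]mulrDr mulrCA; congr (_ + _).
  by rewrite [RHS]mulrCA; congr (_ * _); rewrite mulr_sumr.
have [ap lp] := ext_rtest M0 lD lZ lM Tphi.
pose d x := phi x + (-1) * g x.
have ad : l1approx d by apply: l1approxD => //; exact: l1approxZ.
have iphg : rintg (fun x => h x * g x) := rintg_bounded_mul ig mh hM.
have iphp : rintg (fun x => h x * phi x) := rintg_bounded_mul ip mh hM.
have -> : l phi - rint (fun x => h x * phi x) = ext l M d - rint (fun x => h x * d x).
  rewrite (extD M0 lD lZ lM ap (l1approxZ _ ag)) (extZ M0 lD lZ lM _ ag) lp Eg.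
  rewrite (_ : (fun x => h x * d x) = fun x => h x * phi x + (-1) * (h x * g x)); last by apply/funext => x; rewrite /d; ring.
  by rewrite rintD ?rintZ//; [ring|exact: rintgZ].
have dle x : `|d x| <= eta * G x.
  have -> : d x = ((v x + V) - eta * \sum_(0 <= j < K) (j.+1%:R * eta <= v x + V)%R%:R) * G x.
    have vG : v x * G x = phi x by rewrite /v -mulrA GG mulr1.
    have iT : \1_[set: RnT] x = 1 :> R by rewrite indicE in_setT.
    rewrite mulrBl mulrDl vG /d /g iT.
    rewrite (eq_bigr (fun j => (j.+1%:R * eta <= v x + V)%R%:R * G x)); last first.
      move=> j _; rewrite indicE; suff -> : (x \in B j) = (j.+1%:R * eta <= v x + V) by [].
      by apply/idP/idP => [/set_mem|H]; [|exact: mem_set].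
    by rewrite -mulr_suml; move: (\sum_(0 <= j < K) _) => S; ring.
  rewrite normrM (gtr0_norm (G0 x)) ler_wpM2r ?(ltW (G0 x))//; apply: layer_cake => //.
    by have := vV x; rewrite ler_norml => /andP[]; lra.
  by apply: le_lt_trans VK; have := vV x; rewrite ler_norml => /andP[]; lra.
have dJ : rint (fun x => `|d x|) <= eta * J.
  by rewrite -rintZ//; apply: le_rint => //; [exact: rintg_norm ad.1|exact: rintgZ].
apply: le_trans (ler_normB _ _) _.
apply: le_trans (lerD (ext_le M0 lD lZ lM ad.1) (le_cabs_rint ad.1 mh hM)) _.
rewrite -mulr2n -mulr_natl; apply: (@le_trans _ _ (2 * (M * (eta * J)))); first by rewrite ler_wpM2l// ler_wpM2l.
rewrite (_ : 2 * _ = e * ((2 * M * J) / (2 * M * J + 1))); last by rewrite /eta; field; rewrite gt_eqF.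
by rewrite ler_piMr ?(ltW e0)// ler_pdivrMr// mul1r lerDl.
Qed.

End l1_dual.

(** * The complex representation with the sharp bound *)

Section tempered_l1_dual.
Context {R : realType} {n : nat}.
Notation vec := 'rV[R]_n.+1.
Local Notation RnT := (Rn (R:=R) (n:=n.+1)).
Local Notation lam := (@lam R n.+1).
Notation Re := complex.Re.
Notation Im := complex.Im.
Implicit Types (g h phi : vec -> R) (psi : vec -> R[i]).

(** The choice of [p - i q] close to the conjugate of [z] turns the hypothesis into [|z|^2 <= M |z|]
    up to a small error. Rational directions suffice, so that in the application only countably many
    null sets are discarded. *)
Lemma cabs_le_directions (z : R[i]) (M : R) : 0 <= M ->
  (forall p q : rat, ratr p * Re z + ratr q * Im z <= M * cabs (Complex (ratr p) (- ratr q))) ->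
  cabs z <= M.
Proof.
move=> M0 H; have [->|z0] := eqVneq (cabs z) 0; first by [].
have zp : 0 < cabs z by rewrite lt_def z0 cabs_ge0.
rewrite -(ler_pM2r zp) -subr_le0; apply: ler0_eps => e e0.
(* Each of [p], [q] is within [d] of the corresponding part of [z], which costs [2 d (M + |z|) = e]
   in all. *)
pose d : R := e / (2 * (M + cabs z)).
have D0 : 0 < 2 * (M + cabs z) by rewrite mulr_gt0// ltr_wpDl.
have d0 : 0 < d by rewrite divr_gt0.
have ed : e = 2 * d * (M + cabs z) by rewrite /d; field; rewrite gt_eqF// ltr_wpDl.
have [p pP] : exists p : rat, ratr p \in `](Re z), (Re z + d)[ by apply: rat_in_itvoo; rewrite ltrDl.
have [q qP] : exists q : rat, ratr q \in `](Im z), (Im z + d)[ by apply: rat_in_itvoo; rewrite ltrDl.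
move: pP qP; rewrite !in_itv /= => /andP[p1 p2] /andP[q1 q2].
have := H p q; set P : R := ratr p in p1 p2 *; set Q : R := ratr q in q1 q2 *.
have E : Complex P (- Q) = Complex (Re z) (- Im z) + Complex (P - Re z) (Im z - Q).
  by apply/eqP; rewrite eq_complex /=; apply/andP; split; apply/eqP; ring.
have h1 : cabs (Complex (Re z) (- Im z)) = cabs z by rewrite /cabs /= sqrrN.
have h2 : cabs (Complex (P - Re z) (Im z - Q)) <= 2 * d.
  apply: le_trans (cabs_le_ReIm _) _; rewrite /= ger0_norm; last by lra.
  by rewrite ler0_norm; lra.
have h3 : cabs (Complex P (- Q)) <= cabs z + 2 * d by rewrite E (le_trans (cabsD _ _))// h1 lerD2l.
have h4 := ler_wpM2l M0 h3 => h5.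
have h6 : cabs z * cabs z = Re z * Re z + Im z * Im z.
  by rewrite -expr2 /cabs sqr_sqrtr ?addr_ge0 ?sqr_ge0// !expr2.
have h7 : `|(P - Re z) * Re z| <= d * cabs z.
  by rewrite normrM ler_pM// ?Re_le_cabs// ger0_norm; lra.
have h8 : `|(Q - Im z) * Im z| <= d * cabs z.
  by rewrite normrM ler_pM// ?Im_le_cabs// ger0_norm; lra.
rewrite h6 ed; move: h7 h8 h4 h5; rewrite !ler_norml => /andP[h7 _] /andP[h8 _].
rewrite !mulrBl in h7 h8; rewrite !mulrDr => h4 h5.
have := le_trans h5 h4; rewrite (_ : 2 * d * M + 2 * d * cabs z = M * (2 * d) + 2 * (d * cabs z)); last by ring.
move: (d * cabs z) (P * Re z) (Re z * Re z) (Q * Im z) (Im z * Im z) (M * cabs z) (M * (2 * d)) h7 h8.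
by move=> a1 a2 a3 a4 a5 a6 a7; clear; lra.
Qed.

(** The densities [h1], [h2] of the real and imaginary parts are each bounded by [M], which alone
    gives [sqrt 2 * M] for the modulus. For rational [p], [q] the combination [p h1 + q h2]
    represents the real part of [(p - i q) a], so it is at most [M |p - i q|] almost everywhere, and
    [cabs_le_directions] concludes. *)
Lemma tempered_l1_dual a (M : R) : tempered a -> 0 <= M ->
  (forall psi, test_fun psi -> cabs (a psi) <= M * rint (fun x => cabs (psi x))) ->
  exists f : vec -> R[i], [/\ cmeas f,
    exists N, [/\ measurable (N : set RnT), lam N = 0%E & forall x, ~ N x -> cabs (f x) <= M] &
    forall psi, test_fun psi -> cintg (fun x => f x * psi x) /\ cint (fun x => f x * psi x) = a psi].
Proof.
move=> Ta M0 aM; pose z (phi : vec -> R) : R[i] := a (fun x => (phi x)%:C).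
have Sr phi : rtest phi -> schwartz (fun x => (phi x)%:C) by move=> /rtest_test/test_schwartz.
have zD phi phi' : rtest phi -> rtest phi' -> z (fun x => phi x + phi' x) = z phi + z phi'.
  move=> Tp Tq; rewrite /z -(temperedD Ta (Sr _ Tp) (Sr _ Tq)).
  by congr a; apply/funext => x; rewrite rmorphD.
have zZ c phi : rtest phi -> z (fun x => c * phi x) = c%:C * z phi.
  by move=> Tp; rewrite /z -(temperedZ _ Ta (Sr _ Tp)); congr a; apply/funext => x; rewrite rmorphM.
have zM phi : rtest phi -> cabs (z phi) <= M * rint (fun x => `|phi x|).
  move=> Tp; apply: le_trans (aM _ (rtest_test Tp)) _.
  by under eq_fun do rewrite cabs_real.
have [h1 [mh1 h1M h1P]] : exists h : vec -> R, [/\ measurable_fun setT (h : RnT -> R), forall x, `|h x| <= M &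
    forall phi, rtest phi -> Re (z phi) = rint (fun x => h x * phi x)].
  apply: (real_l1_dual (l := fun phi => Re (z phi)) M0) => [p q Tp Tq|c p Tp|p Tp].
  - by rewrite zD// Re_add.
  - by rewrite zZ// Re_mul mul0r subr0.
  - exact: le_trans (Re_le_cabs _) (zM p Tp).
have [h2 [mh2 h2M h2P]] : exists h : vec -> R, [/\ measurable_fun setT (h : RnT -> R), forall x, `|h x| <= M &
    forall phi, rtest phi -> Im (z phi) = rint (fun x => h x * phi x)].
  apply: (real_l1_dual (l := fun phi => Im (z phi)) M0) => [p q Tp Tq|c p Tp|p Tp].
  - by rewrite zD// Im_add.
  - by rewrite zZ// Im_mul mul0r addr0.
  - exact: le_trans (Im_le_cabs _) (zM p Tp).
pose f x : R[i] := Complex (h1 x) (h2 x).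
have mf : cmeas f by split.
have rp psi : test_fun psi -> rtest (reparts psi) /\ rtest (imparts psi).
  move=> [[sR sI] [r pr]].
  split; split; [exact: sR|by exists r => x /pr H; rewrite /reparts H|exact: sI|].
  by exists r => x /pr H; rewrite /imparts H.
exists f; split => //.
- have dir (pq : rat * rat) : exists N, [/\ measurable (N : set RnT), lam N = 0%E &
      forall x, ~ N x -> ratr pq.1 * h1 x + ratr pq.2 * h2 x <= M * cabs (Complex (ratr pq.1 : R) (- ratr pq.2))].
    case: pq => p q /=; set P : R := ratr p; set Q : R := ratr q.
    apply: (rint_test_le_ae (C := (`|P| + `|Q|) * M)).
    + by apply: measurable_funD; exact: measurable_funM.
    + move=> x; apply: le_trans (ler_normD _ _) _; rewrite !normrM mulrDl.
      by apply: lerD; rewrite ler_wpM2l.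
    + move=> phi Tp; have ip := rtest_rintg Tp.
      have i1 : rintg (fun x => h1 x * phi x) := rintg_bounded_mul ip mh1 h1M.
      have i2 : rintg (fun x => h2 x * phi x) := rintg_bounded_mul ip mh2 h2M.
      have E : (fun x => (P * h1 x + Q * h2 x) * phi x) = fun x => P * (h1 x * phi x) + Q * (h2 x * phi x).
        by apply/funext => x; ring.
      rewrite E (rintD (rintgZ _ i1) (rintgZ _ i2)) !rintZ// -h1P// -h2P//.
      have -> : P * Re (z phi) + Q * Im (z phi) = Re (Complex P (- Q) * z phi).
        by rewrite Re_mul /= mulNr opprK.
      apply: le_trans (ler_norm _) _; apply: le_trans (Re_le_cabs _) _.
      rewrite cabsM -mulrA mulrCA ler_wpM2l ?cabs_ge0//; exact: zM.
    + by rewrite mulr_ge0 ?cabs_ge0.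
  have [N NP] := choice dir.
  (* The pairs of rationals are enumerated by [nat]; codes of no pair yield the empty set. *)
  pose F (k : nat) : set RnT := oapp N set0 (unpickle k).
  have FN pq : F (pickle pq) = N pq by rewrite /F pickleK.
  pose NN : set RnT := \bigcup_k F k.
  exists NN; split.
  + by apply: bigcupT_measurable => k; rewrite /F; case: (unpickle k) => [pq|]; [have [] := NP pq|exact: measurable0].
  + apply: bigcup_null => k; rewrite /F; case: (unpickle k) => [pq|]; last exact: lebesgue_outer0.
    by have [] := NP pq.
  + move=> x Nx; apply: cabs_le_directions => // p q; have [_ _] := NP (p, q); apply => H.
    by apply: Nx; exists (pickle (p, q)); [exact: I|rewrite FN].
- move=> psi Tpsi; have [Tp Tq] := rp psi Tpsi.
  have ip := rtest_rintg Tp; have iq := rtest_rintg Tq.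
  have i1p : rintg (fun x => h1 x * reparts psi x) := rintg_bounded_mul ip mh1 h1M.
  have i2p : rintg (fun x => h2 x * reparts psi x) := rintg_bounded_mul ip mh2 h2M.
  have i1q : rintg (fun x => h1 x * imparts psi x) := rintg_bounded_mul iq mh1 h1M.
  have i2q : rintg (fun x => h2 x * imparts psi x) := rintg_bounded_mul iq mh2 h2M.
  have eR : (fun x => Re (f x * psi x)) = fun x => h1 x * reparts psi x + (-1) * (h2 x * imparts psi x).
    by apply/funext => x; rewrite Re_mul mulN1r.
  have eI : (fun x => Im (f x * psi x)) = fun x => h1 x * imparts psi x + h2 x * reparts psi x.
    by apply/funext => x; rewrite Im_mul.
  split; first by split; rewrite ?eR ?eI; apply: rintgD => //; exact: rintgZ.
  have -> : a psi = z (reparts psi) + 'i%R * z (imparts psi).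
    rewrite /z -(temperedZ _ Ta (Sr _ Tq)) -(temperedD Ta (Sr _ Tp) (schwartzZ _ (Sr _ Tq))).
    by congr a; apply/funext => x; rewrite rect_complexE /reparts /imparts; case: (psi x).
  rewrite cintE eR eI rintD ?rintZ//; last exact: rintgZ.
  rewrite (rintD i1q i2p) -!h1P// -!h2P// iE.
  apply/eqP; rewrite eq_complex; apply/andP; split; apply/eqP.
    by rewrite Re_add Re_mul /= mul0r mul1r sub0r mulN1r.
  by rewrite Im_add Im_mul /= mul0r mul1r add0r addrC.
Qed.

End tempered_l1_dual.

(** * The constant multiplier *)

Section constant_multiplier.
Context {R : realType} {n : nat}.
Notation vec := 'rV[R]_n.+1.
Local Notation RnT := (Rn (R:=R) (n:=n.+1)).
Local Notation lam := (@lam R n.+1).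
Local Notation lo := (@lebesgue_outer R n.+1).
Notation Re := complex.Re.
Implicit Types u v g h d phi : vec -> R[i].

Lemma null_setU (N1 N2 : set vec) : lo N1 = 0%E -> lo N2 = 0%E -> lo (N1 `|` N2) = 0%E.
Proof.
move=> N10 N20; rewrite -bigcup2E; apply: bigcup_null => -[|[|k]] //=.
Qed.

Lemma cint_null u v (N : set vec) : lo N = 0%E -> (forall x, ~ N x -> u x = v x) -> cint u = cint v.
Proof. by move=> N0 uv; apply: cint_eq; apply: (rint_null N0) => x /uv ->. Qed.

(** Completeness: sets that agree off a null set have equal intersections with any [C] as far as the
    outer measure is concerned, so Caratheodory's identity carries over. *)
Lemma lebesgue_measurable_null (A B N : set vec) : lo N = 0%E -> (forall x, ~ N x -> (A x <-> B x)) ->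
  lebesgue_measurable_set B -> lebesgue_measurable_set A.
Proof.
move=> N0 AB mB C.
have le2 (X Y : set vec) : (forall x, ~ N x -> X x -> Y x) -> (lo X <= lo Y)%E.
  move=> XY; apply: (@le_trans _ _ (lo (Y `|` N))).
    apply: le_lebesgue_outer => x Xx; have [Nx|Nx] := pselect (N x); [by right|left; exact: XY].
  by apply: le_trans (outer_measureU2 lo Y N) _; rewrite [X in (_ + X <= _)%E]N0 adde0.
have e1 : lo (C `&` A) = lo (C `&` B).
  by apply/eqP; rewrite eq_le; apply/andP; split; apply: le2 => x Nx [Cx Ax]; split => //; apply/(AB x Nx).
have e2 : lo (C `\` A) = lo (C `\` B).
  by apply/eqP; rewrite eq_le; apply/andP; split; apply: le2 => x Nx [Cx Ax]; split => // H; apply: Ax; apply/(AB x Nx).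
by rewrite e1 e2; exact: mB.
Qed.

Lemma lmeas_cfun_borel g : lmeas_cfun g -> exists (h : vec -> R[i]) (N : set vec),
  [/\ cmeas h, lo N = 0%E & forall x, ~ N x -> g x = h x].
Proof.
move=> [/lmeas_rfun_borel[h1 [N1 [m1 _ N10 H1]]] /lmeas_rfun_borel[h2 [N2 [m2 _ N20 H2]]]].
exists (fun x => Complex (h1 x) (h2 x)), (N1 `|` N2); split; [by split|exact: null_setU|].
move=> x Nx; have n1 : ~ N1 x by move=> ?; apply: Nx; left.
have n2 : ~ N2 x by move=> ?; apply: Nx; right.
by rewrite -H1// -H2//; case: (g x).
Qed.

Lemma Mplus_ebs_lmeas g : lmeas_cfun g -> Mplus (ebs g).
Proof.
move=> /lmeas_cfun_borel[h [N [mh N0 gh]]]; split; last by move=> x; rewrite lee_fin cabs_ge0.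
move=> c; apply: (lebesgue_measurable_null N0 _ ((Mplus_ebs mh).1 c)) => x Nx.
by rewrite /= /ebs gh.
Qed.

Lemma cintg_lint h : cmeas h -> (lint setT (fun x => (cabs (h x))%:E) < +oo)%E -> cintg h.
Proof.
move=> mh fin; apply: (cintg_le (k := fun x => cabs (h x))) => //.
apply/integrableP; split; first by apply/measurable_EFinP; exact: cmeas_cabs.
move: fin; rewrite /lint; congr (_ < _)%E; apply: eq_integral => x _ /=.
by rewrite ger0_norm ?cabs_ge0.
Qed.

(** A cutoff makes [d] integrable. Testing against approximate indicators shows that the real part
    of [c D] is nonpositive almost everywhere for [c = 1, -1, i, -i], hence [D = 0]; the cutoffs
    exhaust the space. *)
Lemma cint_test_eq0 d : cmeas d -> (forall phi, test_fun phi -> cintg (fun x => d x * phi x) /\ cint (fun x => d x * phi x) = 0) ->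
  exists N, lo N = 0%E /\ forall x, ~ N x -> d x = 0.
Proof.
move=> md dphi; have l2 : 1 < 2 :> R by rewrite ltr1n.
have [U [sU U01 U1 U0]] := @radial_cutoff R n 2 l2.
have Tw (j : nat) : test_fun (dcut U 0 (j.+1%:R : R)) by exact: (test_dcut sU U0 0 (ltr0Sn _ j)).
pose D (j : nat) x := d x * dcut U 0 (j.+1%:R : R) x.
have part (j : nat) (c : R[i]) : cabs c = 1 -> exists N, [/\ measurable (N : set RnT), lam N = 0%E & forall x, ~ N x -> Re (c * D j x) <= 0].
  move=> c1; have iD : cintg (D j) := (dphi _ (Tw j)).1.
  have icD := cintgZ c iD; apply: (nonpos_ae icD.1) => A mA.
  apply/ler_addgt0Pr => e e0; rewrite add0r.
  have iaD := cintg_cabs icD.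
  (* The weight is the modulus of [c * D j] itself, since [d] has no known bound by which an error
     in plain L^1 could be multiplied. *)
  have [p Tp Hp] := approximableP iaD (fun x => cabs_ge0 _) mA e0.
  have Tpw : test_fun (fun x => (p x)%:C * dcut U 0 (j.+1%:R : R) x).
    by apply: test_funM; [exact: (smooth_c_real Tp.1)|exact: Tw].
  have [ip0 p0] := dphi _ Tpw.
  have E : (fun x => c * (d x * ((p x)%:C * dcut U 0 (j.+1%:R : R) x))) = fun x => (p x)%:C * (c * D j x).
    by apply/funext => x; rewrite /D; ring.
  have icp := cintgZ c ip0; have : cint (fun x => (p x)%:C * (c * D j x)) = 0 by rewrite -E cintZ// p0 mulr0.
  move/(congr1 (@complex.Re R)); rewrite Re_cint.
  have ER : (fun x => Re ((p x)%:C * (c * D j x))) = fun x => p x * Re (c * D j x).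
    by apply/funext => x; rewrite Re_mul mul0r subr0.
  rewrite ER /= => rp0; have iRp : rintg (fun x => p x * Re (c * D j x)) by move: icp; rewrite E => -[]; rewrite ER.
  have iA := rintg_indic icD.1 mA.
  rewrite -[leLHS]subr0 -[X in _ - X]rp0.
  rewrite -(mulN1r (rint _)) -(rintZ _ iRp) -(rintD iA (rintgZ _ iRp)).
  apply: le_trans Hp; apply: le_rint; [exact: rintgD iA (rintgZ _ iRp)|exact: rintg_approx|] => x.
  rewrite mulN1r -mulrBl; apply: le_trans (ler_norm _) _; rewrite normrM ler_wpM2l//.
  exact: Re_le_cabs.
have all (j : nat) : exists N, lo N = 0%E /\ forall x, ~ N x -> D j x = 0.
  have i1 : cabs ('i%R : R[i]) = 1 by rewrite iE /cabs /= expr0n expr1n add0r sqrtr1.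
  have [N1 [_ N10 P1]] := part j 1 cabs1.
  have [N2 [_ N20 P2]] := part j (-1) (etrans (cabsN 1) cabs1).
  have [N3 [_ N30 P3]] := part j 'i%R i1.
  have [N4 [_ N40 P4]] := part j (- 'i%R) (etrans (cabsN _) i1).
  exists ((N1 `|` N2) `|` (N3 `|` N4)); split; first by apply: null_setU; exact: null_setU.
  move=> x Nx.
  have p1 : ~ N1 x by move=> ?; apply: Nx; left; left.
  have p2 : ~ N2 x by move=> ?; apply: Nx; left; right.
  have p3 : ~ N3 x by move=> ?; apply: Nx; right; left.
  have p4 : ~ N4 x by move=> ?; apply: Nx; right; right.
  have := P1 x p1; have := P2 x p2; have := P3 x p3; have := P4 x p4.
  rewrite mul1r mulN1r mulNr !Re_opp iE Re_mul /= mul0r mul1r sub0r.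
  move: (D j x) => [a b] /= h4 h3 h2 h1; apply/eqP; rewrite eq_complex /=.
  by apply/andP; split; apply/eqP; lra.
have [N NP] := choice all.
exists (\bigcup_j N j); split; first by apply: bigcup_null => j; exact: (NP j).1.
move=> x Nx; pose j := Num.bound (enorm x).
have := (NP j).2 x; rewrite /D (dcut_one l2 U1 (ltr0Sn _ j)) ?mulr1.
  by apply => H; apply: Nx; exists j.
rewrite /eball /= subr0; apply: (lt_le_trans (archi_boundP (enorm_ge0 x))).
by rewrite ler_nat.
Qed.

(** [mult_norm] admits every function that represents the distribution, so an upper bound for it
    needs this. As [g] is only Lebesgue measurable, a Borel version [h] takes its place first. *)
Lemma dist_is_fun_unique T g u : ccont u -> dist_is_fun T u -> dist_is_fun T g ->
  exists N, lo N = 0%E /\ forall x, ~ N x -> g x = u x.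
Proof.
move=> cu [_ Tu] [mg Tg]; have [h [N0 [mh N00 gh]]] := lmeas_cfun_borel mg.
have mu := ccont_cmeas cu.
have md : cmeas (fun x => h x + (-1) * u x) by apply: cmeasD => //; apply: cmeasM => //; exact: cmeas_cst.
have [phi Tphi|N [N_0 NP]] := cint_test_eq0 md.
  have [[_ gfin] gE] := Tg phi Tphi; have [_ uE] := Tu phi Tphi.
  have mphi := cintg_cmeas (schwartz_cintg (test_schwartz Tphi)).
  have iu : cintg (fun x => u x * phi x).
    by have := test_cintg_mul Tphi cu; under eq_fun do rewrite mulrC.
  have ih : cintg (fun x => h x * phi x).
    apply: (cintg_lint (cmeasM mh mphi)).
    by rewrite (lint_null N00 (g := fun x => (cabs (g x * phi x))%:E)) => [//|x /gh ->].
  have E : (fun x => (h x + (-1) * u x) * phi x) = fun x => h x * phi x - u x * phi x.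
    by apply/funext => x; ring.
  rewrite E; split; first exact: cintgB.
  rewrite cintB// (cint_null (v := fun x => g x * phi x) N00) => [|x /gh ->//].
  by rewrite gE uE subrr.
exists (N0 `|` N); split; first exact: null_setU.
move=> x Nx; have n1 : ~ N0 x by move=> ?; apply: Nx; left.
have n2 : ~ N x by move=> ?; apply: Nx; right.
by rewrite gh//; have /eqP := NP x n2; rewrite mulN1r subr_eq0 => /eqP.
Qed.

(** [cint], read as a functional on Schwartz functions, is the constant function 1 as a
    distribution. *)
Lemma tempered_cint : tempered (@cint R n.+1).
Proof.
split.
  move=> u v c Su Sv; have iu := schwartz_cintg Su; have iv := schwartz_cintg Sv.
  by rewrite (cintD iu (cintgZ c iv)) cintZ.
exists (rint (@weight R n)), (2 * n.+1)%N => u M Su uM.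
have uM' : snb (2 * n.+1) u M by move=> x al al_N; exact: uM.
rewrite mulrC -rintZ; last exact: rintg_weight.
apply: cabs_cint_le; [exact: cintg_cmeas (schwartz_cintg Su)|exact: snb_weight uM'|].
exact/rintgZ/rintg_weight.
Qed.

(** The multiplication formula moves the transform from [phi] onto [ft (-1) u], where inversion
    undoes it. *)
Lemma multiplier_cint u phi : schwartz u -> test_fun phi ->
  multiplier_op (@cint R n.+1) u phi = cint (fun x => u x * phi x).
Proof.
move=> Su Tphi; have Sphi := test_schwartz Tphi; have Sf := schwartz_ft normrN1R Su.
rewrite /multiplier_op fourier_ft ifourier_ft; set c := (_ ^- n.+1)%:C.
have ip := schwartz_cintg (schwartz_mul (schwartz_moderate Sf) (schwartz_ft (normr1 R) Sphi)).
rewrite (_ : (fun xi => _) = fun xi => c * (ft (-1) u xi * ft 1 phi xi)); last first.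
  by apply/funext => xi; rewrite mulrCA.
rewrite cintZ//.
have -> : cint (fun xi => ft (-1) u xi * ft 1 phi xi) = cint (fun y => phi y * ft 1 (ft (-1) u) y).
  have ftE v (xi : vec) : ft 1 v xi = cint (fun y => v y * expi (1 * dotp xi y)).
    by rewrite /ft; congr cint; apply/funext => y; rewrite dotpC.
  have -> : (fun xi => ft (-1) u xi * ft 1 phi xi) =
      fun xi => ft (-1) u xi * cint (fun y => phi y * expi (1 * dotp xi y)).
    by apply/funext => xi; rewrite [ft 1 _ _]ftE.
  exact: (cint_expi_swap 1 (schwartz_cintg Sf) (schwartz_cintg Sphi)).
have inv y : ft 1 (ft (-1) u) y = ((2 * pi) ^+ n.+1)%:C * u y.
  by have := ft_inversion y normrN1R Su; rewrite opprK.
under eq_fun do rewrite inv.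
have iup := schwartz_cintg (schwartz_mul (schwartz_moderate Su) Sphi).
rewrite (_ : (fun y => _) = fun y => ((2 * pi) ^+ n.+1)%:C * (u y * phi y)); last first.
  by apply/funext => y; rewrite mulrCA [phi y * _]mulrC.
by rewrite cintZ// mulrA c0_mul mul1r.
Qed.

Lemma multiplier_cint_dist u : schwartz u -> dist_is_fun (multiplier_op (@cint R n.+1) u) u.
Proof.
move=> Su; have cu := smooth_ccont (schwartz_smooth Su).
split; first exact: cmeas_lmeas (ccont_cmeas cu).
move=> phi Tphi; split; last by rewrite multiplier_cint.
apply: cintg_cintegrable; exact: schwartz_cintg (schwartz_mul (schwartz_moderate Su) (test_schwartz Tphi)).
Qed.

Lemma mult_norm_cint (rho : (vec -> \bar R) -> \bar R) : banach_function_norm rho ->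
  (mult_norm rho (@cint R n.+1) <= 1)%E.
Proof.
move=> bfn; apply: ge_ereal_sup => _ [u [g [Su ufin _ Tg ->]]].
have [N [N0 gu]] := dist_is_fun_unique (smooth_ccont (schwartz_smooth Su)) (multiplier_cint_dist Su) Tg.
have Mu : Mplus (ebs u) := Mplus_ebs (cintg_cmeas (schwartz_cintg Su)).
have Mg : Mplus (ebs g) := Mplus_ebs_lmeas Tg.1.
have [_ [_ [_ [A2 _]]]] := bfn.
have le : (rho (ebs g) <= rho (ebs u))%E.
  by apply: A2 => //; exists N; split => // x /gu; rewrite /ebs => ->.
have u0 := bfn_ge0 bfn Mu.
have uE : rho (ebs u) = (fine (rho (ebs u)))%:E by rewrite fineK// ge0_fin_numE.
set t := fine _ in uE *; have t0 : 0 <= t by rewrite -lee_fin -uE.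
apply: (@le_trans _ _ (t%:E * (t^-1)%:E)%E).
  by apply: lee_wpmul2r; [rewrite lee_fin invr_ge0|rewrite -uE].
(* If [t = 0], its inverse is 0 by convention and the quotient is 0. *)
rewrite -EFinM lee_fin; have [->|tn0] := eqVneq t 0; first by rewrite mul0r.
by rewrite mulfV.
Qed.

Lemma dist_is_fun_cint : dist_is_fun (@cint R n.+1) (fun=> 1).
Proof.
split; first exact: cmeas_lmeas (cmeas_cst 1).
move=> phi Tphi; have E : (fun x : vec => 1 * phi x) = phi by apply/funext => x; rewrite mul1r.
rewrite E; split => //; exact: cintg_cintegrable (schwartz_cintg (test_schwartz Tphi)).
Qed.

Lemma linf_norm_one : (1 <= linf_norm (fun _ : vec => 1%R : R[i]))%E.
Proof.
apply: le_ereal_inf_tmp => M [N [N0 NP]].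
have [x Nx] : exists x, ~ N x.
  apply: contrapT => H; have := lebesgue_outer_eball_gt0 (0 : vec) (@ltr01 R).
  rewrite -N0 ltNge => /negP; apply; apply: le_lebesgue_outer => x _.
  by apply: contrapT => Nx; apply: H; exists x.
by have := NP x Nx; rewrite cabs1.
Qed.

End constant_multiplier.

Unset Implicit Arguments.

Theorem theorem1p3 (R : realType) (n : nat)
    (rho : ('rV[R]_n -> \bar R) -> \bar R) :
  (1 <= n)%N ->
  banach_function_norm rho ->
  weak_doubling rho ->
  (forall a : ('rV[R]_n -> R[i]) -> R[i],
     in_mult_space rho a ->
     exists f : 'rV[R]_n -> R[i],
       dist_is_fun a f /\ (linf_norm f < +oo)%E /\
       (linf_norm f <= mult_norm rho a)%E) /\
  (forall c : R, c < 1 ->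
     exists a : ('rV[R]_n -> R[i]) -> R[i],
       in_mult_space rho a /\
       exists f : 'rV[R]_n -> R[i],
         dist_is_fun a f /\ (c%:E * mult_norm rho a < linf_norm f)%E).
Proof.
case: n rho => [//|n] rho _ bfn wd; split.
  move=> a [Ta afin]; have M0 := mult_norm_ge0 bfn Ta afin.
  have ME : mult_norm rho a = (fine (mult_norm rho a))%:E by rewrite fineK// ge0_fin_numE.
  have [f [mf [N [_ N0 NP]] fa]] := tempered_l1_dual Ta (fine_ge0 M0)
    (fun psi Tpsi => schwartz_L1_bound bfn wd Ta afin Tpsi).
  have le : (linf_norm f <= mult_norm rho a)%E.
    by rewrite ME; apply: ereal_inf_lbound; exists N; split => // x /NP.
  exists f; split; last by split => //; exact: le_lt_trans le afin.
  split; first exact: cmeas_lmeas.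
  by move=> psi Tpsi; have [i1 e1] := fa psi Tpsi; split => //; exact: cintg_cintegrable.
(* The extremal example: multiplier norm at most 1 against essential supremum at least 1. *)
move=> c c1; exists (@cint R n.+1); have Tc := @tempered_cint R n.
have m1 := mult_norm_cint bfn.
have mfin : (mult_norm rho (@cint R n.+1) < +oo)%E by exact: le_lt_trans m1 (ltry _).
have m0 := mult_norm_ge0 bfn Tc mfin.
split => //; exists (fun=> 1); split; first exact: dist_is_fun_cint.
apply: lt_le_trans (@linf_norm_one R n).
have ME : mult_norm rho (@cint R n.+1) = (fine (mult_norm rho (@cint R n.+1)))%:E by rewrite fineK// ge0_fin_numE.
rewrite ME; rewrite ME in m0 m1; move: m0 m1; set m := fine _; rewrite -EFinM !lee_fin lte_fin => m0 m1.
have [c0|c0] := leP 0 c; first by apply: le_lt_trans c1; rewrite ler_piMr.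
by apply: le_lt_trans ltr01; rewrite nmulr_rle0.
Qed.
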